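(* Let $c,\mu,\rho_{\max}>0$, $\varepsilon\in(0,\rho_{\max})$, $h$, $f$ and the set $X$ be as described in the context, and let $\rho_{eq}>0$ be the desired equilibrium density. Suppose that $$\rho_{eq} \le \frac{c}{c+f(\rho_{eq})}(\rho_{\max}-\varepsilon)$$ and that the following inequality holds: $$\left(v - f\left(\rho_{eq}\frac{c+f(\rho_{eq})}{c+v}\right)\right)\big(v - f(\rho_{eq})\big) > 0, \quad \text{for all } v\ge 0,\ v\ne f(\rho_{eq}).$$ Then there exists a function $Q\in KL$ such that for every $(\rho_0,v_0)\in X$ for which the equalities $$\rho_0(0) = \rho_{eq}\frac{c+f(\rho_{eq})}{c+v_0(0)}, \qquad \rho_0'(0) = -\frac{\rho_0(0)}{c+v_0(0)}\,v_0'(0)$$ hold, the initial-boundary value problem $$\frac{\partial\rho}{\partial t}(t,x) + v(t,x)\frac{\partial\rho}{\partial x}(t,x) + \rho(t,x)\frac{\partial v}{\partial x}(t,x) = 0, \qquad \frac{\partial v}{\partial t}(t,x) - c\,\frac{\partial v}{\partial x}(t,x) = 0, \quad \text{for } (t,x)\in\mathbb{R}_+\times[0,1],$$ $$\rho(t,0) = h\left(\frac{q(t)}{v(t,0)}\right), \qquad \frac{\partial v}{\partial t}(t,1) = -\mu\big(v(t,1) - f(\rho(t,1))\big), \quad \text{for } t\ge 0,$$ with $$q(t) = \rho_{eq}\,v(t,0)\,\frac{c+f(\rho_{eq})}{c+v(t,0)}, \quad t\ge 0,$$ and $$\rho(0,x)-\rho_0(x) = v(0,x)-v_0(x) = 0,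 \quad \text{for all } x\in[0,1],$$ admits a unique solution $\rho,v\in C^1(\mathbb{R}_+\times[0,1])$, with $(\rho[t],v[t])\in X$ for all $t\ge 0$, satisfying the following estimate for all $t\ge 0$: $$\max_{0\le x\le 1}\left(\left|\ln\left(\frac{\rho(t,x)}{\rho_{eq}}\right)\right|\right) + \max_{0\le x\le 1}\left(\left|\ln\left(\frac{v(t,x)}{f(\rho_{eq})}\right)\right|\right) \le Q\left(\max_{0\le x\le 1}\left(\left|\ln\left(\frac{\rho_0(x)}{\rho_{eq}}\right)\right|\right) + \max_{0\le x\le 1}\left(\left|\ln\left(\frac{v_0(x)}{f(\rho_{eq})}\right)\right|\right),\ t\right).$$
   Context: $\mathbb{R}_+ := [0,+\infty)$. Standing data of the traffic flow model: $c>0$, $\mu>0$, $\rho_{\max}>0$ are constants and $\varepsilon\in(0,\rho_{\max})$ is a (sufficiently small) constant; $h\in C^2(\mathbb{R}_+)$ is a non-decreasing function satisfying $h(s)=s$ for $s\in[0,\rho_{\max}-\varepsilon]$ and $h(s)=\rho_{\max}$ for $s\ge\rho_{\max}$; $f\in C^1(\mathbb{R}_+)$ is a positive, bounded, non-increasing function. Here $\rho(t,x)$ is the vehicle density, $v(t,x)$ the vehicle velocity, and $q(t)$ the inlet demand (control input). The model comes with the requirement that $\rho(t,x)>0$ and $v(t,x)>0$ for all $(t,x)\in\mathbb{R}_+\times[0,1]$. $W^{2,\infty}([0,1])$ is the space of $C^1$ functions on $[0,1]$ with Lipschitz derivative. The state space is $$X = \left\{(\rho,v)\in \left(W^{2,\infty}([0,1])\right)^2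 : \begin{array}{l} \min(\rho(x),v(x))>0 \text{ for all } x\in[0,1],\\ c\,v'(1) = -\mu\big(v(1)-f(\rho(1))\big),\\ \exists\, a_1>0,\ a_2\in\mathbb{R} \text{ such that } \rho(0)=h(a_1),\ v(0)\rho'(0)+\rho(0)v'(0)=a_2 h'(a_1)\end{array}\right\}.$$ For a function $u$ on $\mathbb{R}_+\times[0,1]$, $u[t]$ denotes the profile at time $t$: $(u[t])(x)=u(t,x)$ for $x\in[0,1]$. $K$ is the class of strictly increasing continuous functions $\alpha:\mathbb{R}_+\to\mathbb{R}_+$ with $\alpha(0)=0$. $KL$ is the set of all continuous functions $\sigma:\mathbb{R}_+\times\mathbb{R}_+\to\mathbb{R}_+$ such that: (i) for each $t\ge 0$, $\sigma(\cdot,t)$ is of class $K$; (ii) for each $s\ge 0$, $\sigma(s,\cdot)$ is non-increasing with $\lim_{t\to+\infty}\sigma(s,t)=0$. *)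

(* Defs.v *)
From Stdlib Require Import Reals.
From Coquelicot Require Import Coquelicot.
Open Scope R_scope.

Definition Rnneg (s : R) : Prop := 0 <= s.
Definition I01 (x : R) : Prop := 0 <= x <= 1.
Definition Omega (p : R * R) : Prop := Rnneg (fst p) /\ I01 (snd p).

(* Functions on a subset [D] of [R] (or of [R * R]) are represented by total
   functions of which only the values on [D] are ever used.  Derivatives are
   relative to [D], hence one-sided at the end points of an interval.
   [Derive_in] and [max01] below are junk when the derivative, resp. the
   maximum, does not exist. *)
Definition ex_derive_in (D : R -> Prop) (u : R -> R) (x : R) : Prop :=
  exists l : R, D_in u (fun _ => l) D x.

Definition Derive_in (D : R -> Prop) (u : R -> R) (x : R) : R :=
  iota (fun l : R => D_in u (fun _ => l) D x).

Definition C1_on (D : R -> Prop) (u : R -> R) : Prop :=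
  (forall x, D x -> ex_derive_in D u x) /\ continuous_on D (Derive_in D u).

Definition C2_on (D : R -> Prop) (u : R -> R) : Prop :=
  C1_on D u /\ C1_on D (Derive_in D u).

Definition W2inf (u : R -> R) : Prop :=
  C1_on I01 u /\
  exists L : R, forall x y, I01 x -> I01 y ->
    Rabs (Derive_in I01 u x - Derive_in I01 u y) <= L * Rabs (x - y).

Definition Dt (u : R -> R -> R) (t x : R) : R :=
  Derive_in Rnneg (fun s => u s x) t.

Definition Dx (u : R -> R -> R) (t x : R) : R :=
  Derive_in I01 (fun y => u t y) x.

Definition C1_Omega (u : R -> R -> R) : Prop :=
  continuous_on Omega (fun p : R * R => u (fst p) (snd p)) /\
  (forall t x, Omega (t, x) ->
     ex_derive_in Rnneg (fun s => u s x) t /\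
     ex_derive_in I01 (fun y => u t y) x) /\
  continuous_on Omega (fun p : R * R => Dt u (fst p) (snd p)) /\
  continuous_on Omega (fun p : R * R => Dx u (fst p) (snd p)).

Definition is_max01 (u : R -> R) (m : R) : Prop :=
  (exists x, I01 x /\ u x = m) /\ (forall x, I01 x -> u x <= m).

Definition max01 (u : R -> R) : R := iota (is_max01 u).

Definition class_K (alpha : R -> R) : Prop :=
  (forall s, Rnneg s -> Rnneg (alpha s)) /\
  continuous_on Rnneg alpha /\
  (forall s1 s2, Rnneg s1 -> s1 < s2 -> alpha s1 < alpha s2) /\
  alpha 0 = 0.

Definition class_KL (sigma : R -> R -> R) : Prop :=
  (forall s t, Rnneg s -> Rnneg t -> Rnneg (sigma s t)) /\
  continuous_on (fun p : R * R => Rnneg (fst p) /\ Rnneg (snd p))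
    (fun p : R * R => sigma (fst p) (snd p)) /\
  (forall t, Rnneg t -> class_K (fun s => sigma s t)) /\
  (forall s, Rnneg s ->
     (forall t1 t2, Rnneg t1 -> t1 <= t2 -> sigma s t2 <= sigma s t1) /\
     is_lim (sigma s) p_infty 0).

Definition inlet_function (rho_max eps : R) (h : R -> R) : Prop :=
  C2_on Rnneg h /\
  (forall s1 s2, Rnneg s1 -> s1 <= s2 -> h s1 <= h s2) /\
  (forall s, 0 <= s <= rho_max - eps -> h s = s) /\
  (forall s, rho_max <= s -> h s = rho_max).

Definition speed_function (f : R -> R) : Prop :=
  C1_on Rnneg f /\
  (forall s, Rnneg s -> 0 < f s) /\
  (exists M : R, forall s, Rnneg s -> f s <= M) /\
  (forall s1 s2, Rnneg s1 -> s1 <= s2 -> f s2 <= f s1).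

Definition state_space (c mu : R) (h f : R -> R) (rho v : R -> R) : Prop :=
  W2inf rho /\ W2inf v /\
  (forall x, I01 x -> Rmin (rho x) (v x) > 0) /\
  c * Derive_in I01 v 1 = - mu * (v 1 - f (rho 1)) /\
  (exists a1 a2 : R, a1 > 0 /\
     rho 0 = h a1 /\
     v 0 * Derive_in I01 rho 0 + rho 0 * Derive_in I01 v 0
       = a2 * Derive_in Rnneg h a1).

Definition traffic_IBVP (c mu : R) (h f q : R -> R) (rho0 v0 : R -> R)
    (rho v : R -> R -> R) : Prop :=
  (forall t x, Omega (t, x) ->
     Dt rho t x + v t x * Dx rho t x + rho t x * Dx v t x = 0 /\
     Dt v t x - c * Dx v t x = 0) /\
  (forall t, Rnneg t ->
     rho t 0 = h (q t / v t 0) /\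
     Dt v t 1 = - mu * (v t 1 - f (rho t 1))) /\
  (forall x, I01 x -> rho 0 x - rho0 x = 0 /\ v 0 x - v0 x = 0).

Definition feedback (c rho_eq : R) (f : R -> R) (v : R -> R -> R) (t : R) : R :=
  rho_eq * v t 0 * ((c + f rho_eq) / (c + v t 0)).

Definition closed_loop_solution (c mu rho_eq : R) (h f : R -> R)
    (rho0 v0 : R -> R) (rho v : R -> R -> R) : Prop :=
  C1_Omega rho /\ C1_Omega v /\
  (forall t, Rnneg t -> state_space c mu h f (rho t) (v t)) /\
  traffic_IBVP c mu h f (feedback c rho_eq f v) rho0 v0 rho v.

Definition deviation (rho_eq v_eq : R) (rho v : R -> R) : R :=
  max01 (fun x => Rabs (ln (rho x / rho_eq))) +
  max01 (fun x => Rabs (ln (v x / v_eq))).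

(* Main.v *)
Require Import Defs.
From Stdlib Require Import Reals ssreflect Lra Lia Classical ClassicalChoice.
From Coquelicot Require Import Coquelicot.
(* [Reals] exports another [Dx]. *)
Import Defs.
Open Scope R_scope.

(* The product z = rho (c + v) is constant along dx/dt = v, and the feedback
   makes it equal to A = rho_eq (c + f rho_eq) at the inlet.  As v solves
   v_t = c v_x, it has the form v(t, x) = w(t + x/c), so that with
   G' = c / (c + w) the label G(t + x/c) - t is constant along the same
   characteristics.  Hence rho (c + v) = Z(G(t + x/c) - t), where Z is determined
   by the initial data and equals A on the negative labels, those of the
   characteristics that enter through the inlet.  What remains is a planar
   Lipschitz differential equation for the outlet speed y(t) = v(t, 1) and the
   outlet label r(t) = G(t + 1/c) - t,
     y' = - mu (y - f(Z(r) / (c + y))),   r' = - y / (c + y),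
   which gives existence and uniqueness.  After a time controlled by the initial
   deviation r is negative, and then y solves a scalar autonomous equation for
   which f(rho_eq) is globally attractive by the sign condition.  The KL estimate
   is the flow of a Lipschitz lower bound of the resulting decay rate, started
   from a class K bound of the transient. *)

(** * Derivatives relative to an interval *)

(** The characteristics of the density depend on the unknown speed. The label removes this
    difficulty: [G(t + x/c) - t] is explicit once [w] is known, so no fixed point over curves is
    needed, and the outlet condition, which couples density and speed at x = 1, becomes an ordinary
    differential equation. Smoothness is decided at two corners. At the label 0, the two equalities
    imposed on [rho0] make [Z] and its derivative match the constant [A]. At the argument 1/c of
    [w], the outlet condition in the state space makes the slope of the initial speed match that of
    [y]. The upper bound on [rho_eq] gives A/c <= rho_max - eps, so the inlet value A/(c + v) stays
    where [h] is the identity and the feedback never saturates. For the estimate the obstacle is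
    uniformity: Q is chosen before the initial data, so the lower speed bound, the time that empties
    the road and all constants may depend on the data only through the deviation d. For d <= 1 a
    common Lipschitz constant yields a bound that vanishes with d; for larger d the boundedness of
    [f] suffices. *)

Record unit_retract (D : R -> Prop) (p : R -> R) : Prop := {
  retract_in : forall x, D (p x);
  retract_id : forall x, D x -> p x = x;
  retract_contract : forall x y, Rabs (p x - p y) <= Rabs (x - y);
  retract_convex : forall a b x, D a -> D b -> a <= x <= b -> D x;
  retract_0 : D 0;
  retract_1 : D 1 }.

(** Nearest-point projections onto the two intervals of the problem. Composition with one of them
    turns a function on the interval into a total function that depends only on its values there. *)
Definition pos_part (x : R) : R := Rmax 0 x.
Definition clamp01 (x : R) : R := Rmax 0 (Rmin 1 x).

Lemma pos_part_retract : unit_retract Rnneg pos_part.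
Proof.
  unfold Rnneg, pos_part; split; intros; try lra;
  unfold Rmax in *; repeat destruct Rle_dec; try lra; unfold Rabs; repeat destruct Rcase_abs; lra.
Qed.

Lemma clamp01_retract : unit_retract I01 clamp01.
Proof.
  unfold I01, clamp01; split; intros; try lra;
  unfold Rmax, Rmin in *; repeat destruct Rle_dec; try lra; unfold Rabs; repeat destruct Rcase_abs; lra.
Qed.

(** Convexity and the points 0 and 1 provide points of [D] arbitrarily close to x: towards 1 if x <
    1, towards 0 otherwise. Limits along [D] are therefore unique. *)
Lemma D_in_unique D p u l1 l2 x : unit_retract D p -> D x ->
  D_in u (fun _ => l1) D x -> D_in u (fun _ => l2) D x -> l1 = l2.
Proof.
  intros hp hx h1 h2.
  refine (single_limit _ _ _ _ _ _ h1 h2).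
  intros d hd.
  destruct (Rlt_le_dec x 1) as [h|h].
  - exists (x + Rmin (d / 2) (1 - x)).
    assert (0 < Rmin (d / 2) (1 - x) <= 1 - x /\ Rmin (d / 2) (1 - x) <= d / 2) as [h3 h4].
    { split; [split|]. apply Rmin_pos; lra. apply Rmin_r. apply Rmin_l. }
    split; [split|].
    + apply (retract_convex _ _ hp x 1); auto. apply (retract_1 _ _ hp). lra.
    + lra.
    + simpl; unfold R_dist; rewrite Rabs_pos_eq; lra.
  - exists (x - Rmin (d / 2) x).
    assert (0 < Rmin (d / 2) x <= x /\ Rmin (d / 2) x <= d / 2) as [h3 h4].
    { split; [split|]. apply Rmin_pos; lra. apply Rmin_r. apply Rmin_l. }
    split; [split|].
    + apply (retract_convex _ _ hp 0 x); auto. apply (retract_0 _ _ hp). lra.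
    + lra.
    + simpl; unfold R_dist; rewrite Rabs_left; lra.
Qed.

Lemma Derive_in_eq D p u l x : unit_retract D p -> D x ->
  D_in u (fun _ => l) D x -> Derive_in D u x = l.
Proof.
  intros hp hx h. apply (iota_unique (V := R_CompleteNormedModule)); auto.
  intros y hy. exact (D_in_unique D p u y l x hp hx hy h).
Qed.

Lemma Derive_in_correct D p u x : unit_retract D p -> D x ->
  ex_derive_in D u x -> D_in u (fun _ => Derive_in D u x) D x.
Proof. intros hp hx [l h]. now rewrite (Derive_in_eq D p u l x). Qed.

Lemma is_derive_D_in D u x l : is_derive u x l -> D_in u (fun _ => l) D x.
Proof.
  intros h. apply is_derive_Reals in h.
  intros e he. destruct (h e he) as [d hd].
  exists d; split; [apply cond_pos|].
  intros y [[_ hy] h2]; simpl in *; unfold R_dist in *.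
  replace y with (x + (y - x)) at 1 by ring.
  apply hd; auto. lra.
Qed.

Lemma D_in_is_derive (D : R -> Prop) u l x : locally x D -> D_in u (fun _ => l) D x -> is_derive u x l.
Proof.
  intros [d hd] h. apply is_derive_Reals. intros e he.
  destruct (h e he) as [a [ha h2]].
  assert (hm : 0 < Rmin a d) by (apply Rmin_pos; [auto|apply cond_pos]).
  exists (mkposreal _ hm). simpl. intros k hk hk2.
  assert (Rmin a d <= a /\ Rmin a d <= d) by (split; [apply Rmin_l|apply Rmin_r]).
  specialize (h2 (x + k)). simpl in h2; unfold R_dist in h2.
  replace (x + k - x) with k in h2 by ring. apply h2. split; [split|].
  - apply hd. unfold ball; simpl; unfold AbsRing_ball, abs, minus, plus, opp; simpl.
    replace (x + k + - x) with k by ring. lra.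
  - lra.
  - lra.
Qed.

Lemma D_in_continuous_on (D : R -> Prop) u :
  (forall x, D x -> ex_derive_in D u x) -> continuous_on D u.
Proof.
  intros h x hx. destruct (h x hx) as [l hl].
  pose proof (cont_deriv u (fun _ => l) D x hl) as hc.
  intros P [e he].
  destruct (hc e (cond_pos e)) as [a [ha h2]].
  exists (mkposreal a ha). intros y hy hDy. apply he.
  destruct (Req_dec x y) as [->|hne]. apply ball_center.
  apply (h2 y). split. split; auto. exact hy.
Qed.

Lemma continuous_on_retract {T U : UniformSpace} (D : T -> Prop) (f : T -> U) (p : T -> T) x :
  continuous_on D f -> (forall y, D (p y)) -> continuous p x ->
  continuous (fun y => f (p y)) x.
Proof.
  intros hf hD hp P hP.
  specialize (hf (p x) (hD x) P hP).
  specialize (hp _ hf). unfold filtermap in *.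
  apply: filter_imp hp. simpl. intros y hy. apply hy, hD.
Qed.

Lemma contract_continuous (p : R -> R) L x :
  (forall x y, Rabs (p x - p y) <= L * Rabs (x - y)) -> continuous p x.
Proof.
  intros h P [e he].
  assert (hL : 0 < Rabs L + 1) by (pose proof (Rabs_pos L); lra).
  assert (hd : 0 < e / (Rabs L + 1)) by (apply Rdiv_lt_0_compat; [apply cond_pos|auto]).
  exists (mkposreal _ hd). intros y hy. apply he.
  unfold ball in *; simpl in *; unfold AbsRing_ball, abs, minus, plus, opp in *; simpl in *.
  specialize (h y x). unfold Rminus in h.
  apply Rle_lt_trans with (1 := h).
  apply Rle_lt_trans with ((Rabs L + 1) * Rabs (y + - x)).
  - apply Rmult_le_compat_r. apply Rabs_pos. pose proof (Rle_abs L); lra.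
  - apply Rlt_le_trans with ((Rabs L + 1) * (e / (Rabs L + 1))).
    apply Rmult_lt_compat_l; auto. right; field; lra.
Qed.

Lemma retract_continuous D p x : unit_retract D p -> continuous p x.
Proof.
  intros hp. apply (contract_continuous p 1). intros a b. rewrite Rmult_1_l. apply (retract_contract _ _ hp).
Qed.

Lemma is_derive_primitive (g : R -> R) a x : (forall y, continuous g y) ->
  is_derive (fun y => RInt g a y) x (g x).
Proof.
  intros hg. apply (is_derive_RInt g _ a x); auto.
  apply filter_forall. intros y. apply (RInt_correct (V := R_CompleteNormedModule)).
  apply ex_RInt_continuous; auto.
Qed.

Lemma MVT_le (u du : R -> R) a b : a <= b ->
  (forall x, a < x < b -> is_derive u x (du x)) -> (forall x, a <= x <= b -> continuous u x) ->
  exists x, a <= x <= b /\ u b - u a = du x * (b - a).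
Proof.
  intros hab hd hc.
  assert (e1 := Rmin_left a b hab). assert (e2 := Rmax_right a b hab).
  pose proof (MVT_gen u a b du) as H. simpl in H. rewrite e1 e2 in H.
  apply H; auto. intros; apply continuity_pt_filterlim, hc; auto.
Qed.

Lemma is_derive_eq (u : R -> R) (x l l' : R) : is_derive u x l -> l = l' -> is_derive u x l'.
Proof. now intros h <-. Qed.

Lemma derive_0_const (u : R -> R) a b : a <= b ->
  (forall x, a < x < b -> is_derive u x 0) -> (forall x, a <= x <= b -> continuous u x) ->
  u a = u b.
Proof.
  intros hab hd hc.
  destruct (MVT_le u (fun _ => 0) a b) as [x [_ hx]]; auto. lra.
Qed.

(** The extension integrates the derivative composed with the projection; for the two intervals at
    hand it is affine outside [D]. It replaces one-sided derivatives by [is_derive], so that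
    calculus on the line applies up to the end points. *)
Lemma C1_extension D p u : unit_retract D p -> C1_on D u ->
  (forall x, continuous (fun y => Derive_in D u (p y)) x) /\
  exists U : R -> R,
    (forall x, is_derive U x (Derive_in D u (p x))) /\ (forall x, D x -> U x = u x).
Proof.
  intros hp [h1 h2].
  assert (hg : forall x, continuous (fun y => Derive_in D u (p y)) x).
  { intros x. apply continuous_on_retract with (D := D); auto. apply hp. eapply retract_continuous; eauto. }
  split; auto.
  set (g := fun y => Derive_in D u (p y)) in *.
  assert (hup : forall x, continuous (fun y => u (p y)) x).
  { intros x. apply continuous_on_retract with (D := D); auto using D_in_continuous_on. apply hp.
    eapply retract_continuous; eauto. }
  assert (hG : forall x, is_derive (fun y => u (p 0) + RInt g 0 y) x (g x)).
  { intros x. replace (g x) with (0 + g x) by ring.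
    apply: is_derive_plus. apply: is_derive_const. now apply is_derive_primitive. }
  exists (fun y => u (p 0) + RInt g 0 y). split; auto.
  assert (hc : forall x, continuous (fun y => u (p y) - (u (p 0) + RInt g 0 y)) x).
  { intros x. apply: continuous_minus; auto. apply: ex_derive_continuous. exists (g x). apply hG. }
  assert (key : forall a b, D a -> D b -> a <= b ->
    u (p a) - (u (p 0) + RInt g 0 a) = u (p b) - (u (p 0) + RInt g 0 b)).
  { intros a b ha hb hab.
    apply (derive_0_const (fun y => u (p y) - (u (p 0) + RInt g 0 y))); auto.
    intros x hx.
    assert (hDx : D x) by (apply (retract_convex _ _ hp a b); auto; lra).
    assert (hl : locally x D).
    { apply (filter_imp (fun y => a < y /\ y < b)).
      intros y hy. apply (retract_convex _ _ hp a b); auto; lra.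
      apply filter_and; [apply open_gt|apply open_lt]; lra. }
    apply (is_derive_eq _ _ (g x - g x)); [|ring]. apply: is_derive_minus; auto.
    assert (hd : is_derive u x (g x)).
    { apply (D_in_is_derive D); auto. unfold g. rewrite (retract_id _ _ hp x hDx).
      apply (Derive_in_correct D p); auto. }
    apply is_derive_ext_loc with (2 := hd). apply: filter_imp hl.
    intros y hy. rewrite (retract_id _ _ hp); auto. }
  assert (h0 : RInt g 0 0 = 0) by apply: RInt_point.
  intros x hx.
  pose proof (retract_id _ _ hp x hx) as e1.
  destruct (Rle_dec 0 x) as [h|h].
  - specialize (key 0 x (retract_0 _ _ hp) hx h). rewrite h0 e1 in key. lra.
  - specialize (key x 0 hx (retract_0 _ _ hp) ltac:(lra)). rewrite h0 e1 in key. lra.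
Qed.

(** * Monotonicity and the Gronwall inequality *)

Lemma derive_nonpos_le (u u' : R -> R) a b : a <= b ->
  (forall x, a <= x <= b -> is_derive u x (u' x)) -> (forall x, a <= x <= b -> u' x <= 0) ->
  u b <= u a.
Proof.
  intros hab hd hn.
  destruct (MVT_le u u' a b) as [x [hx e]]; auto.
  - intros; apply hd; lra.
  - intros x hx; apply (ex_derive_continuous u). exists (u' x); auto.
  - pose proof (hn x hx). nra.
Qed.

Lemma is_derive_pos_part_sqr x : is_derive (fun y => pos_part y ^ 2) x (2 * pos_part x).
Proof.
  unfold pos_part. destruct (Rtotal_order x 0) as [h|[e|h]].
  - rewrite Rmax_left; [|lra]. rewrite Rmult_0_r.
    apply is_derive_ext_loc with (fun _ => 0). 2: apply: is_derive_const.
    apply: filter_imp (open_lt 0 x h). intros y hy. rewrite Rmax_left; lra.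
  - subst x. rewrite Rmax_left; [|lra]. apply is_derive_Reals. intros e he.
    exists (mkposreal e he). simpl. intros k hk hk2.
    replace (((Rmax 0 (0 + k) * (Rmax 0 (0 + k) * 1) - Rmax 0 0 * (Rmax 0 0 * 1)) / k - 2 * 0))
      with (Rmax 0 k * (Rmax 0 k / k)).
    2: { rewrite Rplus_0_l (Rmax_left 0 0); [|lra]. field; auto. }
    unfold Rmax; destruct Rle_dec.
    + unfold Rdiv; rewrite Rinv_r; [|auto]. rewrite Rmult_1_r. exact hk2.
    + rewrite Rmult_0_l Rabs_R0; auto.
  - rewrite Rmax_right; [|lra].
    apply is_derive_ext_loc with (fun y => y ^ 2). 2: auto_derive; [auto|ring].
    apply: filter_imp (open_gt 0 x h). intros y hy. rewrite Rmax_right; lra.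
Qed.

(* [max(u, 0)^2 e^(-2Lt)] is continuously differentiable and non-increasing. *)
Lemma gronwall_nonpos (u u' : R -> R) L :
  (forall t, 0 <= t -> is_derive u t (u' t)) ->
  (forall t, 0 <= t -> 0 < u t -> u' t <= L * u t) ->
  u 0 <= 0 -> forall t, 0 <= t -> u t <= 0.
Proof.
  intros hd hL h0 t ht.
  assert (H : pos_part (u t) ^ 2 * exp (- (2 * L * t)) <= pos_part (u 0) ^ 2 * exp (- (2 * L * 0))).
  { apply (derive_nonpos_le (fun s => pos_part (u s) ^ 2 * exp (- (2 * L * s)))
      (fun s => (u' s * (2 * pos_part (u s))) * exp (- (2 * L * s)) +
                pos_part (u s) ^ 2 * (- (2 * L) * exp (- (2 * L * s))))); auto.
    - intros x hx. apply: is_derive_mult; try (intros; apply Rmult_comm).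
      + apply: (is_derive_comp (fun y => pos_part y ^ 2) u). apply is_derive_pos_part_sqr. apply hd; lra.
      + auto_derive; [auto|ring].
    - intros x hx. pose proof (exp_pos (- (2 * L * x))).
      replace (_ + _) with (2 * exp (- (2 * L * x)) * (pos_part (u x) * (u' x - L * pos_part (u x)))) by (simpl; ring).
      unfold pos_part, Rmax; destruct Rle_dec as [h|h]; [|lra].
      destruct (Req_dec (u x) 0) as [e|e]. rewrite e; lra.
      pose proof (hL x ltac:(lra) ltac:(lra)).
      assert (u x * (u' x - L * u x) <= 0) by nra. nra. }
  unfold pos_part in H. rewrite (Rmax_left 0 (u 0)) in H; [|lra].
  pose proof (exp_pos (- (2 * L * t))).
  unfold Rmax in H; destruct Rle_dec as [h|h]; [|lra].
  simpl in H. assert (u t * u t <= 0). { rewrite !Rmult_1_r Rmult_0_l Rmult_0_l in H. nra. }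
  nra.
Qed.

(** * The Picard-Lindelof theorem *)

(** Both u - v and - u - v are non-increasing. This takes the place of the triangle inequality for
    integrals. *)
Lemma derive_abs_le (u u' v v' : R -> R) a b : a <= b ->
  (forall x, a <= x <= b -> is_derive u x (u' x)) ->
  (forall x, a <= x <= b -> is_derive v x (v' x)) ->
  (forall x, a <= x <= b -> Rabs (u' x) <= v' x) ->
  Rabs (u b - u a) <= v b - v a.
Proof.
  intros hab hu hv h.
  assert (h1 : u b - v b <= u a - v a).
  { apply (derive_nonpos_le (fun x => u x - v x) (fun x => u' x - v' x)); auto.
    - intros x hx. apply: is_derive_minus; auto.
    - intros x hx. pose proof (h x hx). pose proof (Rle_abs (u' x)). lra. }
  assert (h2 : - u b - v b <= - u a - v a).
  { apply (derive_nonpos_le (fun x => - u x - v x) (fun x => - u' x - v' x)); auto.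
    - intros x hx. apply: is_derive_minus; auto. apply: is_derive_opp; auto.
    - intros x hx. pose proof (h x hx). pose proof (Rabs_maj2 (u' x)). lra. }
  apply Rabs_le. lra.
Qed.

Lemma RInt_00 (u : R -> R) : RInt u 0 0 = 0 :> R.
Proof. apply: RInt_point. Qed.

(** Telescoping bounds the increments by 2C (2^(-n) - 2^(-n-k)), so the sequence is Cauchy. The
    explicit rate is kept because later estimates pass to the limit with it. *)
Lemma dyadic_limit (x : nat -> R) C :
  (forall n, Rabs (x (S n) - x n) <= C * (/ 2) ^ n) ->
  exists l, forall n, Rabs (x n - l) <= 2 * C * (/ 2) ^ n.
Proof.
  intros h.
  assert (hp : forall n, 0 < (/ 2) ^ n) by (intros; apply pow_lt; lra).
  assert (hC : 0 <= C).
  { pose proof (h 0%nat). simpl in H. pose proof (Rabs_pos (x 1%nat - x 0%nat)). lra. }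
  assert (hk : forall n k, Rabs (x (n + k)%nat - x n) <= 2 * C * (/ 2) ^ n).
  { intros n k. assert (Rabs (x (n + k)%nat - x n) <= 2 * C * ((/ 2) ^ n - (/ 2) ^ (n + k))).
    { induction k as [|k IH].
      - rewrite Nat.add_0_r Rminus_diag Rabs_R0. rewrite Rminus_diag. lra.
      - rewrite Nat.add_succ_r. pose proof (h (n + k)%nat).
        replace (x (S (n + k)) - x n) with ((x (S (n + k)) - x (n + k)%nat) + (x (n + k)%nat - x n)) by ring.
        apply Rle_trans with (1 := Rabs_triang _ _). simpl pow at 2. lra. }
    pose proof (hp (n + k)%nat). nra. }
  assert (hl : ex_finite_lim_seq x).
  { apply ex_lim_seq_cauchy_corr. intros e.
    assert (hq : is_lim_seq (fun n => 2 * (2 * C) * (/ 2) ^ n) 0).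
    { evar_last. apply (is_lim_seq_scal_l _ (2 * (2 * C)) 0). apply is_lim_seq_geom.
      rewrite Rabs_pos_eq; lra. simpl. f_equal; ring. }
    apply is_lim_seq_spec in hq. destruct (hq e) as [N hN].
    exists N. intros n m hn hm. specialize (hN N (Nat.le_refl N)).
    rewrite Rminus_0_r in hN. apply Rle_lt_trans with (2 := hN).
    apply Rle_trans with (2 := Rle_abs _).
    pose proof (hk N (n - N)%nat) as a1. pose proof (hk N (m - N)%nat) as a2.
    replace (N + (n - N))%nat with n in a1 by lia. replace (N + (m - N))%nat with m in a2 by lia.
    replace (x n - x m) with ((x n - x N) - (x m - x N)) by ring.
    apply Rle_trans with (1 := Rabs_triang _ _). rewrite Rabs_Ropp. lra. }
  destruct hl as [l hl]. exists l. intros n.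
  rewrite Rabs_minus_sym.
  apply (is_lim_seq_le (fun k => Rabs (x (k + n)%nat - x n)) (fun _ => 2 * C * (/ 2) ^ n)
    (Rabs (l - x n)) (2 * C * (/ 2) ^ n)).
  - intros k. rewrite Nat.add_comm. apply hk.
  - apply (is_lim_seq_abs _ (l - x n)). apply: is_lim_seq_minus'.
    apply is_lim_seq_incr_n; auto. apply is_lim_seq_const.
  - apply is_lim_seq_const.
Qed.

Lemma dyadic_small x C : (forall n : nat, Rabs x <= C * (/ 2) ^ n) -> x = 0.
Proof.
  intros h. apply Rabs_eq_0. apply Rle_antisym; [|apply Rabs_pos].
  apply (is_lim_seq_le (fun k : nat => Rabs x) (fun n => C * (/ 2) ^ n) (Rabs x) 0); auto.
  - apply is_lim_seq_const.
  - evar_last. apply (is_lim_seq_scal_l _ C 0). apply is_lim_seq_geom. rewrite Rabs_pos_eq; lra.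
    simpl; f_equal; ring.
Qed.

Lemma continuous_R_spec (u : R -> R) x : continuous u x <->
  forall e, 0 < e -> exists d, 0 < d /\ forall y, Rabs (y - x) < d -> Rabs (u y - u x) < e.
Proof.
  split.
  - intros h e he.
    destruct (proj1 (filterlim_locally _ _) h (mkposreal e he)) as [d hd].
    exists d; split; [apply cond_pos|]. intros y hy. apply (hd y). exact hy.
  - intros h. apply filterlim_locally. intros e. destruct (h e (cond_pos e)) as [d [hd h2]].
    exists (mkposreal d hd). intros y hy. apply (h2 y). exact hy.
Qed.

(** The weight [C] may grow with x; being continuous it is bounded near each point, so the
    convergence is locally uniform. *)
Lemma uniform_limit_continuous (un : nat -> R -> R) (u : R -> R) (C : R -> R) :
  (forall n x, continuous (un n) x) -> (forall x, continuous C x) ->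
  (forall n x, Rabs (un n x - u x) <= C x * (/ 2) ^ n) ->
  forall x, continuous u x.
Proof.
  intros hc hC h x. apply continuous_R_spec. intros e he.
  destruct (proj1 (continuous_R_spec C x) (hC x) 1 Rlt_0_1) as [d1 [hd1 h1]].
  assert (hp : 0 < Rabs (C x) + 1) by (pose proof (Rabs_pos (C x)); lra).
  destruct (pow_lt_1_zero (/ 2) ltac:(rewrite Rabs_pos_eq; lra) (e / 4 / (Rabs (C x) + 1))) as [n hn].
  { apply Rdiv_lt_0_compat; lra. }
  specialize (hn n (Nat.le_refl n)).
  assert (hq : 0 < (/ 2) ^ n) by (apply pow_lt; lra).
  rewrite (Rabs_pos_eq _ (Rlt_le _ _ hq)) in hn.
  assert (hb : (Rabs (C x) + 1) * (/ 2) ^ n < e / 4).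
  { apply Rlt_le_trans with ((Rabs (C x) + 1) * (e / 4 / (Rabs (C x) + 1))).
    apply Rmult_lt_compat_l; auto. right; field; lra. }
  destruct (proj1 (continuous_R_spec (un n) x) (hc n x) (e / 4) ltac:(lra)) as [d2 [hd2 h2]].
  exists (Rmin d1 d2). split. apply Rmin_pos; auto.
  intros y hy. pose proof (Rmin_l d1 d2). pose proof (Rmin_r d1 d2).
  specialize (h1 y ltac:(lra)). specialize (h2 y ltac:(lra)).
  pose proof (h n x) as a1. pose proof (h n y) as a2.
  assert (C x <= Rabs (C x) + 1) by (pose proof (Rle_abs (C x)); lra).
  assert (C y <= Rabs (C x) + 1).
  { pose proof (Rle_abs (C x)). apply Rabs_lt_between in h1. lra. }
  assert (C x * (/ 2) ^ n < e / 4).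
  { apply Rle_lt_trans with (2 := hb), Rmult_le_compat_r; lra. }
  assert (C y * (/ 2) ^ n < e / 4).
  { apply Rle_lt_trans with (2 := hb), Rmult_le_compat_r; lra. }
  apply Rabs_le_between in a1, a2. apply Rabs_lt_between in h2. apply Rabs_lt_between. lra.
Qed.

Definition lipschitz2 (F : R -> R -> R) (L : R) : Prop :=
  forall a b a' b', Rabs (F a b - F a' b') <= L * (Rabs (a - a') + Rabs (b - b')).

Lemma lipschitz2_continuous F L (u v : R -> R) x : lipschitz2 F L ->
  continuous u x -> continuous v x -> continuous (fun s => F (u s) (v s)) x.
Proof.
  intros hF hu hv. apply continuous_R_spec. intros e he.
  assert (hL : 0 < Rabs L + 1) by (pose proof (Rabs_pos L); lra).
  assert (hd : 0 < e / (2 * (Rabs L + 1))) by (apply Rdiv_lt_0_compat; lra).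
  destruct (proj1 (continuous_R_spec u x) hu _ hd) as [d1 [hd1 h1]].
  destruct (proj1 (continuous_R_spec v x) hv _ hd) as [d2 [hd2 h2]].
  exists (Rmin d1 d2). split. apply Rmin_pos; auto.
  intros y hy. pose proof (Rmin_l d1 d2). pose proof (Rmin_r d1 d2).
  specialize (h1 y ltac:(lra)). specialize (h2 y ltac:(lra)).
  apply Rle_lt_trans with (1 := hF _ _ _ _).
  apply Rle_lt_trans with ((Rabs L + 1) * (Rabs (u y - u x) + Rabs (v y - v x))).
  - apply Rmult_le_compat_r. pose proof (Rabs_pos (u y - u x)). pose proof (Rabs_pos (v y - v x)); lra.
    pose proof (Rle_abs L); lra.
  - apply Rlt_le_trans with ((Rabs L + 1) * (e / (2 * (Rabs L + 1)) + e / (2 * (Rabs L + 1)))).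
    apply Rmult_lt_compat_l; lra. right; field; lra.
Qed.

(* Successive iterates satisfy [|y_(n+1) - y_n| <= M e^(4 L t) 2^(-n)] for
   [0 <= t].  The vector field is evaluated at [pos_part t], so that the solution
   has two-sided derivatives at [0] as well. *)
Section Picard.
Variables (F1 F2 : R -> R -> R) (L a b : R).
Hypotheses (hL : 0 < L) (hF1 : lipschitz2 F1 L) (hF2 : lipschitz2 F2 L).

Let field (F : R -> R -> R) (yr : (R -> R) * (R -> R)) (s : R) : R :=
  F (fst yr (pos_part s)) (snd yr (pos_part s)).

Let step (yr : (R -> R) * (R -> R)) : (R -> R) * (R -> R) :=
  (fun t => a + RInt (field F1 yr) 0 t, fun t => b + RInt (field F2 yr) 0 t).

Let iter n := Nat.iter n step (fun _ => a, fun _ => b).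

Let continuous_pair (yr : (R -> R) * (R -> R)) :=
  (forall x, continuous (fst yr) x) /\ (forall x, continuous (snd yr) x).

Let pos_part_continuous x : continuous pos_part x.
Proof. apply (retract_continuous _ _ x pos_part_retract). Qed.

Let field_continuous F yr : lipschitz2 F L -> continuous_pair yr -> forall x, continuous (field F yr) x.
Proof.
  intros hF [h1 h2] x. unfold field.
  apply (lipschitz2_continuous F L (fun s => fst yr (pos_part s)) (fun s => snd yr (pos_part s))); auto.
  - apply (continuous_comp pos_part (fst yr)); auto.
  - apply (continuous_comp pos_part (snd yr)); auto.
Qed.

Let is_derive_step F yr k x : lipschitz2 F L -> continuous_pair yr ->
  is_derive (fun t => k + RInt (field F yr) 0 t) x (field F yr x).
Proof.
  intros hF h. apply (is_derive_eq _ _ (0 + field F yr x)); [|ring].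
  apply: is_derive_plus. apply: is_derive_const. apply is_derive_primitive. auto.
Qed.

Let step_continuous yr : continuous_pair yr -> continuous_pair (step yr).
Proof.
  intros h. split; intros x; apply: ex_derive_continuous; eexists; simpl; apply is_derive_step; auto.
Qed.

Let iter_continuous n : continuous_pair (iter n).
Proof.
  induction n. split; intros; apply: continuous_const. change (continuous_pair (step (iter n))). apply step_continuous. exact IHn.
Qed.

(** Chosen so that [M * (4 * L)] bounds both components of the field at the starting point, as the
    first iterate requires. *)
Let M := (Rabs (F1 a b) + Rabs (F2 a b)) / (4 * L).

Let is_derive_weight K x : is_derive (fun t => K * exp (4 * L * t)) x (K * (4 * L) * exp (4 * L * x)).
Proof. auto_derive; auto. ring. Qed.

Let close (n : nat) (u v : R -> R) :=
  forall t, 0 <= t -> Rabs (u t - v t) <= M * exp (4 * L * t) * (/ 2) ^ n.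

Let M_pos : 0 <= M.
Proof.
  apply Rdiv_le_0_compat; [|lra].
  pose proof (Rabs_pos (F1 a b)). pose proof (Rabs_pos (F2 a b)). lra.
Qed.

(** The two components together make the integrand at most 2 L times the weight, while the
    derivative of the weight is 4 L times the weight. Integration thus halves the distance. *)
Let step_close F k n yr yr' : lipschitz2 F L -> continuous_pair yr -> continuous_pair yr' ->
  close n (fst yr) (fst yr') -> close n (snd yr) (snd yr') ->
  close (S n) (fun t => k + RInt (field F yr) 0 t) (fun t => k + RInt (field F yr') 0 t).
Proof.
  intros hF h1 h2 hf hs t ht.
  set (K := M * (/ 2) ^ S n).
  assert (hK : 0 <= K) by (apply Rmult_le_pos; [auto|apply pow_le; lra]).
  pose proof (derive_abs_le
    (fun t => (k + RInt (field F yr) 0 t) - (k + RInt (field F yr') 0 t))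
    (fun t => field F yr t - field F yr' t)
    (fun t => K * exp (4 * L * t)) (fun t => K * (4 * L) * exp (4 * L * t)) 0 t ht) as H.
  simpl in H. rewrite !RInt_00 in H.
  match type of H with ?A -> ?B -> ?C -> _ => assert (hA : A); [|assert (hB : B); [|assert (hC : C)]] end.
  - intros x _. apply: is_derive_minus; apply is_derive_step; auto.
  - intros x _. apply is_derive_weight.
  - intros x hx. unfold field, pos_part. rewrite Rmax_right; [|lra].
    apply Rle_trans with (1 := hF _ _ _ _).
    pose proof (hf x ltac:(lra)). pose proof (hs x ltac:(lra)).
    apply Rle_trans with (L * (2 * (M * exp (4 * L * x) * (/ 2) ^ n))).
    apply Rmult_le_compat_l; lra. unfold K. simpl pow. right; field.
  - specialize (H hA hB hC). replace (k + 0 - (k + 0)) with 0 in H by ring.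
    rewrite Rminus_0_r in H. apply Rle_trans with (1 := H).
    rewrite Rmult_0_r exp_0.
    apply Rle_trans with (K * exp (4 * L * t)); [lra|right; unfold K; ring].
Qed.

Let first_close F k : lipschitz2 F L -> Rabs (F a b) <= M * (4 * L) ->
  close 0 (fun t => k + RInt (field F (iter 0)) 0 t) (fun _ => k).
Proof.
  intros hF hM t ht.
  pose proof (derive_abs_le (fun t => k + RInt (field F (iter 0)) 0 t) (fun t => field F (iter 0) t)
    (fun t => M * exp (4 * L * t)) (fun t => M * (4 * L) * exp (4 * L * t)) 0 t ht) as H.
  simpl in H. rewrite !RInt_00 in H.
  match type of H with ?A -> ?B -> ?C -> _ => assert (hA : A); [|assert (hB : B); [|assert (hC : C)]] end.
  - intros x _. apply is_derive_step; auto. apply (iter_continuous 0).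
  - intros x _. apply is_derive_weight.
  - intros x hx. unfold field. simpl. apply Rle_trans with (1 := hM).
    pose proof (exp_ineq1_le (4 * L * x)). assert (0 <= 4 * L * x) by nra.
    assert (0 <= M * (4 * L)) by (apply Rmult_le_pos; auto; lra). nra.
  - specialize (H hA hB hC). replace (k + 0) with k in H by ring.
    apply Rle_trans with (1 := H). rewrite Rmult_0_r exp_0. simpl. lra.
Qed.

Let iter_close n : close n (fst (iter (S n))) (fst (iter n)) /\ close n (snd (iter (S n))) (snd (iter n)).
Proof.
  induction n as [|n [IH1 IH2]].
  - pose proof (Rabs_pos (F1 a b)). pose proof (Rabs_pos (F2 a b)).
    assert (M * (4 * L) = Rabs (F1 a b) + Rabs (F2 a b)) by (unfold M; field; lra).
    split; apply first_close; auto; lra.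
  - split; apply (step_close _ _ n (iter (S n)) (iter n)); auto.
Qed.

Theorem picard_lindelof : exists y r : R -> R, y 0 = a /\ r 0 = b /\
  (forall t, is_derive y t (F1 (y (pos_part t)) (r (pos_part t)))) /\
  (forall t, is_derive r t (F2 (y (pos_part t)) (r (pos_part t)))).
Proof.
  set (W := fun t => 2 * (M * exp (4 * L * pos_part t))).
  assert (hpos : forall t, 0 <= pos_part t) by (intros; apply Rmax_l).
  destruct (choice (fun t l => forall n, Rabs (fst (iter n) (pos_part t) - l) <= W t * (/ 2) ^ n)) as [y hy].
  { intros t. apply dyadic_limit. intros n. apply iter_close; auto. }
  destruct (choice (fun t l => forall n, Rabs (snd (iter n) (pos_part t) - l) <= W t * (/ 2) ^ n)) as [r hr].
  { intros t. apply dyadic_limit. intros n. apply iter_close; auto. }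
  assert (hW : forall x, continuous W x).
  { intros x. apply (continuous_comp pos_part (fun t => 2 * (M * exp (4 * L * t)))); auto.
    apply: ex_derive_continuous. auto_derive; auto. }
  assert (hc : continuous_pair (y, r)).
  { split; simpl.
    - apply (uniform_limit_continuous (fun n t => fst (iter n) (pos_part t)) y W); auto.
      intros n x. apply (continuous_comp pos_part (fst (iter n))); auto. apply iter_continuous.
    - apply (uniform_limit_continuous (fun n t => snd (iter n) (pos_part t)) r W); auto.
      intros n x. apply (continuous_comp pos_part (snd (iter n))); auto. apply iter_continuous. }
  assert (hpp : forall t, pos_part (pos_part t) = pos_part t).
  { intros t. apply (retract_id _ _ pos_part_retract), hpos. }
  (* A limit of the iterated integrals is the integral of the limit field: the two differ by at most
     (W t + 2 L W t t) 2^(-n) for every n, because [W] is non-decreasing on [0, t]. *)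
  assert (key : forall F k t, lipschitz2 F L -> 0 <= t -> forall z : R,
    (forall n, Rabs ((k + RInt (field F (iter n)) 0 t) - z) <= W t * (/ 2) ^ n) ->
    z = k + RInt (field F (y, r)) 0 t).
  { intros F k t hF ht z hz.
    assert (hWm : forall s, 0 <= s <= t -> W s <= W t).
    { intros s hs. unfold W, pos_part. rewrite !Rmax_right; try lra.
      apply Rmult_le_compat_l; [lra|]. apply Rmult_le_compat_l; [auto|].
      destruct (proj2 hs) as [h|h]; [|rewrite h; lra].
      left; apply exp_increasing. nra. }
    apply Rminus_diag_uniq. apply (dyadic_small _ (W t + 2 * L * W t * t)). intros n.
    pose proof (derive_abs_le
      (fun t => (k + RInt (field F (iter n)) 0 t) - (k + RInt (field F (y, r)) 0 t))
      (fun t => field F (iter n) t - field F (y, r) t)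
      (fun s => 2 * L * W t * (/ 2) ^ n * s) (fun s => 2 * L * W t * (/ 2) ^ n) 0 t ht) as H.
    simpl in H. rewrite !RInt_00 in H.
    match type of H with ?A -> ?B -> ?C -> _ => assert (hA : A); [|assert (hB : B); [|assert (hC : C)]] end.
    - intros x _. apply: is_derive_minus; apply is_derive_step; auto.
    - intros x _. auto_derive; auto. ring.
    - intros x hx. unfold field. simpl.
      apply Rle_trans with (1 := hF _ _ _ _).
      pose proof (hy (pos_part x) n) as a1. pose proof (hr (pos_part x) n) as a2.
      rewrite hpp in a1. rewrite hpp in a2.
      assert (e : W (pos_part x) = W x) by (unfold W; rewrite hpp; auto). rewrite e in a1. rewrite e in a2.
      pose proof (hWm x hx). assert (0 < (/ 2) ^ n) by (apply pow_lt; lra).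
      assert (W x * (/ 2) ^ n <= W t * (/ 2) ^ n) by nra.
      replace (2 * L * W t * (/ 2) ^ n) with (L * (W t * (/ 2) ^ n + W t * (/ 2) ^ n)) by ring.
      apply Rmult_le_compat_l; lra.
    - specialize (H hA hB hC). replace (k + 0 - (k + 0)) with 0 in H by ring.
      specialize (hz n).
      match type of hz with Rabs (?p - z) <= _ => set (P := p) in * end.
      match type of H with Rabs (P - ?q - 0) <= _ => set (Q := q) in * end.
      replace (z - Q) with ((P - Q - 0) - (P - z)) by ring.
      apply Rle_trans with (1 := Rabs_triang _ _). rewrite Rabs_Ropp. lra. }
  assert (hy2 : forall t, 0 <= t -> y t = a + RInt (field F1 (y, r)) 0 t).
  (* The integral of the field along iterate n is iterate n + 1, hence the bound at [S n], which is
     better than required. *)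
  { intros t ht. apply key; auto. intros n. pose proof (hy t (S n)) as H.
    unfold pos_part in H. rewrite Rmax_right in H; auto.
    apply Rle_trans with (1 := H). simpl pow.
    assert (0 < (/ 2) ^ n) by (apply pow_lt; lra).
    assert (0 <= W t). { unfold W. pose proof (exp_pos (4 * L * pos_part t)). nra. } nra. }
  assert (hr2 : forall t, 0 <= t -> r t = b + RInt (field F2 (y, r)) 0 t).
  { intros t ht. apply key; auto. intros n. pose proof (hr t (S n)) as H.
    unfold pos_part in H. rewrite Rmax_right in H; auto.
    apply Rle_trans with (1 := H). simpl pow.
    assert (0 < (/ 2) ^ n) by (apply pow_lt; lra).
    assert (0 <= W t). { unfold W. pose proof (exp_pos (4 * L * pos_part t)). nra. } nra. }
  exists (fun t => a + RInt (field F1 (y, r)) 0 t), (fun t => b + RInt (field F2 (y, r)) 0 t).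
  rewrite !RInt_00. split; [ring|split; [ring|]].
  split; intros t; rewrite -!hy2 -?hr2; auto; apply (is_derive_step _ (y, r)); auto.
Qed.
End Picard.

(** * Local Lipschitz continuity and functions on Omega *)

(** Lipschitz on bounded sets: unlike global Lipschitz continuity, this is stable under products and
    compositions. It gives continuity and, on [0, 1], the Lipschitz derivative demanded by
    [W2inf]. *)
Definition locally_lipschitz (u : R -> R) : Prop :=
  forall M, exists L, 0 <= L /\
    forall x y, Rabs x <= M -> Rabs y <= M -> Rabs (u x - u y) <= L * Rabs (x - y).

Lemma locally_lipschitz_bound u : locally_lipschitz u ->
  forall M, exists B, 0 <= B /\ forall x, Rabs x <= M -> Rabs (u x) <= B.
Proof.
  intros h M. destruct (h (Rabs M)) as [L [hL hl]].
  exists (Rabs (u 0) + L * Rabs M). pose proof (Rabs_pos M). pose proof (Rabs_pos (u 0)). split. nra.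
  intros x hx. assert (Rabs x <= Rabs M) by (apply Rle_trans with (1 := hx), Rle_abs).
  pose proof (hl x 0 ltac:(auto) ltac:(rewrite Rabs_R0; auto)) as H2. rewrite Rminus_0_r in H2.
  replace (u x) with (u 0 + (u x - u 0)) by ring.
  apply Rle_trans with (1 := Rabs_triang _ _). nra.
Qed.

Lemma locally_lipschitz_continuous u x : locally_lipschitz u -> continuous u x.
Proof.
  intros h. apply continuous_R_spec. intros e he.
  destruct (h (Rabs x + 1)) as [L [hL hl]].
  assert (hd : 0 < e / (L + 1)) by (apply Rdiv_lt_0_compat; lra).
  exists (Rmin 1 (e / (L + 1))). split. apply Rmin_pos; lra.
  intros y hy. pose proof (Rmin_l 1 (e / (L + 1))). pose proof (Rmin_r 1 (e / (L + 1))).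
  apply Rle_lt_trans with (L * Rabs (y - x)).
  - apply hl. 2: lra.
    replace y with ((y - x) + x) by ring. apply Rle_trans with (1 := Rabs_triang _ _). lra.
  - apply Rle_lt_trans with ((L + 1) * Rabs (y - x)). pose proof (Rabs_pos (y - x)); nra.
    apply Rlt_le_trans with ((L + 1) * (e / (L + 1))). apply Rmult_lt_compat_l; lra.
    right; field; lra.
Qed.

Lemma lipschitz_locally_lipschitz u L : (forall x y, Rabs (u x - u y) <= L * Rabs (x - y)) ->
  locally_lipschitz u.
Proof.
  intros h M. exists (Rabs L). split. apply Rabs_pos. intros x y _ _.
  apply Rle_trans with (1 := h x y). apply Rmult_le_compat_r. apply Rabs_pos. apply Rle_abs.
Qed.

Lemma locally_lipschitz_retract D p : unit_retract D p -> locally_lipschitz p.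
Proof. intros h. apply (lipschitz_locally_lipschitz p 1). intros. rewrite Rmult_1_l. apply (retract_contract _ _ h). Qed.

Lemma locally_lipschitz_affine a b : locally_lipschitz (fun x => a * x + b).
Proof.
  apply (lipschitz_locally_lipschitz _ (Rabs a)). intros x y.
  rewrite -Rabs_mult. right; f_equal; ring.
Qed.

Lemma locally_lipschitz_ext u v : (forall x, u x = v x) -> locally_lipschitz u -> locally_lipschitz v.
Proof. intros h hu M. destruct (hu M) as [L hl]. exists L. split. apply hl. intros. rewrite -!h. apply hl; auto. Qed.

Lemma locally_lipschitz_plus u v : locally_lipschitz u -> locally_lipschitz v ->
  locally_lipschitz (fun x => u x + v x).
Proof.
  intros hu hv M. destruct (hu M) as [L [hL hl]]. destruct (hv M) as [L' [hL' hl']].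
  exists (L + L'). split. lra. intros x y hx hy.
  replace (u x + v x - (u y + v y)) with ((u x - u y) + (v x - v y)) by ring.
  apply Rle_trans with (1 := Rabs_triang _ _). specialize (hl x y hx hy). specialize (hl' x y hx hy). nra.
Qed.

Lemma locally_lipschitz_mult u v : locally_lipschitz u -> locally_lipschitz v ->
  locally_lipschitz (fun x => u x * v x).
Proof.
  intros hu hv M. destruct (hu M) as [L [hL hl]]. destruct (hv M) as [L' [hL' hl']].
  destruct (locally_lipschitz_bound u hu M) as [B [hB hb]].
  destruct (locally_lipschitz_bound v hv M) as [B' [hB' hb']].
  exists (L * B' + B * L'). split. nra. intros x y hx hy.
  replace (u x * v x - u y * v y) with ((u x - u y) * v x + u y * (v x - v y)) by ring.
  apply Rle_trans with (1 := Rabs_triang _ _). rewrite !Rabs_mult.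
  specialize (hl x y hx hy). specialize (hl' x y hx hy). specialize (hb y hy). specialize (hb' x hx).
  rewrite Rmult_plus_distr_r. apply Rplus_le_compat.
  - replace (L * B' * Rabs (x - y)) with ((L * Rabs (x - y)) * B') by ring.
    apply Rmult_le_compat; auto using Rabs_pos.
  - rewrite Rmult_assoc. apply Rmult_le_compat; auto using Rabs_pos.
Qed.

Lemma locally_lipschitz_scal k u : locally_lipschitz u -> locally_lipschitz (fun x => k * u x).
Proof.
  intros hu. apply (locally_lipschitz_mult (fun _ => k) u); auto.
  apply (locally_lipschitz_ext (fun x => 0 * x + k)). intros; ring. apply locally_lipschitz_affine.
Qed.

Lemma locally_lipschitz_comp u v : locally_lipschitz u -> locally_lipschitz v ->
  locally_lipschitz (fun x => v (u x)).
Proof.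
  intros hu hv M. destruct (hu M) as [L [hL hl]].
  destruct (locally_lipschitz_bound u hu M) as [B [hB hb]]. destruct (hv B) as [L' [hL' hl']].
  exists (L' * L). split. nra. intros x y hx hy.
  apply Rle_trans with (1 := hl' _ _ (hb x hx) (hb y hy)).
  rewrite Rmult_assoc. apply Rmult_le_compat_l; auto.
Qed.

Lemma locally_lipschitz_inv u k : locally_lipschitz u -> 0 < k -> (forall x, k <= u x) ->
  locally_lipschitz (fun x => / u x).
Proof.
  intros hu hk h M. destruct (hu M) as [L [hL hl]].
  exists (L * (/ k * / k)). assert (0 < / k) by (apply Rinv_0_lt_compat; auto).
  split. apply Rmult_le_pos; nra. intros x y hx hy.
  pose proof (h x). pose proof (h y).
  replace (/ u x - / u y) with ((u y - u x) * (/ u x * / u y)) by (field; lra).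
  rewrite Rabs_mult (Rabs_minus_sym (u y)).
  assert (0 < / u x <= / k) by (split; [apply Rinv_0_lt_compat; lra|apply Rinv_le_contravar; auto]).
  assert (0 < / u y <= / k) by (split; [apply Rinv_0_lt_compat; lra|apply Rinv_le_contravar; auto]).
  rewrite (Rabs_pos_eq (/ u x * / u y)); [|nra].
  replace (L * (/ k * / k) * Rabs (x - y)) with (L * Rabs (x - y) * (/ k * / k)) by ring.
  apply Rmult_le_compat; auto using Rabs_pos.
  - apply Rmult_le_pos; lra.
  - apply Rmult_le_compat; lra.
Qed.

Lemma is_derive_locally_lipschitz u u' : (forall x, is_derive u x (u' x)) ->
  (forall x, continuous u' x) -> locally_lipschitz u.
Proof.
  intros hd hc M.
  destruct (continuity_ab_maj (fun x => Rabs (u' x)) (- Rabs M) (Rabs M)) as [z [hz _]].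
  - pose proof (Rabs_pos M); lra.
  - intros x _. apply continuity_pt_filterlim. apply (continuous_comp u' Rabs); auto.
    apply: continuous_Rabs.
  - exists (Rabs (u' z)). split. apply Rabs_pos.
    assert (H : forall x y, Rabs x <= M -> Rabs y <= M -> x <= y ->
      Rabs (u y - u x) <= Rabs (u' z) * y - Rabs (u' z) * x).
    { intros x y hx hy hxy. pose proof (Rle_abs M).
      apply Rabs_le_between in hx, hy.
      apply (derive_abs_le u u' (fun s => Rabs (u' z) * s) (fun _ => Rabs (u' z))); auto.
      - intros s _. auto_derive; auto. ring.
      - intros s hs. apply hz. lra. }
    intros x y hx hy. destruct (Rle_dec x y) as [h|h].
    + rewrite (Rabs_minus_sym (u x)) (Rabs_minus_sym x) (Rabs_pos_eq (y - x)); [|lra].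
      specialize (H x y hx hy h). lra.
    + rewrite (Rabs_pos_eq (x - y)); [|lra]. specialize (H y x hy hx ltac:(lra)). lra.
Qed.

(** * Regularity on [0, 1] and on Omega *)

Lemma I01_0 : I01 0. Proof. unfold I01; lra. Qed.
Lemma I01_1 : I01 1. Proof. unfold I01; lra. Qed.

Lemma clamp01_bound x : Rabs (clamp01 x) <= 1.
Proof. destruct (retract_in _ _ clamp01_retract x). apply Rabs_le; lra. Qed.

Lemma I01_Rabs x : I01 x -> Rabs x <= 1.
Proof. intros [h1 h2]. apply Rabs_le; lra. Qed.

Lemma continuous_on_of_continuous {T U : UniformSpace} (D : T -> Prop) (f : T -> U) :
  (forall x, D x -> continuous f x) -> continuous_on D f.
Proof. intros h x hx. intros P hP. specialize (h x hx P hP).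
  unfold filtermap in *. unfold within. revert h. apply filter_imp. intros y hy _. exact hy. Qed.

Lemma W2inf_intro U dU v : (forall x, I01 x -> is_derive U x (dU x)) ->
  locally_lipschitz v -> (forall x, I01 x -> dU x = v x) ->
  W2inf U /\ forall x, I01 x -> Derive_in I01 U x = dU x.
Proof.
  intros hd hv he.
  assert (hD : forall x, I01 x -> Derive_in I01 U x = dU x).
  { intros x hx. apply (Derive_in_eq _ _ _ _ _ clamp01_retract); auto. apply is_derive_D_in; auto. }
  split; auto. split; [split|].
  - intros x hx. exists (dU x). apply is_derive_D_in; auto.
  - apply continuous_on_ext with v. intros x hx. rewrite hD; auto. symmetry; auto.
    apply continuous_on_of_continuous. intros; apply locally_lipschitz_continuous; auto.
  - destruct (hv 1) as [L [hL hl]]. exists L. intros x y hx hy.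
    rewrite !hD; auto. rewrite !he; auto. apply hl; apply I01_Rabs; auto.
Qed.

Lemma C1_Omega_intro (u ut ux : R -> R -> R) :
  (forall t x, Omega (t, x) -> is_derive (fun s => u s x) t (ut t x)) ->
  (forall t x, Omega (t, x) -> is_derive (fun y => u t y) x (ux t x)) ->
  (forall p, Omega p -> continuous (fun p : R * R => u (fst p) (snd p)) p) ->
  (forall p, Omega p -> continuous (fun p : R * R => ut (fst p) (snd p)) p) ->
  (forall p, Omega p -> continuous (fun p : R * R => ux (fst p) (snd p)) p) ->
  C1_Omega u /\ forall t x, Omega (t, x) -> Dt u t x = ut t x /\ Dx u t x = ux t x.
Proof.
  intros h1 h2 c0 c1 c2.
  assert (H : forall t x, Omega (t, x) -> Dt u t x = ut t x /\ Dx u t x = ux t x).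
  { intros t x h. pose proof h as [ha hb]. simpl in *. split.
    apply (Derive_in_eq _ _ _ _ _ pos_part_retract); auto. apply is_derive_D_in; auto.
    apply (Derive_in_eq _ _ _ _ _ clamp01_retract); auto. apply is_derive_D_in; auto. }
  split; auto. split; [|split; [|split]].
  - apply continuous_on_of_continuous; auto.
  - intros t x h. split; eexists; apply is_derive_D_in; eauto.
  - apply continuous_on_ext with (fun p : R * R => ut (fst p) (snd p)).
    intros [t x] hx. symmetry. apply H; auto.
    apply continuous_on_of_continuous; auto.
  - apply continuous_on_ext with (fun p : R * R => ux (fst p) (snd p)).
    intros [t x] hx. symmetry. apply H; auto.
    apply continuous_on_of_continuous; auto.
Qed.

Lemma locally_Omega t x : 0 < t -> 0 < x < 1 ->
  locally (t, x) (fun p : R * R => 0 < fst p /\ 0 < snd p < 1).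
Proof.
  intros ht hx. apply filter_and; [|apply filter_and].
  - apply (continuous_fst t x (fun r => 0 < r)). apply (open_gt 0); auto.
  - apply (continuous_snd t x (fun r => 0 < r)). apply (open_gt 0); apply hx.
  - apply (continuous_snd t x (fun r => r < 1)). apply (open_lt 1); apply hx.
Qed.

(** Restricted to interior points, where the partial derivatives are two-sided and their continuity
    gives differentiability in the plane. The boundary is reached by continuity in [path_const]. *)
Lemma chain_rule_Omega u (T X : R -> R) s T' X' : C1_Omega u ->
  0 < T s -> 0 < X s < 1 -> is_derive T s T' -> is_derive X s X' ->
  is_derive (fun r => u (T r) (X r)) s (Dt u (T s) (X s) * T' + Dx u (T s) (X s) * X').
Proof.
  intros [_ [hd [hct hcx]]] hT hX dT dX.
  pose proof (locally_Omega (T s) (X s) hT hX) as hl.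
  assert (hO : forall p : R * R, 0 < fst p /\ 0 < snd p < 1 -> Omega p).
  { intros p [h1 h2]. unfold Omega, Rnneg, I01. lra. }
  apply is_derive_Reals. apply derivable_pt_lim_comp_2d; try (apply is_derive_Reals; auto).
  apply filterdiff_differentiable_pt_lim.
  apply (is_derive_filterdiff u (T s) (X s) (fun t x => Dt u t x) (Dx u (T s) (X s))).
  - apply: filter_imp hl. intros [t x] hp. simpl in *.
    apply (D_in_is_derive Rnneg).
    + apply (filter_imp (fun r => 0 < r)). unfold Rnneg; intros; lra. apply (open_gt 0); lra.
    + apply (Derive_in_correct _ _ _ _ pos_part_retract). unfold Rnneg; lra.
      apply hd. apply hO; auto.
  - apply (D_in_is_derive I01).
    + apply (filter_imp (fun r => 0 < r /\ r < 1)). unfold I01; intros; lra.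
      apply filter_and; [apply (open_gt 0)|apply (open_lt 1)]; lra.
    + apply (Derive_in_correct _ _ _ _ clamp01_retract). unfold I01; lra.
      apply hd. apply hO; simpl; auto.
  - apply (continuous_continuous_on Omega); auto. apply: filter_imp hl. auto.
Qed.

Lemma max01_correct u : (forall x, continuous (fun y => u (clamp01 y)) x) -> is_max01 u (max01 u).
Proof.
  intros hc.
  destruct (continuity_ab_maj (fun y => u (clamp01 y)) 0 1) as [z [hz hz2]]. lra.
  { intros; apply continuity_pt_filterlim, hc. }
  assert (hm : is_max01 u (u z)).
  { split. exists z; split; auto. intros x hx.
    specialize (hz x hx). rewrite !(retract_id _ _ clamp01_retract) in hz; auto. }
  apply (iota_correct (V := R_CompleteNormedModule) (is_max01 u)). exists (u z). split; auto.
  intros m [[y [hy e]] h2]. destruct hm as [[y' [hy' e']] h2'].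
  apply Rle_antisym. apply h2; auto. rewrite -e. apply h2'; auto.
Qed.

Lemma C1_on_locally_lipschitz D p u : unit_retract D p -> C1_on D u ->
  locally_lipschitz (fun x => u (p x)).
Proof.
  intros hp h. destruct (C1_extension D p u hp h) as [hc [U [h1 h2]]].
  apply (locally_lipschitz_ext (fun x => U (p x))).
  - intros x. apply h2, (retract_in _ _ hp).
  - apply (locally_lipschitz_comp p U). eapply locally_lipschitz_retract; eauto.
    exact (is_derive_locally_lipschitz _ _ h1 hc).
Qed.

Lemma clamp01_lipschitz u : locally_lipschitz u ->
  exists L, 0 <= L /\ forall x y, Rabs (u (clamp01 x) - u (clamp01 y)) <= L * Rabs (x - y).
Proof.
  intros h. destruct (h 1) as [L [hL hl]]. exists L; split; auto. intros x y.
  apply Rle_trans with (1 := hl _ _ (clamp01_bound x) (clamp01_bound y)).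
  apply Rmult_le_compat_l; auto. apply (retract_contract _ _ clamp01_retract).
Qed.

Lemma clamp01_id x : I01 x -> clamp01 x = x.
Proof. apply (retract_id _ _ clamp01_retract). Qed.

Lemma clamp01_in x : I01 (clamp01 x).
Proof. apply (retract_in _ _ clamp01_retract). Qed.

Lemma clamp01_idem x : clamp01 (clamp01 x) = clamp01 x.
Proof. apply clamp01_id, clamp01_in. Qed.

Lemma clamp01_continuous x : continuous clamp01 x.
Proof. apply (retract_continuous _ _ _ clamp01_retract). Qed.

Lemma pos_part_continuous x : continuous pos_part x.
Proof. apply (retract_continuous _ _ _ pos_part_retract). Qed.

Lemma pos_part_id x : 0 <= x -> pos_part x = x.
Proof. intros h. apply Rmax_right; auto. Qed.

Lemma pos_part_nonneg x : 0 <= pos_part x.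
Proof. apply Rmax_l. Qed.

Lemma C1_on_clamp_continuous u x : C1_on I01 u -> continuous (fun y => u (clamp01 y)) x.
Proof.
  intros h. apply locally_lipschitz_continuous, (C1_on_locally_lipschitz I01); auto. apply clamp01_retract.
Qed.

Lemma derive_eq_eq (u v d : R -> R) a b : a <= b ->
  (forall x, a <= x <= b -> is_derive u x (d x)) -> (forall x, a <= x <= b -> is_derive v x (d x)) ->
  u a = v a -> u b = v b.
Proof.
  intros hab hu hv h0.
  assert (H : u a - v a = u b - v b).
  { assert (hd : forall x, a <= x <= b -> is_derive (fun x => u x - v x) x 0).
    { intros x hx. apply (is_derive_eq _ _ (d x - d x)); [|ring].
      apply: is_derive_minus; auto. }
    apply (derive_0_const (fun x => u x - v x)); auto.
    - intros x hx; apply hd; lra.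
    - intros x hx. apply: ex_derive_continuous. eexists; apply hd; auto. }
  lra.
Qed.

Lemma derive_pos_lt (u d : R -> R) a b : a < b ->
  (forall x, a <= x <= b -> is_derive u x (d x)) -> (forall x, a <= x <= b -> 0 < d x) -> u a < u b.
Proof.
  intros hab hu hd. destruct (MVT_le u d a b) as [x [hx e]].
  - lra.
  - intros; apply hu; lra.
  - intros x hx. apply (ex_derive_continuous u). exists (d x); auto.
  - pose proof (hd x hx). nra.
Qed.

Lemma derive_nonneg_le (u d : R -> R) a b : a <= b ->
  (forall x, a <= x <= b -> is_derive u x (d x)) -> (forall x, a <= x <= b -> 0 <= d x) -> u a <= u b.
Proof.
  intros hab hu hd. destruct (MVT_le u d a b) as [x [hx e]]; auto.
  - intros; apply hu; lra.
  - intros x hx. apply (ex_derive_continuous u). exists (d x); auto.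
  - pose proof (hd x hx). nra.
Qed.

(* [G0 x] is the label of the characteristic issued from [(0, x)], and [H]
   recovers [x] from it. *)
Lemma travel_time_inverse c v0 : 0 < c -> C1_on I01 v0 -> (forall x, I01 x -> 0 < v0 x) ->
  exists G0 H : R -> R, G0 0 = 0 /\ H 0 = 0 /\
    (forall x, is_derive G0 x (/ (c + v0 (clamp01 x)))) /\
    (forall r, is_derive H r (c + v0 (clamp01 (H r)))) /\
    (forall x, H (G0 x) = x) /\ (forall r, G0 (H r) = r).
Proof.
  intros hc hv hpos.
  set (K := fun x => c + v0 (clamp01 x)).
  assert (hK : forall x, c < K x) by (intros x; unfold K; pose proof (hpos _ (clamp01_in x)); lra).
  destruct (clamp01_lipschitz _ (C1_on_locally_lipschitz I01 clamp01 v0 clamp01_retract hv)) as [L [hL hl]].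
  assert (hKL : forall x y, Rabs (K x - K y) <= L * Rabs (x - y)).
  { intros x y. specialize (hl x y). rewrite !clamp01_idem in hl.
    unfold K. replace (c + v0 (clamp01 x) - (c + v0 (clamp01 y))) with (v0 (clamp01 x) - v0 (clamp01 y)) by ring.
    exact hl. }
  (* A scalar equation, with a constant second component. The constant L + 1 is positive even if L =
     0. *)
  destruct (picard_lindelof (fun a _ => K a) (fun _ _ => 0) (L + 1) 0 0) as [H [r [H0 [_ [dH _]]]]].
  - lra.
  - intros a b a' b'. apply Rle_trans with (1 := hKL a a').
    pose proof (Rabs_pos (a - a')). pose proof (Rabs_pos (b - b')). nra.
  - intros a b a' b'. rewrite Rminus_diag Rabs_R0.
    pose proof (Rabs_pos (a - a')). pose proof (Rabs_pos (b - b')). nra.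
  - assert (hneg : forall r, r <= 0 -> H r <= 0).
    { intros s hs. rewrite -H0. apply (derive_nonneg_le H (fun r => K (H (pos_part r)))); auto.
      intros; pose proof (hK (H (pos_part x))); lra. }
    (* For r < 0 the solution is driven by the field frozen at time 0. There H r <= 0 = H 0, and
       [clamp01] sends both to 0, so the field at [H r] has the same value. *)
    assert (dH' : forall r, is_derive H r (K (H r))).
    { intros s. apply (is_derive_eq _ _ _ _ (dH s)).
      destruct (Rle_dec 0 s) as [h|h]. rewrite pos_part_id; auto.
      unfold pos_part. rewrite Rmax_left; [|lra]. rewrite H0.
      assert (e : H s <= 0) by (apply hneg; lra).
      unfold K. f_equal. f_equal. unfold clamp01. rewrite (Rmin_right 1 0); [|lra]. rewrite (Rmin_right 1); [|lra].
      rewrite !Rmax_left; lra. }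
    assert (dG : forall x, is_derive (fun y => RInt (fun s => / K s) 0 y) x (/ K x)).
    { intros x. apply (is_derive_primitive (fun s => / K s)). intros y.
      apply continuous_Rinv_comp. apply (contract_continuous K L); auto.
      pose proof (hK y). lra. }
    set (G0 := fun y => RInt (fun s => / K s) 0 y) in *.
    assert (G00 : G0 0 = 0) by apply RInt_00.
    assert (hGH : forall r, G0 (H r) = r).
    { assert (hd : forall r, is_derive (fun r => G0 (H r)) r 1).
      { intros s. apply (is_derive_eq _ _ (K (H s) * / K (H s))).
        - apply: (is_derive_comp G0 H); auto.
        - field. pose proof (hK (H s)); lra. }
      assert (hd2 : forall r : R, is_derive (fun r : R => r) r 1) by (intros; apply: is_derive_id).
      intros s. destruct (Rle_dec 0 s).
      - apply (derive_eq_eq (fun r => G0 (H r)) (fun r => r) (fun _ => 1) 0 s); auto. rewrite H0; auto.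
      - assert (E : G0 (H s) - s = G0 (H 0) - 0).
        { apply (derive_0_const (fun r => G0 (H r) - r) s 0).
          + lra.
          + intros x _. apply (is_derive_eq _ _ (1 - 1)); [|ring]. apply: is_derive_minus; auto.
          + intros x _. apply: continuous_minus; [|apply: continuous_id].
            apply: ex_derive_continuous; eexists; apply hd. }
        rewrite H0 G00 in E. lra. }
    assert (hmono : forall x y, x < y -> G0 x < G0 y).
    { intros x y hxy. apply (derive_pos_lt G0 (fun x => / K x)); auto.
      intros z _. apply Rinv_0_lt_compat. pose proof (hK z); lra. }
    exists G0, H. do 4 (split; [assumption|]). split; [|assumption]. intros x.
    destruct (Rtotal_order (H (G0 x)) x) as [h|[h|h]]; auto;
      apply hmono in h; rewrite hGH in h; lra.
Qed.

(** * The outlet equation *)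

(** Gronwall for the squared distance: with a and b the distances of the components, its derivative
    is at most 2 L (a + b)^2 <= 4 L (a^2 + b^2). *)
Lemma lipschitz2_ode_unique F1 F2 L (y1 r1 y2 r2 : R -> R) :
  0 < L -> lipschitz2 F1 L -> lipschitz2 F2 L ->
  (forall t, 0 <= t -> is_derive y1 t (F1 (y1 t) (r1 t))) ->
  (forall t, 0 <= t -> is_derive r1 t (F2 (y1 t) (r1 t))) ->
  (forall t, 0 <= t -> is_derive y2 t (F1 (y2 t) (r2 t))) ->
  (forall t, 0 <= t -> is_derive r2 t (F2 (y2 t) (r2 t))) ->
  y1 0 = y2 0 -> r1 0 = r2 0 ->
  forall t, 0 <= t -> y1 t = y2 t /\ r1 t = r2 t.
Proof.
  intros hL hF1 hF2 dy1 dr1 dy2 dr2 hy hr t ht.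
  assert (H : (y1 t - y2 t) ^ 2 + (r1 t - r2 t) ^ 2 <= 0).
  { apply (gronwall_nonpos (fun t => (y1 t - y2 t) ^ 2 + (r1 t - r2 t) ^ 2)
      (fun t => 2 * (y1 t - y2 t) * (F1 (y1 t) (r1 t) - F1 (y2 t) (r2 t)) +
                2 * (r1 t - r2 t) * (F2 (y1 t) (r1 t) - F2 (y2 t) (r2 t))) (4 * L)); auto.
    - intros s hs.
      assert (sq : forall (u : R -> R) du, is_derive u s du -> is_derive (fun s => u s ^ 2) s (2 * u s * du)).
      { intros u du hu. apply (is_derive_eq _ _ (INR 2 * du * u s ^ Nat.pred 2)); [|simpl; ring].
        apply: is_derive_pow; auto. }
      apply: is_derive_plus.
      + apply (sq (fun s => y1 s - y2 s)). apply: is_derive_minus; auto.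
      + apply (sq (fun s => r1 s - r2 s)). apply: is_derive_minus; auto.
    - intros s _ _. cbv beta.
      specialize (hF1 (y1 s) (r1 s) (y2 s) (r2 s)). specialize (hF2 (y1 s) (r1 s) (y2 s) (r2 s)).
      set (p := y1 s - y2 s) in *. set (q := r1 s - r2 s) in *.
      set (P := F1 (y1 s) (r1 s) - F1 (y2 s) (r2 s)) in *. set (Q := F2 (y1 s) (r1 s) - F2 (y2 s) (r2 s)) in *.
      assert (h1 : p * P <= Rabs p * (L * (Rabs p + Rabs q))).
      { apply Rle_trans with (1 := Rle_abs _). rewrite Rabs_mult.
        apply Rmult_le_compat_l; auto using Rabs_pos. }
      assert (h2 : q * Q <= Rabs q * (L * (Rabs p + Rabs q))).
      { apply Rle_trans with (1 := Rle_abs _). rewrite Rabs_mult.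
        apply Rmult_le_compat_l; auto using Rabs_pos. }
      rewrite -(pow2_abs p) -(pow2_abs q).
      set (a := Rabs p) in *. set (b := Rabs q) in *.
      assert (0 <= L * (a - b) ^ 2) by (apply Rmult_le_pos; [lra|apply pow2_ge_0]). nra.
    - rewrite hy hr. lra. }
  pose proof (pow2_ge_0 (y1 t - y2 t)). pose proof (pow2_ge_0 (r1 t - r2 t)).
  assert (e1 : (y1 t - y2 t) ^ 2 = 0) by lra. assert (e2 : (r1 t - r2 t) ^ 2 = 0) by lra.
  split; apply Rminus_diag_uniq; nra.
Qed.

(* The positive parts do not matter for positive speeds; they make the vector
   field globally Lipschitz. *)
Definition outlet_accel (c mu : R) (f Z : R -> R) (y r : R) : R :=
  - mu * (y - f (Z r / (c + pos_part y))).

Definition outlet_drift (c y r : R) : R := - pos_part y / (c + pos_part y).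

Lemma inv_pos_part_lipschitz c a b : 0 < c ->
  Rabs (/ (c + pos_part a) - / (c + pos_part b)) <= / c * / c * Rabs (a - b).
Proof.
  intros hc. pose proof (pos_part_nonneg a). pose proof (pos_part_nonneg b).
  replace (/ (c + pos_part a) - / (c + pos_part b))
    with (/ (c + pos_part a) * / (c + pos_part b) * (pos_part b - pos_part a)) by (field; lra).
  assert (0 < / (c + pos_part a) <= / c) by (split; [apply Rinv_0_lt_compat; lra|apply Rinv_le_contravar; lra]).
  assert (0 < / (c + pos_part b) <= / c) by (split; [apply Rinv_0_lt_compat; lra|apply Rinv_le_contravar; lra]).
  rewrite Rabs_mult (Rabs_minus_sym (pos_part b)) Rabs_pos_eq; [|nra].
  apply Rmult_le_compat; auto using Rabs_pos. nra. apply Rmult_le_compat; lra.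
  apply (retract_contract _ _ pos_part_retract).
Qed.

Lemma outlet_drift_lipschitz c : 0 < c -> lipschitz2 (outlet_drift c) (/ c).
Proof.
  intros hc a b a' b'. unfold outlet_drift.
  pose proof (pos_part_nonneg a). pose proof (pos_part_nonneg a').
  replace (- pos_part a / (c + pos_part a) - - pos_part a' / (c + pos_part a'))
    with (c * (/ (c + pos_part a) - / (c + pos_part a'))) by (field; lra).
  rewrite Rabs_mult Rabs_pos_eq; [|lra].
  apply Rle_trans with (c * (/ c * / c * Rabs (a - a'))).
  - apply Rmult_le_compat_l; [lra|]. apply inv_pos_part_lipschitz; auto.
  - replace (c * (/ c * / c * Rabs (a - a'))) with (/ c * Rabs (a - a')) by (field; lra).
    apply Rmult_le_compat_l. left; apply Rinv_0_lt_compat; auto. pose proof (Rabs_pos (b - b')); lra.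
Qed.

(** Since [Z] takes values in [0, B], the argument of [f] never leaves [0, B/c]. A Lipschitz
    constant of [f] on this interval is enough for a global one. *)
Lemma outlet_accel_lipschitz c mu f Z B LZ : 0 < c -> 0 < mu ->
  locally_lipschitz (fun s => f (pos_part s)) ->
  (forall r, 0 <= Z r <= B) -> (forall r s, Rabs (Z r - Z s) <= LZ * Rabs (r - s)) ->
  exists L, 0 < L /\ lipschitz2 (outlet_accel c mu f Z) L.
Proof.
  intros hc hmu hf hZ hLZ.
  assert (hic : 0 < / c) by (apply Rinv_0_lt_compat; auto).
  destruct (hf (B * / c)) as [Lf [hLf hlf]].
  assert (hB : 0 <= B) by (pose proof (hZ 0); lra).
  assert (hLZ0 : 0 <= LZ).
  { pose proof (hLZ 1 0) as h. rewrite Rminus_0_r Rabs_R1 in h. pose proof (Rabs_pos (Z 1 - Z 0)). lra. }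
  assert (arg : forall y r, 0 <= Z r * / (c + pos_part y) <= B * / c).
  { intros y r. pose proof (pos_part_nonneg y). pose proof (hZ r).
    assert (0 < / (c + pos_part y) <= / c) by (split; [apply Rinv_0_lt_compat; lra|apply Rinv_le_contravar; lra]).
    split. apply Rmult_le_pos; lra. apply Rmult_le_compat; lra. }
  set (k := B * (/ c * / c) + LZ * / c).
  assert (hk : 0 <= k).
  { apply Rplus_le_le_0_compat; apply Rmult_le_pos; nra. }
  exists (mu * (1 + Lf * k)). split. apply Rmult_lt_0_compat; nra.
  intros a b a' b'. unfold outlet_accel, Rdiv.
  assert (h1 : Rabs (f (Z b * / (c + pos_part a)) - f (Z b' * / (c + pos_part a')))
     <= Lf * (k * (Rabs (a - a') + Rabs (b - b')))).
  { pose proof (arg a b) as A1. pose proof (arg a' b') as A2.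
    rewrite -(pos_part_id _ (proj1 A1)) -(pos_part_id _ (proj1 A2)).
    assert (habs : forall s, 0 <= s <= B * / c -> Rabs s <= B * / c) by (intros s hs; rewrite Rabs_pos_eq; lra).
    apply Rle_trans with (1 := hlf _ _ (habs _ A1) (habs _ A2)).
    apply Rmult_le_compat_l; auto.
    replace (Z b * / (c + pos_part a) - Z b' * / (c + pos_part a'))
      with (Z b * (/ (c + pos_part a) - / (c + pos_part a')) + (Z b - Z b') * / (c + pos_part a')) by ring.
    apply Rle_trans with (1 := Rabs_triang _ _). rewrite !Rabs_mult.
    pose proof (inv_pos_part_lipschitz c a a' hc) as h2. pose proof (hLZ b b') as h3. pose proof (hZ b) as h4.
    pose proof (pos_part_nonneg a').
    assert (h5 : 0 < / (c + pos_part a') <= / c) by (split; [apply Rinv_0_lt_compat; lra|apply Rinv_le_contravar; lra]).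
    rewrite (Rabs_pos_eq (Z b)); [|lra]. rewrite (Rabs_pos_eq (/ (c + pos_part a'))); [|lra].
    assert (h6 : Z b * Rabs (/ (c + pos_part a) - / (c + pos_part a')) <= B * (/ c * / c * Rabs (a - a'))).
    { apply Rmult_le_compat; auto using Rabs_pos; lra. }
    assert (h7 : Rabs (Z b - Z b') * / (c + pos_part a') <= LZ * Rabs (b - b') * / c).
    { apply Rmult_le_compat; auto using Rabs_pos; lra. }
    pose proof (Rabs_pos (a - a')). pose proof (Rabs_pos (b - b')).
    assert (0 <= B * (/ c * / c) * Rabs (b - b')) by (apply Rmult_le_pos; nra).
    assert (0 <= LZ * / c * Rabs (a - a')) by (apply Rmult_le_pos; nra).
    unfold k. lra. }
  match goal with |- Rabs ?e <= _ => replace e with (- mu * ((a - a') -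
     (f (Z b * / (c + pos_part a)) - f (Z b' * / (c + pos_part a'))))) by ring end.
  rewrite Rabs_mult Rabs_Ropp (Rabs_pos_eq mu); [|lra].
  rewrite Rmult_assoc. apply Rmult_le_compat_l; [lra|].
  apply Rle_trans with (1 := Rabs_triang _ _). rewrite Rabs_Ropp.
  pose proof (Rabs_pos (b - b')). lra.
Qed.

(** * Characteristics *)

Lemma continuous_on_Omega_path (g : R -> R -> R) (T X : R -> R) s :
  continuous_on Omega (fun p : R * R => g (fst p) (snd p)) ->
  continuous T s -> continuous X s ->
  continuous (fun r => g (pos_part (T r)) (clamp01 (X r))) s.
Proof.
  intros hg hT hX.
  assert (hO : forall a b, Omega (pos_part a, clamp01 b)).
  { intros a b. split. apply pos_part_nonneg. apply clamp01_in. }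
  assert (hT' : continuous (fun r => pos_part (T r)) s)
    by (apply (continuous_comp T pos_part); auto; apply pos_part_continuous).
  assert (hX' : continuous (fun r => clamp01 (X r)) s)
    by (apply (continuous_comp X clamp01); auto; apply clamp01_continuous).
  intros P hP.
  destruct (hg _ (hO (T s) (X s)) P hP) as [d hd].
  assert (h1 := proj1 (filterlim_locally _ _) hT' d). assert (h2 := proj1 (filterlim_locally _ _) hX' d).
  unfold filtermap.
  apply: filter_imp (filter_and _ _ h1 h2). intros r [b1 b2].
  apply (hd (pos_part (T r), clamp01 (X r))); auto. split; auto.
Qed.

Lemma path_const (g : R -> R -> R) (T X : R -> R) a b : a <= b ->
  continuous_on Omega (fun p : R * R => g (fst p) (snd p)) ->
  (forall s, continuous T s) -> (forall s, continuous X s) ->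
  Omega (T a, X a) -> Omega (T b, X b) ->
  (forall s, a < s < b -> 0 < T s /\ 0 < X s < 1 /\ is_derive (fun r => g (T r) (X r)) s 0) ->
  g (T a) (X a) = g (T b) (X b).
Proof.
  intros hab hg hT hX [ha1 ha2] [hb1 hb2] hd. simpl in *.
  assert (H : g (pos_part (T a)) (clamp01 (X a)) = g (pos_part (T b)) (clamp01 (X b))).
  { apply (derive_0_const (fun s => g (pos_part (T s)) (clamp01 (X s)))); auto.
    - intros s hs. destruct (hd s hs) as [h1 [h2 h3]].
      apply is_derive_ext_loc with (2 := h3).
      assert (l1 : locally s (fun r => 0 < T r)) by (apply (hT s (fun r => 0 < r)), (open_gt 0); auto).
      assert (l2 : locally s (fun r => 0 < X r)) by (apply (hX s (fun r => 0 < r)), (open_gt 0); apply h2).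
      assert (l3 : locally s (fun r => X r < 1)) by (apply (hX s (fun r => r < 1)), (open_lt 1); apply h2).
      apply: filter_imp (filter_and _ _ l1 (filter_and _ _ l2 l3)). intros r [p1 [p2 p3]].
      rewrite pos_part_id; [|lra]. rewrite clamp01_id; auto. unfold I01; lra.
    - intros s _. apply continuous_on_Omega_path; auto. }
  rewrite !pos_part_id in H; auto. rewrite !clamp01_id in H; auto.
Qed.

Lemma continuous_on_speed_product {T : UniformSpace} (D : T -> Prop) (f g : T -> R) c :
  continuous_on D f -> continuous_on D g -> continuous_on D (fun p => f p * (c + g p)).
Proof.
  intros hf hg p hp.
  apply: (filterlim_comp_2 _ _ Rmult (hf p hp)); [|apply (filterlim_mult (K := R_AbsRing))].
  apply: (filterlim_comp_2 _ _ Rplus _ (hg p hp)); [apply filterlim_const|].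
  apply (filterlim_plus (V := R_NormedModule)).
Qed.

(** What remains of a solution once the partial differential equations are integrated; uniqueness
    and the decay estimates work from this record. [y] is kept apart from [w] so that it can have a
    two-sided derivative at time 0. *)
Record characteristic_form (c mu : R) (f v0 Z : R -> R) (rho v : R -> R -> R) (y w G : R -> R) : Prop := {
  cf_G_0 : G 0 = 0;
  cf_G_deriv : forall s, 0 <= s -> is_derive G s (c / (c + w s));
  cf_w_pos : forall s, 0 <= s -> 0 < w s;
  cf_w_initial : forall x, I01 x -> w (x / c) = v0 x;
  cf_w_outlet : forall t, 0 <= t -> w (t + 1 / c) = y t;
  cf_y_deriv : forall t, 0 <= t -> is_derive y t (outlet_accel c mu f Z (y t) (G (t + 1 / c) - t));
  cf_v : forall t x, Omega (t, x) -> v t x = w (t + x / c);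
  cf_rho : forall t x, Omega (t, x) -> rho t x * (c + v t x) = Z (G (t + x / c) - t) }.

Arguments cf_G_0 {c mu f v0 Z rho v y w G} _.
Arguments cf_w_outlet {c mu f v0 Z rho v y w G} _.
Arguments cf_w_initial {c mu f v0 Z rho v y w G} _.
Arguments cf_w_pos {c mu f v0 Z rho v y w G} _.
Arguments cf_v {c mu f v0 Z rho v y w G} _.
Arguments cf_rho {c mu f v0 Z rho v y w G} _.
Arguments cf_y_deriv {c mu f v0 Z rho v y w G} _.

Lemma Omega_pair t x : Omega (t, x) -> 0 <= t /\ 0 <= x <= 1.
Proof. intros [h1 h2]. split; auto. Qed.

(** Backwards in time, the line along which v is constant reaches time 0 if c t <= 1 - x and the
    outlet x = 1 otherwise. The two projections express both cases in one formula, which depends on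
    t + x/c only. *)
Lemma transport_left c v : 0 < c -> C1_Omega v ->
  (forall t x, Omega (t, x) -> Dt v t x - c * Dx v t x = 0) ->
  forall t x, Omega (t, x) ->
  v t x = v (pos_part (t + x / c - 1 / c)) (clamp01 (c * (t + x / c))).
Proof.
  intros hc hC hpde t x htx. destruct (Omega_pair _ _ htx) as [ht hx].
  assert (ex : c * (t + x / c) = x + c * t) by (field; lra). rewrite ex.
  assert (et : t + x / c - 1 / c = t - (1 - x) / c) by (field; lra). rewrite et.
  assert (hb : 0 <= (1 - x) / c) by (apply Rdiv_le_0_compat; lra).
  assert (eb : c * ((1 - x) / c) = 1 - x) by (field; lra).
  assert (dT : forall s, is_derive (fun s => t - s) s (-1)) by (intros; auto_derive; auto; ring).
  assert (dX : forall s, is_derive (fun s => x + c * s) s c) by (intros; auto_derive; auto; ring).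
  assert (key : forall b, 0 <= b -> b <= t -> c * b <= 1 - x -> v t x = v (t - b) (x + c * b)).
  { intros b h0 h1 h2.
    replace (v t x) with (v (t - 0) (x + c * 0)) by (f_equal; ring).
    apply (path_const v (fun s => t - s) (fun s => x + c * s) 0 b); auto.
    - apply hC.
    - intros; apply: ex_derive_continuous; eexists; apply dT.
    - intros; apply: ex_derive_continuous; eexists; apply dX.
    - rewrite Rminus_0_r Rmult_0_r Rplus_0_r; auto.
    - split; simpl; unfold Rnneg, I01; nra.
    - intros s hs. assert (0 < t - s) by lra. assert (0 < x + c * s < 1) by nra. split; [|split]; auto.
      apply (is_derive_eq _ _ (Dt v (t - s) (x + c * s) * -1 + Dx v (t - s) (x + c * s) * c)).
      apply (chain_rule_Omega v (fun s => t - s) (fun s => x + c * s)); auto.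
      assert (hO : Omega (t - s, x + c * s)) by (split; simpl; unfold Rnneg, I01; lra).
      specialize (hpde _ _ hO). lra. }
  destruct (Rle_dec t ((1 - x) / c)) as [h|h].
  - assert (c * t <= 1 - x) by (rewrite -eb; apply Rmult_le_compat_l; lra).
    rewrite (key t); auto; try lra.
    unfold pos_part at 1. rewrite Rmax_left; [|lra]. rewrite clamp01_id. f_equal; ring.
    unfold I01; nra.
  - rewrite (key ((1 - x) / c)); auto; try lra.
    rewrite pos_part_id; [|lra]. f_equal. rewrite eb.
    assert (1 - x <= c * t) by (rewrite -eb; apply Rmult_le_compat_l; lra).
    unfold clamp01. rewrite Rmin_left; [|lra]. rewrite Rmax_right; lra.
Qed.

(** * Reduction of a solution to its characteristic form *)

Section Representation.
Variables (c mu rho_eq : R) (h f rho0 v0 G0 H : R -> R) (rho v : R -> R -> R).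
Let A := rho_eq * (c + f rho_eq).
Let Z r := rho0 (clamp01 (H r)) * (c + v0 (clamp01 (H r))).
Hypotheses (hc : 0 < c)
  (hv0 : forall x, I01 x -> 0 < v0 x) (hv0C : C1_on I01 v0)
  (hinlet : forall V, 0 < V -> h (rho_eq * V * ((c + f rho_eq) / (c + V)) / V) = A / (c + V))
  (hz0 : rho0 0 * (c + v0 0) = A)
  (G00 : G0 0 = 0) (H0 : H 0 = 0)
  (dG0 : forall x, is_derive G0 x (/ (c + v0 (clamp01 x))))
  (dH : forall r, is_derive H r (c + v0 (clamp01 (H r))))
  (HG0 : forall x, H (G0 x) = x) (G0H : forall r, G0 (H r) = r).

(** Such labels have H r <= 0, which the clamp sends to the inlet point; the first compatibility
    equality gives the value there. *)
Lemma label_neg r : r <= 0 -> Z r = A.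
Proof.
  intros hr. assert (hH : H r <= 0).
  { rewrite -H0. apply (derive_nonneg_le H (fun r => c + v0 (clamp01 (H r)))); auto.
    intros x _. pose proof (hv0 _ (clamp01_in (H x))). lra. }
  unfold Z, clamp01. rewrite (Rmin_right 1 (H r)); [|lra]. rewrite Rmax_left; auto.
Qed.

Lemma label_initial G x : G 0 = 0 -> (forall y, I01 y -> is_derive G (y / c) (c / (c + v0 y))) ->
  I01 x -> G (x / c) = G0 x.
Proof.
  intros hG dG hx.
  apply (derive_eq_eq (fun y => G (y / c)) G0 (fun y => / (c + v0 (clamp01 y))) 0 x); auto.
  - apply hx.
  - intros y hy. assert (hy' : I01 y) by (unfold I01 in *; lra).
    rewrite clamp01_id; auto. pose proof (hv0 y hy').
    apply (is_derive_eq _ _ (/ c * (c / (c + v0 y)))); [|field; lra].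
    apply: (is_derive_comp G (fun y => y / c)); auto.
    auto_derive; auto; field; lra.
  - unfold Rdiv; rewrite Rmult_0_l hG G00; auto.
Qed.

Lemma label_G0 x : I01 x -> Z (G0 x) = rho0 x * (c + v0 x).
Proof. intros hx. unfold Z. rewrite HG0 clamp01_id; auto. Qed.

Theorem representation : closed_loop_solution c mu rho_eq h f rho0 v0 rho v ->
  exists y w G, characteristic_form c mu f v0 Z rho v y w G.
Proof.
  intros [hCr [hCv [hst [hpde [hbd hinit]]]]].
  assert (hpos : forall t x, Omega (t, x) -> 0 < rho t x /\ 0 < v t x).
  { intros t x hO. destruct (Omega_pair _ _ hO) as [ht hx].
    destruct (hst t ht) as [_ [_ [hp _]]]. specialize (hp x hx).
    pose proof (Rmin_l (rho t x) (v t x)). pose proof (Rmin_r (rho t x) (v t x)). lra. }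
  set (w := fun s => v (pos_part (s - 1 / c)) (clamp01 (c * s))).
  assert (hOw : forall s, Omega (pos_part (s - 1 / c), clamp01 (c * s))).
  { intros s. split. apply pos_part_nonneg. apply clamp01_in. }
  assert (hwp : forall s, 0 < w s) by (intros s; apply hpos, hOw).
  assert (hwc : forall s, continuous w s).
  { intros s. apply (continuous_on_Omega_path v (fun s => s - 1 / c) (fun s => c * s)). apply hCv.
    apply: ex_derive_continuous; auto_derive; auto. apply: ex_derive_continuous; auto_derive; auto. }
  assert (hvw : forall t x, Omega (t, x) -> v t x = w (t + x / c)).
  { intros t x hO. apply transport_left; auto. intros; apply hpde; auto. }
  set (G := fun s => RInt (fun s => c / (c + w s)) 0 s).
  assert (dG : forall s, is_derive G s (c / (c + w s))).
  { intros s. apply (is_derive_primitive (fun s => c / (c + w s))). intros r.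
    apply: continuous_mult. apply continuous_const. apply continuous_Rinv_comp.
    apply: continuous_plus; auto. apply continuous_const. pose proof (hwp r). simpl. lra. }
  assert (hGc : forall s, continuous G s) by (intros; apply: ex_derive_continuous; eexists; apply dG).
  assert (G_0 : G 0 = 0) by apply RInt_00.
  assert (hGd : forall s, 0 < c / (c + w s) < 1).
  { intros s. pose proof (hwp s). split. apply Rdiv_lt_0_compat; lra.
    apply (Rmult_lt_reg_r (c + w s)); [lra|]. unfold Rdiv. rewrite Rmult_assoc Rinv_l; lra. }
  assert (hG_lt : forall a b, a < b -> G a < G b).
  { intros a b hab. apply (derive_pos_lt G (fun s => c / (c + w s))); auto. intros; apply hGd. }
  assert (hD_lt : forall a b, a < b -> G b - b < G a - a).
  { intros a b hab. assert (a - G a < b - G b); [|lra].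
    apply (derive_pos_lt (fun s => s - G s) (fun s => 1 - c / (c + w s))); auto.
    intros. apply: is_derive_minus; auto. apply: is_derive_id. intros x _; pose proof (hGd x); lra. }
  assert (hwi : forall x, I01 x -> w (x / c) = v0 x).
  { intros x hx. assert (hO : Omega (0, x)) by (split; simpl; unfold Rnneg; auto; lra).
    specialize (hvw 0 x hO). rewrite Rplus_0_l in hvw. rewrite -hvw. destruct (hinit x hx). lra. }
  assert (hGi : forall x, I01 x -> G (x / c) = G0 x).
  { intros x hx. apply label_initial; auto. intros y hy. rewrite -hwi; auto. }
  (* The characteristic through (t, x) is parametrised by s, the argument of [w]: its time is T = t
     + G s - G s0 with s0 = t + x/c, its place c (s - T). On it v = w s is known in advance. As 0 <
     G' < 1, time and place both increase with s, which keeps the open arc in the interior. *)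
  assert (hchar : forall t x s, Omega (t, x) -> 0 <= s -> s <= t + x / c ->
    Omega (t + G s - G (t + x / c), c * (s - (t + G s - G (t + x / c)))) ->
    rho (t + G s - G (t + x / c)) (c * (s - (t + G s - G (t + x / c)))) *
     (c + v (t + G s - G (t + x / c)) (c * (s - (t + G s - G (t + x / c))))) = rho t x * (c + v t x)).
  { intros t x s hO hs hle hOs. destruct (Omega_pair _ _ hO) as [ht hx].
    set (s0 := t + x / c) in *.
    set (T := fun r => t + G r - G s0). set (X := fun r => c * (r - T r)).
    assert (eT : T s0 = t) by (unfold T; ring).
    assert (eX : X s0 = x) by (unfold X; rewrite eT; unfold s0; field; lra).
    assert (dT : forall r, is_derive T r (c / (c + w r))).
    { intros r. apply (is_derive_eq _ _ (0 + c / (c + w r) - 0)); [|ring].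
      apply: is_derive_minus; [|apply: is_derive_const]. apply: is_derive_plus; auto. apply: is_derive_const. }
    assert (dX : forall r, is_derive X r (c * (1 - c / (c + w r)))).
    { intros r. apply: is_derive_scal. apply: is_derive_minus; auto. apply: is_derive_id. }
    assert (E := path_const (fun t x => rho t x * (c + v t x)) T X s s0 hle). simpl in E.
    rewrite eT eX in E. apply E; auto; clear E.
    - apply continuous_on_speed_product; [apply hCr|apply hCv].
    - intros r; apply: ex_derive_continuous; eexists; apply dT.
    - intros r; apply: ex_derive_continuous; eexists; apply dX.
    - intros r hr. destruct (Omega_pair _ _ hOs) as [hs1 hs2].
      assert (p1 : 0 < T r). { unfold T. pose proof (hG_lt s r (proj1 hr)). lra. }
      assert (p2 : 0 < X r < 1).
      { unfold X, T. pose proof (hD_lt s r (proj1 hr)). pose proof (hD_lt r s0 (proj2 hr)).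
        assert (s0 - t = x / c) by (unfold s0; ring). assert (c * (x / c) = x) by (field; lra). split; nra. }
      split; [|split]; auto.
      assert (hOr : Omega (T r, X r)) by (split; simpl; unfold Rnneg, I01; lra).
      assert (ev : v (T r) (X r) = w r).
      { rewrite hvw; auto. f_equal. unfold X. field. lra. }
      destruct (hpde _ _ hOr) as [q1 q2]. pose proof (hwp r).
      rewrite ev in q1.
      apply (is_derive_eq _ _
        ((Dt rho (T r) (X r) * (c / (c + w r)) + Dx rho (T r) (X r) * (c * (1 - c / (c + w r)))) * (c + v (T r) (X r))
         + rho (T r) (X r) * (0 + (Dt v (T r) (X r) * (c / (c + w r)) + Dx v (T r) (X r) * (c * (1 - c / (c + w r))))))).
      + apply: is_derive_mult; [| |intros; apply Rmult_comm].
        apply chain_rule_Omega; auto. apply: is_derive_plus. apply: is_derive_const. apply chain_rule_Omega; auto.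
      + rewrite ev.
        replace (Dt v (T r) (X r)) with (c * Dx v (T r) (X r)) by lra.
        replace (Dt rho (T r) (X r)) with (- (w r * Dx rho (T r) (X r) + rho (T r) (X r) * Dx v (T r) (X r))) by lra.
        field. lra. }
  assert (hrho : forall t x, Omega (t, x) -> rho t x * (c + v t x) = Z (G (t + x / c) - t)).
  { intros t x hO. destruct (Omega_pair _ _ hO) as [ht hx].
    assert (hxc : 0 <= x / c) by (apply Rdiv_le_0_compat; lra).
    set (s0 := t + x / c). set (r := G s0 - t).
    (* A non-negative label is traced back to the point [H r] of the initial profile, whose
       parameter is [H r / c]; the bound r <= G0 x places it in [0, x]. *)
    destruct (Rle_dec 0 r) as [hr|hr].
    - assert (hr1 : r <= G0 x).
      { rewrite -hGi; auto. unfold r, s0. destruct (Rle_lt_or_eq_dec 0 t ht) as [ht'|ht'].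
        pose proof (hD_lt (x / c) (t + x / c) ltac:(lra)). lra.
        rewrite -ht'. rewrite Rplus_0_l. lra. }
      assert (Hmono : forall a b, a <= b -> H a <= H b).
      { intros a b hab. apply (derive_nonneg_le H (fun r => c + v0 (clamp01 (H r)))); auto.
        intros z _. pose proof (hv0 _ (clamp01_in (H z))). lra. }
      assert (hxi : 0 <= H r <= x).
      { rewrite -{1}H0 -(HG0 x). split; apply Hmono; auto. }
      assert (hI : I01 (H r)) by (unfold I01; lra).
      assert (eG : G (H r / c) = r) by (rewrite hGi; auto).
      assert (hle : H r / c <= s0).
      { apply Rle_trans with (x / c); unfold s0; [|lra]. apply Rmult_le_compat_r; [|lra].
        left; apply Rinv_0_lt_compat; auto. }
      assert (e1 : t + G (H r / c) - G s0 = 0) by (rewrite eG; unfold r; ring).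
      assert (e2 : c * (H r / c - 0) = H r) by (field; lra).
      specialize (hchar t x (H r / c) hO). fold s0 in hchar. rewrite e1 e2 in hchar.
      rewrite -hchar; auto.
      + destruct (hinit (H r) hI). unfold Z. rewrite clamp01_id; auto.
        f_equal; [|f_equal]; lra.
      + apply Rdiv_le_0_compat; lra.
      + split; auto. simpl; unfold Rnneg; lra.
    - rewrite label_neg; [|lra].
      (* At the inlet, time and parameter coincide and the label is G s - s. It is 0 at s = 0 and at
         most r at s0, so some entry time s1 carries the label r. *)
      destruct (IVT_gen (fun s => G s - s) 0 s0 r) as [s1 [hs1 es1]].
      { intros s. apply continuity_pt_filterlim. apply: continuous_minus; auto. apply: continuous_id. }
      { rewrite G_0. rewrite Rminus_0_r. unfold r, s0.
        assert (G (t + x / c) - (t + x / c) <= G (t + x / c) - t) by lra.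
        split. apply Rle_trans with (2 := H1). apply Rmin_r.
        apply Rle_trans with 0. unfold r, s0 in hr; lra. apply Rmax_l. }
      assert (hs0 : 0 <= s0) by (unfold s0; lra).
      rewrite Rmin_left in hs1; auto. rewrite Rmax_right in hs1; auto.
      assert (e1 : t + G s1 - G s0 = s1) by (unfold r in es1; lra).
      assert (e2 : c * (s1 - s1) = 0) by ring.
      specialize (hchar t x s1 hO). fold s0 in hchar. rewrite e1 e2 in hchar.
      assert (hO1 : Omega (s1, 0)) by (split; simpl; unfold Rnneg, I01; lra).
      rewrite -hchar; auto; try lra.
      destruct (hbd s1 ltac:(unfold Rnneg; lra)) as [hb1 _].
      unfold feedback in hb1. destruct (hpos _ _ hO1) as [_ hv1]. rewrite hb1 hinlet; auto.
      field. lra. }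
  assert (hy1 : C1_on Rnneg (fun t => v t 1)).
  { split.
    - intros t ht. apply hCv. split; auto. apply I01_1.
    - intros t ht. destruct hCv as [_ [_ [hct _]]].
      assert (hO : Omega (t, 1)) by (split; auto; apply I01_1).
      intros P hP. destruct (hct (t, 1) hO P hP) as [d hd]. exists d. intros s hs hs2.
      apply (hd (s, 1)). split; auto. apply ball_center. split; auto. apply I01_1. }
  destruct (C1_extension _ _ _ pos_part_retract hy1) as [_ [y [dy hy]]].
  exists y, w, G. split; auto.
  - intros t ht. rewrite hy; auto. symmetry. apply hvw. split; auto. apply I01_1.
  - intros t ht. apply (is_derive_eq _ _ _ _ (dy t)). rewrite pos_part_id; auto.
    destruct (hbd t ht) as [_ hb2]. unfold Dt in hb2. rewrite hb2.
    assert (hO : Omega (t, 1)) by (split; auto; apply I01_1).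
    unfold outlet_accel. rewrite hy; auto. specialize (hrho t 1 hO).
    destruct (hpos _ _ hO). rewrite pos_part_id; [|lra]. rewrite -hrho.
    f_equal. f_equal. f_equal. field. lra.
Qed.
End Representation.

(** * Existence *)

Lemma lipschitz2_le F L L' : L <= L' -> lipschitz2 F L -> lipschitz2 F L'.
Proof.
  intros h hF a b a' b'. apply Rle_trans with (1 := hF a b a' b').
  apply Rmult_le_compat_r; auto. pose proof (Rabs_pos (a - a')). pose proof (Rabs_pos (b - b')). lra.
Qed.

Lemma lipschitz2_locally_lipschitz F L u v : 0 <= L -> lipschitz2 F L -> locally_lipschitz u ->
  locally_lipschitz v -> locally_lipschitz (fun x => F (u x) (v x)).
Proof.
  intros hL hF hu hv M. destruct (hu M) as [L1 [h1 h1']]. destruct (hv M) as [L2 [h2 h2']].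
  exists (L * (L1 + L2)). split. nra. intros x y hx hy.
  apply Rle_trans with (1 := hF _ _ _ _). rewrite Rmult_assoc.
  apply Rmult_le_compat_l; auto. specialize (h1' x y hx hy). specialize (h2' x y hx hy). lra.
Qed.

(** Below m the speed cannot decrease: the argument of [f] is at most B/c, so the target speed is at
    least f(B/c) >= m. *)
Lemma outlet_lower_bound c mu f Z B m (y r : R -> R) : 0 < c -> 0 < mu -> speed_function f ->
  (forall s, 0 <= Z s <= B) ->
  (forall t, 0 <= t -> is_derive y t (outlet_accel c mu f Z (y t) (r t))) ->
  m <= y 0 -> m <= f (B / c) -> forall t, 0 <= t -> m <= y t.
Proof.
  intros hc hmu [_ [_ [_ hf]]] hZ dy h0 hm t ht.
  assert (m - y t <= 0); [|lra].
  apply (gronwall_nonpos (fun t => m - y t) (fun t => 0 - outlet_accel c mu f Z (y t) (r t)) 0); auto.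
  - intros s hs. apply: is_derive_minus; auto. apply: is_derive_const.
  - intros s hs hu. unfold outlet_accel.
    assert (f (B / c) <= f (Z (r s) / (c + pos_part (y s)))).
    { pose proof (hZ (r s)). pose proof (pos_part_nonneg (y s)). apply hf.
      apply Rdiv_le_0_compat; lra.
      apply Rmult_le_compat; try lra. left; apply Rinv_0_lt_compat; lra. apply Rinv_le_contravar; lra. }
    nra.
  - lra.
Qed.

Section Existence.
Variables (c mu rho_eq : R) (f rho0 v0 G0 H : R -> R).
Let A := rho_eq * (c + f rho_eq).
Let Z r := rho0 (clamp01 (H r)) * (c + v0 (clamp01 (H r))).
Hypotheses (hc : 0 < c) (hmu : 0 < mu) (hf : speed_function f)
  (hr0 : forall x, I01 x -> 0 < rho0 x)
  (hv0 : forall x, I01 x -> 0 < v0 x)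
  (hr0W : W2inf rho0) (hv0W : W2inf v0)
  (hz0 : rho0 0 * (c + v0 0) = A)
  (hz0' : Derive_in I01 rho0 0 * (c + v0 0) + rho0 0 * Derive_in I01 v0 0 = 0)
  (hv1 : c * Derive_in I01 v0 1 = - mu * (v0 1 - f (rho0 1)))
  (G00 : G0 0 = 0)
  (dG0 : forall x, is_derive G0 x (/ (c + v0 (clamp01 x))))
  (dH : forall r, is_derive H r (c + v0 (clamp01 (H r))))
  (HG0 : forall x, H (G0 x) = x).

Let v0_lip : locally_lipschitz (fun x => v0 (clamp01 x)).
Proof. apply (C1_on_locally_lipschitz I01); [apply clamp01_retract|apply hv0W]. Qed.

Let rho0_lip : locally_lipschitz (fun x => rho0 (clamp01 x)).
Proof. apply (C1_on_locally_lipschitz I01); [apply clamp01_retract|apply hr0W]. Qed.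

Let c_v0_lip : locally_lipschitz (fun x => c + v0 (clamp01 x)).
Proof.
  apply (locally_lipschitz_plus (fun _ => c)); auto.
  apply (locally_lipschitz_ext (fun x => 0 * x + c)). intros; ring. apply locally_lipschitz_affine.
Qed.

Lemma W2inf_derivative_lipschitz u : W2inf u -> locally_lipschitz (fun x => Derive_in I01 u (clamp01 x)).
Proof.
  intros [_ [L hl]]. apply (lipschitz_locally_lipschitz _ (Rabs L)). intros x y.
  apply Rle_trans with (1 := hl _ _ (clamp01_in x) (clamp01_in y)).
  apply Rle_trans with (Rabs L * Rabs (clamp01 x - clamp01 y)).
  apply Rmult_le_compat_r; auto using Rabs_pos, Rle_abs.
  apply Rmult_le_compat_l; auto using Rabs_pos. apply (retract_contract _ _ clamp01_retract).
Qed.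

Let H_lip : locally_lipschitz H.
Proof.
  apply (is_derive_locally_lipschitz H (fun r => c + v0 (clamp01 (H r)))); auto. intros x.
  apply (continuous_comp H (fun s => c + v0 (clamp01 s))). apply: ex_derive_continuous; eexists; apply dH.
  apply locally_lipschitz_continuous; auto.
Qed.

Let H_mono a b : a <= b -> H a <= H b.
Proof.
  intros hab. apply (derive_nonneg_le H (fun r => c + v0 (clamp01 (H r)))); auto.
  intros z _. pose proof (hv0 _ (clamp01_in (H z))). lra.
Qed.

(** [H] has bounded slope because c + v0 is bounded on [0, 1]. These global bounds on [Z] are the
    ones that [outlet_accel_lipschitz] asks for. *)
Lemma label_bounds : exists B LZ, (forall r, 0 <= Z r <= B) /\
  (forall r s, Rabs (Z r - Z s) <= LZ * Rabs (r - s)).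
Proof.
  assert (hz : locally_lipschitz (fun x => rho0 (clamp01 x) * (c + v0 (clamp01 x))))
    by (apply locally_lipschitz_mult; auto).
  destruct (locally_lipschitz_bound _ hz 1) as [B [hB hb]].
  destruct (clamp01_lipschitz _ hz) as [L [hL hl]].
  destruct (locally_lipschitz_bound _ c_v0_lip 1) as [K [hK hk]].
  assert (hHL : forall a b, a <= b -> Rabs (H b - H a) <= K * b - K * a).
  { intros a b hab. apply (derive_abs_le H (fun r => c + v0 (clamp01 (H r))) (fun s => K * s) (fun _ => K)); auto.
    intros; auto_derive; auto; ring.
    intros x _. rewrite -(clamp01_idem (H x)). apply hk, clamp01_bound. }
  exists B, (L * K). split.
  - intros r. specialize (hb _ (clamp01_bound (H r))). rewrite !clamp01_idem in hb.
    pose proof (hr0 _ (clamp01_in (H r))). pose proof (hv0 _ (clamp01_in (H r))).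
    assert (0 <= Z r) by (unfold Z; apply Rmult_le_pos; lra). split; auto.
    apply Rle_trans with (2 := hb). apply Rle_abs.
  - intros r s. specialize (hl (H r) (H s)). rewrite !clamp01_idem in hl.
    apply Rle_trans with (1 := hl). rewrite Rmult_assoc. apply Rmult_le_compat_l; auto.
    destruct (Rle_dec s r) as [e|e].
    + rewrite (Rabs_pos_eq (r - s)); [|lra]. specialize (hHL s r e). lra.
    + rewrite Rabs_minus_sym (Rabs_minus_sym r) (Rabs_pos_eq (s - r)); [|lra].
      specialize (hHL r s ltac:(lra)). lra.
Qed.

(** The clamp may give [Z] a corner at the label [G0 1], the largest one that occurs on the road;
    [ZZ] continues it smoothly beyond. At the label 0 there is no corner: [hz0'] says that the
    derivative of rho0 (c + v0) vanishes at x = 0 and so joins the constant [A]. *)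
Lemma label_smooth : exists ZZ dZZ : R -> R, (forall r, is_derive ZZ r (dZZ r)) /\
  locally_lipschitz ZZ /\ locally_lipschitz dZZ /\ (forall r, r <= G0 1 -> ZZ r = Z r).
Proof.
  set (dz := fun x => Derive_in I01 rho0 (clamp01 x) * (c + v0 (clamp01 x))
                      + rho0 (clamp01 x) * Derive_in I01 v0 (clamp01 x)).
  assert (hdz : locally_lipschitz dz).
  { apply locally_lipschitz_plus; apply locally_lipschitz_mult; auto using W2inf_derivative_lipschitz. }
  set (Ze := fun x => A + RInt dz 0 x).
  assert (dZe : forall x, is_derive Ze x (dz x)).
  { intros x. apply (is_derive_eq _ _ (0 + dz x)); [|ring]. apply: is_derive_plus. apply: is_derive_const.
    apply is_derive_primitive. intros; apply locally_lipschitz_continuous; auto. }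
  assert (hZe0 : Ze 0 = A) by (unfold Ze; rewrite RInt_00; ring).
  assert (hZneg : forall x, x <= 0 -> Ze x = A).
  { intros x hx. rewrite -hZe0. apply (derive_0_const Ze); auto.
    - intros s hs. apply (is_derive_eq _ _ _ _ (dZe s)). unfold dz.
      assert (e : clamp01 s = 0). { unfold clamp01. rewrite Rmin_right; [|lra]. rewrite Rmax_left; lra. }
      rewrite e. exact hz0'.
    - intros s _. apply: ex_derive_continuous; eexists; apply dZe. }
  assert (hZpos : forall x, I01 x -> Ze x = rho0 x * (c + v0 x)).
  { intros x hx.
    destruct (C1_extension _ _ _ clamp01_retract (proj1 hr0W)) as [_ [R0 [dR0 eR0]]].
    destruct (C1_extension _ _ _ clamp01_retract (proj1 hv0W)) as [_ [V0 [dV0 eV0]]].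
    rewrite -eR0; auto. rewrite -eV0; auto.
    apply (derive_eq_eq Ze (fun x => R0 x * (c + V0 x)) dz 0 x); auto. apply hx.
    - intros s hs. assert (hs' : I01 s) by (unfold I01 in *; lra).
      apply (is_derive_eq _ _ (Derive_in I01 rho0 (clamp01 s) * (c + V0 s) +
        R0 s * (0 + Derive_in I01 v0 (clamp01 s)))).
      + apply: is_derive_mult; auto; [|intros; apply Rmult_comm].
        apply: is_derive_plus; auto. apply: is_derive_const.
      + unfold dz. rewrite eR0; auto. rewrite eV0; auto. rewrite clamp01_id; auto. ring.
    - rewrite hZe0 -hz0 eR0 ?eV0; auto using I01_0. }
  exists (fun r => Ze (H r)), (fun r => (c + v0 (clamp01 (H r))) * dz (H r)).
  split; [|split; [|split]].
  - intros r. apply: (is_derive_comp Ze H); auto.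
  - apply (locally_lipschitz_comp H Ze); auto.
    apply (is_derive_locally_lipschitz _ dz); auto. intros; apply locally_lipschitz_continuous; auto.
  - apply (locally_lipschitz_comp H (fun s => (c + v0 (clamp01 s)) * dz s)); auto.
    apply locally_lipschitz_mult; auto.
  - intros r hr. apply H_mono in hr. rewrite HG0 in hr.
    destruct (Rle_dec 0 (H r)) as [e|e].
    + assert (hI : I01 (H r)) by (unfold I01; lra). rewrite hZpos; auto. unfold Z. rewrite clamp01_id; auto.
    + rewrite hZneg; [|lra]. unfold Z. assert (e2 : clamp01 (H r) = 0).
      { unfold clamp01. rewrite Rmin_right; [|lra]. rewrite Rmax_left; lra. }
      rewrite e2. auto.
Qed.

Lemma outlet_profile : exists w dw G : R -> R,
  (forall s, is_derive w s (dw s)) /\ locally_lipschitz w /\ locally_lipschitz dw /\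
  (forall s, 0 <= s -> 0 < w s) /\ (forall x, I01 x -> w (x / c) = v0 x) /\
  G 0 = 0 /\ (forall s, is_derive G s (c / (c + w (pos_part s)))) /\
  (forall t, 0 <= t -> dw (t + 1 / c) =
     - mu * (w (t + 1 / c) - f (Z (G (t + 1 / c) - t) / (c + w (t + 1 / c))))).
Proof.
  destruct label_bounds as [B [LZ [hB hLZ]]].
  destruct (outlet_accel_lipschitz c mu f Z B LZ) as [L [hL hacc]]; auto.
  { apply (C1_on_locally_lipschitz Rnneg); [apply pos_part_retract|apply hf]. }
  assert (hic : 0 < / c) by (apply Rinv_0_lt_compat; auto).
  assert (hL1 : lipschitz2 (outlet_accel c mu f Z) (L + / c)) by (apply lipschitz2_le with L; auto; lra).
  assert (hL2 : lipschitz2 (outlet_drift c) (L + / c)).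
  { apply lipschitz2_le with (/ c). lra. apply outlet_drift_lipschitz; auto. }
  destruct (picard_lindelof _ _ (L + / c) (v0 1) (G0 1) ltac:(lra) hL1 hL2) as [y [r [hy0 [hr_0 [dy dr]]]]].
  set (a := fun t => outlet_accel c mu f Z (y (pos_part t)) (r (pos_part t))) in *.
  assert (yc : forall t, continuous y t) by (intros; apply: ex_derive_continuous; eexists; apply dy).
  assert (rc : forall t, continuous r t) by (intros; apply: ex_derive_continuous; eexists; apply dr).
  assert (ypc : forall t, continuous (fun t => y (pos_part t)) t).
  { intros t. apply (continuous_comp pos_part y); auto. apply pos_part_continuous. }
  assert (rpc : forall t, continuous (fun t => r (pos_part t)) t).
  { intros t. apply (continuous_comp pos_part r); auto. apply pos_part_continuous. }
  assert (hyl : locally_lipschitz y).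
  { apply (is_derive_locally_lipschitz _ _ dy). intros t.
    apply (lipschitz2_continuous _ _ (fun t => y (pos_part t)) (fun t => r (pos_part t)) t hL1); auto. }
  assert (hrl : locally_lipschitz r).
  { apply (is_derive_locally_lipschitz _ _ dr). intros t.
    apply (lipschitz2_continuous _ _ (fun t => y (pos_part t)) (fun t => r (pos_part t)) t hL2); auto. }
  assert (hpl : locally_lipschitz pos_part) by apply (locally_lipschitz_retract _ _ pos_part_retract).
  assert (hal : locally_lipschitz a).
  { apply (lipschitz2_locally_lipschitz _ (L + / c) (fun t => y (pos_part t)) (fun t => r (pos_part t))); auto.
    lra. apply (locally_lipschitz_comp pos_part y); auto. apply (locally_lipschitz_comp pos_part r); auto. }
  assert (hypos : forall t, 0 <= t -> 0 < y t).
  { intros t ht.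
    apply Rlt_le_trans with (Rmin (v0 1) (f (B / c))).
    - apply Rmin_pos. apply hv0, I01_1. apply hf. unfold Rnneg. apply Rdiv_le_0_compat; auto.
      pose proof (hB 0); lra.
    - apply (outlet_lower_bound c mu f Z B _ y (fun t => r (pos_part t))); auto.
      + intros s hs. apply (is_derive_eq _ _ _ _ (dy s)). rewrite !pos_part_id; auto.
      + rewrite hy0. apply Rmin_l.
      + apply Rmin_r. }
  destruct (C1_extension _ _ _ clamp01_retract (proj1 hv0W)) as [dv0c [V0 [dV0 eV0]]].
  set (dv0 := fun x => Derive_in I01 v0 (clamp01 x)) in *.
  (* The field is frozen at time 0 for negative times, so [y] is affine there, just as [V0] is
     beyond 1. *)
  assert (hyneg : forall t, t <= 0 -> y t = v0 1 + a 0 * t).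
  { intros t ht.
    assert (E : y t - a 0 * t = y 0 - a 0 * 0).
    { apply (derive_0_const (fun t => y t - a 0 * t)); auto.
      - intros s hs. apply (is_derive_eq _ _ (a s - a 0)).
        apply: is_derive_minus. apply dy. auto_derive; auto; ring.
        unfold a. unfold pos_part. rewrite !(Rmax_left 0); try lra.
      - intros s _. apply: continuous_minus; auto. apply: ex_derive_continuous. auto_derive; auto. }
    rewrite hy0 in E. lra. }
  (* The outlet condition satisfied by the initial state: the two pieces of [w] meet at 1/c with
     equal slopes. *)
  assert (ha0 : c * dv0 1 = a 0).
  { unfold dv0. rewrite clamp01_id; [|apply I01_1]. rewrite hv1. unfold a, outlet_accel.
    rewrite pos_part_id; [|lra]. rewrite hy0 hr_0. unfold Z. rewrite HG0 clamp01_id; [|apply I01_1].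
    pose proof (hv0 1 I01_1). rewrite pos_part_id; [|lra]. f_equal. f_equal. f_equal. field. lra. }
  (* On each side of [1 / c] one of the two extensions [V0] and [y] is affine
     with slope [a 0], which leaves the other one. *)
  set (w := fun s => V0 (c * s) + y (s - 1 / c) - a 0 * (s - 1 / c) - v0 1).
  set (dw := fun s => c * dv0 (c * s) + a (s - 1 / c) - a 0).
  assert (hdw : forall s, is_derive w s (dw s)).
  { intros s. apply (is_derive_eq _ _ (c * dv0 (c * s) + 1 * a (s - 1 / c) - a 0 - 0)); [|unfold dw; ring].
    apply: is_derive_minus; [|apply: is_derive_const].
    apply: is_derive_minus; [apply: is_derive_plus|].
    - apply: (is_derive_comp V0 (fun s => c * s)). apply dV0. auto_derive; auto; ring.
    - apply: (is_derive_comp y (fun s => s - 1 / c)). apply dy. auto_derive; auto; ring.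
    - auto_derive; auto; ring. }
  assert (hdwl : locally_lipschitz dw).
  { apply (locally_lipschitz_plus (fun s => c * dv0 (c * s) + a (s - 1 / c)) (fun _ => - a 0)).
    apply locally_lipschitz_plus.
    - apply (locally_lipschitz_scal c). apply (locally_lipschitz_comp (fun s => c * s) dv0).
      apply (locally_lipschitz_ext (fun x => c * x + 0)). intros; ring. apply locally_lipschitz_affine.
      apply W2inf_derivative_lipschitz; auto.
    - apply (locally_lipschitz_comp (fun s => s - 1 / c) a); auto.
      apply (locally_lipschitz_ext (fun x => 1 * x + - (1 / c))). intros; ring. apply locally_lipschitz_affine.
    - apply (locally_lipschitz_ext (fun x => 0 * x + - a 0)). intros; ring. apply locally_lipschitz_affine. }
  assert (hwl : locally_lipschitz w).
  { apply (is_derive_locally_lipschitz _ _ hdw). intros; apply locally_lipschitz_continuous; auto. }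
  assert (hwi : forall x, I01 x -> w (x / c) = v0 x).
  { intros x hx. unfold w. rewrite hyneg.
    - replace (c * (x / c)) with x by (field; lra). rewrite eV0; auto. ring.
    - apply Rmult_le_reg_l with c; auto. replace (c * (x / c - 1 / c)) with (x - 1) by (field; lra).
      rewrite Rmult_0_r. destruct hx; lra. }
  assert (hwo : forall t, 0 <= t -> w (t + 1 / c) = y t).
  { intros t ht. unfold w. replace (t + 1 / c - 1 / c) with t by ring.
    assert (E : V0 (c * (t + 1 / c)) = v0 1 + a 0 * t).
    { apply (derive_eq_eq (fun t => V0 (c * (t + 1 / c))) (fun t => v0 1 + a 0 * t) (fun _ => a 0) 0 t); auto.
      - intros s hs. apply (is_derive_eq _ _ (c * dv0 (c * (s + 1 / c)))).
        + apply: (is_derive_comp V0 (fun s => c * (s + 1 / c))). apply dV0. auto_derive; auto; ring.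
        + rewrite -ha0. f_equal. unfold dv0. f_equal.
          replace (c * (s + 1 / c)) with (1 + c * s) by (field; lra).
          unfold clamp01. rewrite !Rmin_left; auto; try lra. nra.
      - intros s hs. auto_derive; auto; ring.
      - rewrite -eV0; [|apply I01_1]. rewrite Rplus_0_l Rmult_0_r Rplus_0_r. f_equal. field; lra. }
    rewrite E. ring. }
  assert (hwp : forall s, 0 <= s -> 0 < w s).
  { intros s hs. destruct (Rle_dec s (1 / c)) as [e|e].
    - replace s with (c * s / c) by (field; lra). assert (hI : I01 (c * s)).
      { split. nra. apply Rmult_le_compat_l with (r := c) in e; [|lra].
        replace (c * (1 / c)) with 1 in e by (field; lra). lra. }
      rewrite hwi; auto.
    - replace s with ((s - 1 / c) + 1 / c) by ring. rewrite hwo; [|lra]. apply hypos. lra. }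
  (* [w] is known to be positive only for s >= 0; the positive part keeps the denominator away from
     0 on the whole line. *)
  set (Gd := fun s => c / (c + w (pos_part s))).
  assert (hGd : forall s, continuous Gd s).
  { intros s. apply: continuous_mult. apply continuous_const. apply continuous_Rinv_comp.
    apply: continuous_plus. apply continuous_const.
    apply (continuous_comp pos_part w). apply pos_part_continuous. apply locally_lipschitz_continuous; auto.
    pose proof (hwp _ (pos_part_nonneg s)). simpl. lra. }
  set (G := fun s => RInt Gd 0 s).
  assert (dG : forall s, is_derive G s (Gd s)) by (intros; apply is_derive_primitive; auto).
  assert (G_0 : G 0 = 0) by apply RInt_00.
  assert (hG1 : forall x, I01 x -> G (x / c) = G0 x).
  { intros x hx. apply (label_initial c v0 G0); auto.
    intros z hz. apply (is_derive_eq _ _ _ _ (dG _)). unfold Gd. rewrite pos_part_id ?hwi; auto.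
    apply Rdiv_le_0_compat; auto. apply hz. }
  (* The second Picard component was solved for without [G]. It is identified with the outlet label
     by equal derivatives and equal initial values [G0 1]. *)
  assert (hrG : forall t, 0 <= t -> r t = G (t + 1 / c) - t).
  { intros t ht. apply (derive_eq_eq r (fun t => G (t + 1 / c) - t) (fun t => outlet_drift c (y t) (r t)) 0 t); auto.
    - intros s hs. apply (is_derive_eq _ _ _ _ (dr s)). rewrite pos_part_id; auto; lra.
    - intros s hs. apply (is_derive_eq _ _ (1 * Gd (s + 1 / c) - 1)).
      + apply: is_derive_minus; [|apply: is_derive_id].
        apply: (is_derive_comp G (fun s => s + 1 / c)). apply dG. auto_derive; auto; ring.
      + assert (0 < 1 / c) by (unfold Rdiv; lra).
        unfold Gd, outlet_drift. rewrite pos_part_id; [|lra]. rewrite hwo; [|lra].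
        pose proof (hypos s ltac:(lra)). rewrite pos_part_id; [|lra]. field. lra.
    - rewrite hr_0 Rplus_0_l hG1; [|apply I01_1]. ring. }
  exists w, dw, G. do 7 (split; auto).
  intros t ht. rewrite hwo; auto. rewrite -hrG; auto. unfold dw.
  replace (t + 1 / c - 1 / c) with t by ring.
  assert (e : dv0 (c * (t + 1 / c)) = dv0 1).
  { unfold dv0. f_equal. replace (c * (t + 1 / c)) with (1 + c * t) by (field; lra).
    unfold clamp01. rewrite !Rmin_left; auto; try lra. nra. }
  rewrite e ha0. unfold a, outlet_accel at 2. rewrite !(pos_part_id t); auto.
  pose proof (hypos t ht). rewrite (pos_part_id (y t)); [|lra]. ring.
Qed.
End Existence.

(** * Verification that the profiles define a solution *)

Section Assembly.
Variables (c mu rho_eq : R) (h f rho0 v0 w dw G Z dZ : R -> R).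
Let A := rho_eq * (c + f rho_eq).
Let rho t x := Z (G (t + x / c) - t) / (c + w (t + x / c)).
Let v t x := w (t + x / c).
Hypotheses (hc : 0 < c)
  (hinlet : forall V, 0 < V -> h (rho_eq * V * ((c + f rho_eq) / (c + V)) / V) = A / (c + V))
  (hinlet1 : forall V, 0 < V -> h (A / (c + V)) = A / (c + V) /\ Derive_in Rnneg h (A / (c + V)) = 1)
  (hA : 0 < A)
  (hv0 : forall x, I01 x -> 0 < v0 x)
  (hdw : forall s, is_derive w s (dw s)) (hwl : locally_lipschitz w) (hdwl : locally_lipschitz dw)
  (hwp : forall s, 0 <= s -> 0 < w s) (hwi : forall x, I01 x -> w (x / c) = v0 x)
  (hG0 : G 0 = 0) (dG : forall s, is_derive G s (c / (c + w (pos_part s))))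
  (hout : forall t, 0 <= t -> dw (t + 1 / c) =
     - mu * (w (t + 1 / c) - f (Z (G (t + 1 / c) - t) / (c + w (t + 1 / c)))))
  (hdZ : forall r, is_derive Z r (dZ r)) (hZl : locally_lipschitz Z) (hdZl : locally_lipschitz dZ)
  (hZneg : forall r, r <= 0 -> Z r = A)
  (hZi : forall x, I01 x -> Z (G (x / c)) = rho0 x * (c + v0 x))
  (hZp : forall t x, Omega (t, x) -> 0 < Z (G (t + x / c) - t)).

(** The reciprocal of c + w, cut off at negative arguments, where c + w may vanish. It is locally
    Lipschitz on the line and exact on the road. *)
Let D s := / (c + w (pos_part s)).

Let D_lip : locally_lipschitz D.
Proof.
  apply (locally_lipschitz_inv (fun s => c + w (pos_part s)) c); auto.
  - apply (locally_lipschitz_plus (fun _ => c)).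
    apply (locally_lipschitz_ext (fun x => 0 * x + c)). intros; ring. apply locally_lipschitz_affine.
    apply (locally_lipschitz_comp pos_part w); auto. apply (locally_lipschitz_retract _ _ pos_part_retract).
  - intros s. pose proof (hwp _ (pos_part_nonneg s)). lra.
Qed.

Let G_lip : locally_lipschitz G.
Proof.
  apply (is_derive_locally_lipschitz _ _ dG). intros s. apply locally_lipschitz_continuous.
  apply (locally_lipschitz_scal c); auto.
Qed.

Let Omega_time t x : Omega (t, x) -> 0 <= t + x / c.
Proof.
  intros hO. destruct (Omega_pair _ _ hO) as [ht hx].
  assert (0 <= x / c) by (apply Rdiv_le_0_compat; lra). lra.
Qed.

Let D_eq s : 0 <= s -> D s = / (c + w s).
Proof. intros hs. unfold D. rewrite pos_part_id; auto. Qed.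

(** Written as sums and products of locally Lipschitz factors, without quotients, so that continuity
    and Lipschitz bounds follow by composition. *)
Let rho_t t x := (dZ (G (t + x / c) - t) * (c * D (t + x / c) - 1)) * D (t + x / c)
  + (-1 * (Z (G (t + x / c) - t) * (dw (t + x / c) * (D (t + x / c) * D (t + x / c))))).
Let rho_x t x := (dZ (G (t + x / c) - t) * D (t + x / c)) * D (t + x / c)
  + (- / c * (Z (G (t + x / c) - t) * (dw (t + x / c) * (D (t + x / c) * D (t + x / c))))).

(** One computation serves both partial derivatives: S stands for t + x/c and T for t, as functions
    of either coordinate. *)
Let rho_derive (S T : R -> R) r dS dT : 0 <= S r -> is_derive S r dS -> is_derive T r dT ->
  is_derive (fun r => Z (G (S r) - T r) / (c + w (S r))) r
   ((dZ (G (S r) - T r) * (dS * (c * D (S r)) - dT)) * D (S r)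
    + (- dS * (Z (G (S r) - T r) * (dw (S r) * (D (S r) * D (S r)))))).
Proof.
  intros hs hS hT. pose proof (hwp _ hs).
  apply (is_derive_eq _ _ ((((dS * (c / (c + w (pos_part (S r)))) - dT) * dZ (G (S r) - T r)) * (c + w (S r))
     - Z (G (S r) - T r) * (0 + dS * dw (S r))) / (c + w (S r)) ^ 2)).
  - apply: is_derive_div; [| |lra].
    + apply: (is_derive_comp Z (fun r => G (S r) - T r)); auto.
      apply: is_derive_minus; auto. apply: (is_derive_comp G S); auto.
    + apply: is_derive_plus. apply: is_derive_const. apply: (is_derive_comp w S); auto.
  - rewrite D_eq; auto. rewrite pos_part_id; auto. field. lra.
Qed.

Let S_cont (p : R * R) : continuous (fun p : R * R => fst p + snd p / c) p.
Proof.
  destruct p as [t x]. apply: continuous_plus. apply continuous_fst.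
  apply: continuous_mult. apply continuous_snd. apply continuous_const.
Qed.

Let comp_cont (u : R -> R) (g : R * R -> R) p : locally_lipschitz u -> continuous g p ->
  continuous (fun p => u (g p)) p.
Proof. intros hu hg. apply (continuous_comp g u); auto. apply locally_lipschitz_continuous; auto. Qed.

Let theta_cont (p : R * R) : continuous (fun p : R * R => G (fst p + snd p / c) - fst p) p.
Proof.
  apply: continuous_minus. apply (comp_cont G (fun p => fst p + snd p / c)); auto.
  destruct p; apply continuous_fst.
Qed.

Let rho_C1 : C1_Omega rho /\ forall t x, Omega (t, x) -> Dt rho t x = rho_t t x /\ Dx rho t x = rho_x t x.
Proof.
  assert (cZ : forall p, continuous (fun p : R * R => Z (G (fst p + snd p / c) - fst p)) p)
    by (intros; apply (comp_cont Z (fun p => G (fst p + snd p / c) - fst p)); auto).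
  assert (cdZ : forall p, continuous (fun p : R * R => dZ (G (fst p + snd p / c) - fst p)) p)
    by (intros; apply (comp_cont dZ (fun p => G (fst p + snd p / c) - fst p)); auto).
  assert (cD : forall p, continuous (fun p : R * R => D (fst p + snd p / c)) p)
    by (intros; apply (comp_cont D (fun p => fst p + snd p / c)); auto).
  assert (cw : forall p, continuous (fun p : R * R => w (fst p + snd p / c)) p)
    by (intros; apply (comp_cont w (fun p => fst p + snd p / c)); auto).
  assert (cdw : forall p, continuous (fun p : R * R => dw (fst p + snd p / c)) p)
    by (intros; apply (comp_cont dw (fun p => fst p + snd p / c)); auto).
  assert (cq : forall k p, continuous (fun p : R * R => k * (Z (G (fst p + snd p / c) - fst p) *
     (dw (fst p + snd p / c) * (D (fst p + snd p / c) * D (fst p + snd p / c))))) p).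
  { intros k p. apply: continuous_mult. apply continuous_const. apply: continuous_mult; auto.
    apply: continuous_mult; auto. apply: continuous_mult; auto. }
  apply C1_Omega_intro.
  - intros t x hO. pose proof (Omega_time _ _ hO).
    apply (is_derive_eq _ _ _ _ (rho_derive (fun t => t + x / c) (fun t => t) t 1 1 ltac:(auto)
      ltac:(auto_derive; auto; ring) ltac:(apply: is_derive_id))).
    unfold rho_t. ring.
  - intros t x hO. pose proof (Omega_time _ _ hO).
    apply (is_derive_eq _ _ _ _ (rho_derive (fun x => t + x / c) (fun x => t) x (/ c) 0 ltac:(auto)
      ltac:(auto_derive; auto; field; lra) ltac:(apply: is_derive_const))).
    unfold rho_x. field. lra.
  - intros [t x] hO. pose proof (hwp _ (Omega_time _ _ hO)) as hw. apply: continuous_mult; auto.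
    apply (continuous_comp (fun p : R * R => c + w (fst p + snd p / c)) Rinv); [|apply continuous_Rinv; simpl; lra].
    apply: continuous_plus; auto. apply continuous_const.
  - intros p _. apply: continuous_plus; [|apply cq]. apply: continuous_mult; auto. apply: continuous_mult; auto.
    apply: continuous_minus; [|apply continuous_const]. apply: continuous_mult; auto. apply continuous_const.
  - intros p _. apply: continuous_plus; [|apply cq]. apply: continuous_mult; auto. apply: continuous_mult; auto.
Qed.

Let v_C1 : C1_Omega v /\ forall t x, Omega (t, x) ->
  Dt v t x = dw (t + x / c) /\ Dx v t x = / c * dw (t + x / c).
Proof.
  apply (C1_Omega_intro v (fun t x => dw (t + x / c)) (fun t x => / c * dw (t + x / c))).
  - intros t x _. apply (is_derive_eq _ _ (1 * dw (t + x / c))); [|ring].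
    apply: (is_derive_comp w (fun t => t + x / c)); auto. auto_derive; auto; ring.
  - intros t x _. apply: (is_derive_comp w (fun x => t + x / c)); auto. auto_derive; auto; field; lra.
  - intros p _. apply (comp_cont w (fun p => fst p + snd p / c)); auto.
  - intros p _. apply (comp_cont dw (fun p => fst p + snd p / c)); auto.
  - intros p _. apply: continuous_mult. apply continuous_const.
    apply (comp_cont dw (fun p => fst p + snd p / c)); auto.
Qed.

(** The label at the inlet is G t - t, which starts at 0 and decreases because G' < 1; hence it lies
    where [Z] equals [A]. *)
Let rho_inlet t : 0 <= t -> rho t 0 = A / (c + v t 0).
Proof.
  intros ht. unfold rho, v. rewrite hZneg; auto.
  replace (t + 0 / c) with t by (field; lra).
  assert (G t - t <= G 0 - 0); [|lra].
  apply (derive_nonpos_le (fun t => G t - t) (fun s => c / (c + w (pos_part s)) - 1)); auto.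
  - intros s _. apply: is_derive_minus; auto. apply: is_derive_id.
  - intros s _. pose proof (hwp _ (pos_part_nonneg s)).
    replace (c / (c + w (pos_part s)) - 1) with (- (w (pos_part s) * / (c + w (pos_part s)))) by (field; lra).
    assert (0 < / (c + w (pos_part s))) by (apply Rinv_0_lt_compat; lra). nra.
Qed.

Let profile_state t : 0 <= t -> state_space c mu h f (rho t) (v t).
Proof.
  intros ht.
  assert (hO : forall x, I01 x -> Omega (t, x)) by (intros x hx; split; auto).
  assert (hS : locally_lipschitz (fun x => t + x / c)).
  { apply (locally_lipschitz_ext (fun x => / c * x + t)). intros; unfold Rdiv; ring.
    apply locally_lipschitz_affine. }
  assert (hth : locally_lipschitz (fun x => G (t + x / c) - t)).
  { apply (locally_lipschitz_plus (fun x => G (t + x / c)) (fun _ => - t)).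
    apply (locally_lipschitz_comp (fun x => t + x / c) G); auto.
    apply (locally_lipschitz_ext (fun x => 0 * x + - t)). intros; ring. apply locally_lipschitz_affine. }
  assert (lD : locally_lipschitz (fun x => D (t + x / c))) by (apply (locally_lipschitz_comp (fun x => t + x / c) D); auto).
  assert (ldw : locally_lipschitz (fun x => dw (t + x / c))) by (apply (locally_lipschitz_comp (fun x => t + x / c) dw); auto).
  assert (lZ : locally_lipschitz (fun x => Z (G (t + x / c) - t)))
    by (apply (locally_lipschitz_comp (fun x => G (t + x / c) - t) Z); auto).
  assert (ldZ : locally_lipschitz (fun x => dZ (G (t + x / c) - t)))
    by (apply (locally_lipschitz_comp (fun x => G (t + x / c) - t) dZ); auto).
  destruct (W2inf_intro (rho t) (rho_x t) (rho_x t)) as [w1 e1]; auto.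
  { intros x hx. pose proof (Omega_time _ _ (hO x hx)).
    apply (is_derive_eq _ _ _ _ (rho_derive (fun x => t + x / c) (fun x => t) x (/ c) 0 ltac:(auto)
      ltac:(auto_derive; auto; field; lra) ltac:(apply: is_derive_const))).
    unfold rho_x. field. lra. }
  { unfold rho_x. apply locally_lipschitz_plus.
    - apply locally_lipschitz_mult; auto. apply locally_lipschitz_mult; auto.
    - apply (locally_lipschitz_scal (- / c)). apply locally_lipschitz_mult; auto.
      apply locally_lipschitz_mult; auto. apply locally_lipschitz_mult; auto. }
  destruct (W2inf_intro (v t) (fun x => / c * dw (t + x / c)) (fun x => / c * dw (t + x / c))) as [w2 e2]; auto.
  { intros x hx. apply: (is_derive_comp w (fun x => t + x / c)); auto. auto_derive; auto; field; lra. }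
  { apply (locally_lipschitz_scal (/ c)); auto. }
  split; [|split; [|split; [|split]]]; auto.
  - intros x hx. pose proof (hwp _ (Omega_time _ _ (hO x hx))).
    apply Rmin_pos; auto. apply Rdiv_lt_0_compat; [apply hZp; auto|lra].
  - rewrite e2; [|apply I01_1]. rewrite -(hout t ht). field. lra.
  - assert (hv : 0 < v t 0) by (apply hwp, Omega_time, hO, I01_0).
    (* At this a1 the function [h] is the identity with slope 1, so a2 can be the whole left-hand
       side. *)
    exists (A / (c + v t 0)), (v t 0 * Derive_in I01 (rho t) 0 + rho t 0 * Derive_in I01 (v t) 0).
    destruct (hinlet1 _ hv) as [i1 i2]. rewrite i1 i2. split; [|split].
    + apply Rdiv_lt_0_compat; auto. lra.
    + apply rho_inlet; auto.
    + ring.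
Qed.

Theorem closed_loop_solution_of_profile : closed_loop_solution c mu rho_eq h f rho0 v0 rho v.
Proof.
  destruct rho_C1 as [r1 r2]. destruct v_C1 as [v1 v2].
  split; [|split; [|split]]; auto. split; [|split].
  - intros t x hO. destruct (r2 _ _ hO) as [-> ->]. destruct (v2 _ _ hO) as [-> ->].
    pose proof (Omega_time _ _ hO) as hs. pose proof (hwp _ hs).
    unfold rho_t, rho_x, rho, v. rewrite D_eq; auto. split; field; lra.
  - intros t ht. split.
    + unfold feedback. rewrite hinlet. apply rho_inlet; auto.
      apply hwp, Omega_time. split; auto. apply I01_0.
    + assert (hO : Omega (t, 1)) by (split; auto; apply I01_1).
      destruct (v2 _ _ hO) as [-> _]. unfold v, rho. apply hout; auto.
  - intros x hx. unfold rho, v. rewrite !Rplus_0_l. rewrite hwi; auto.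
    rewrite Rminus_0_r hZi; auto. pose proof (hv0 x hx). split; [field; lra|ring].
Qed.
End Assembly.

(** * Comparison flows of class KL *)

(** The forward flow of b' = - lam(b). For [lam] Lipschitz, zero at 0 and positive on positive
    numbers, it is the usual source of a KL bound. *)
Record decay_flow (lam : R -> R) (beta : R -> R -> R) : Prop := {
  flow_0 : forall s, beta s 0 = s;
  flow_derive : forall s t, 0 <= t -> is_derive (beta s) t (- lam (beta s t)) }.

Section Decay.
Variables (lam : R -> R) (L : R) (beta : R -> R -> R).
Hypotheses (hL : 0 < L) (hlam : forall a b, Rabs (lam a - lam b) <= L * Rabs (a - b))
  (hlam0 : lam 0 = 0) (hpos : forall s, 0 < s -> 0 < lam s).

Lemma decay_flow_exists : exists b, decay_flow lam b.
Proof.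
  destruct (choice (fun s (y : R -> R) => y 0 = s /\
    forall t, 0 <= t -> is_derive y t (- lam (y t)))) as [b hb].
  { intros s. destruct (picard_lindelof (fun a _ => - lam a) (fun _ _ => 0) L s 0) as [y [r [h0 [_ [dy _]]]]]; auto.
    - intros a b a' b'. replace (- lam a - - lam a') with (- (lam a - lam a')) by ring. rewrite Rabs_Ropp.
      apply Rle_trans with (1 := hlam a a'). pose proof (Rabs_pos (b - b')). nra.
    - intros a b a' b'. rewrite Rminus_diag Rabs_R0.
      pose proof (Rabs_pos (a - a')). pose proof (Rabs_pos (b - b')). nra.
    - exists y. split; auto. intros t ht. apply (is_derive_eq _ _ _ _ (dy t)). rewrite pos_part_id; auto. }
  exists b. split; intros; apply hb; auto.
Qed.

Hypothesis hbeta : decay_flow lam beta.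

(** The differential inequality is asked for only where p exceeds the flow. For p = v_eq - y or p =
    y - v_eq, and a non-negative flow, this fixes the side of v_eq on which y lies, so a single
    entry of the minimum in [decay_rate] has to be evaluated. *)
Lemma flow_comparison (p p' : R -> R) s :
  (forall t, 0 <= t -> is_derive p t (p' t)) ->
  (forall t, 0 <= t -> beta s t < p t -> p' t <= - lam (p t)) ->
  p 0 <= s -> forall t, 0 <= t -> p t <= beta s t.
Proof.
  intros dp hp h0 t ht. assert (p t - beta s t <= 0); [|lra].
  apply (gronwall_nonpos (fun t => p t - beta s t) (fun t => p' t - - lam (beta s t)) L); auto.
  - intros r hr. apply: is_derive_minus; auto. apply hbeta; auto.
  - intros r hr h. specialize (hp r hr ltac:(lra)).
    pose proof (hlam (beta s r) (p r)) as H. rewrite (Rabs_minus_sym (beta s r)) in H.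
    rewrite (Rabs_pos_eq (p r - beta s r)) in H; [|lra]. apply Rabs_le_between in H. lra.
  - rewrite (flow_0 _ _ hbeta). lra.
Qed.

Lemma flow_nonneg s t : 0 <= s -> 0 <= t -> 0 <= beta s t.
Proof.
  intros hs ht. apply (flow_comparison (fun _ => 0) (fun _ => 0) s); auto.
  - intros; apply: is_derive_const.
  - intros; rewrite hlam0; lra.
Qed.

Lemma flow_mono_l s1 s2 t : s1 <= s2 -> 0 <= t -> beta s1 t <= beta s2 t.
Proof.
  intros hs ht. apply (flow_comparison (beta s1) (fun t => - lam (beta s1 t)) s2); auto.
  - intros; apply hbeta; auto.
  - intros; lra.
  - rewrite (flow_0 _ _ hbeta); auto.
Qed.

Lemma lam_nonneg s : 0 <= s -> 0 <= lam s.
Proof. intros [h|<-]; [left; auto|rewrite hlam0; lra]. Qed.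

Lemma flow_anti_r s t1 t2 : 0 <= s -> 0 <= t1 -> t1 <= t2 -> beta s t2 <= beta s t1.
Proof.
  intros hs h1 h2. apply (derive_nonpos_le (beta s) (fun t => - lam (beta s t))); auto.
  - intros; apply hbeta; lra.
  - intros x hx. pose proof (lam_nonneg _ (flow_nonneg s x hs ltac:(lra))). lra.
Qed.

Lemma flow_le s t : 0 <= s -> 0 <= t -> beta s t <= s.
Proof. intros hs ht. rewrite -{2}(flow_0 _ _ hbeta s). apply flow_anti_r; auto; lra. Qed.

Lemma flow_lipschitz_l s1 s2 t : 0 <= t -> Rabs (beta s1 t - beta s2 t) <= exp (L * t) * Rabs (s1 - s2).
Proof.
  intros ht.
  assert (key : forall a b, a <= b -> beta b t - beta a t <= exp (L * t) * (b - a)).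
  { intros a b hab. assert (beta b t - beta a t - exp (L * t) * (b - a) <= 0); [|lra].
    apply (gronwall_nonpos (fun t => beta b t - beta a t - exp (L * t) * (b - a))
      (fun t => (- lam (beta b t)) - (- lam (beta a t)) - L * exp (L * t) * (b - a)) L); auto.
    - intros s hs. apply: is_derive_minus. apply: is_derive_minus; apply hbeta; auto.
      auto_derive; auto; ring.
    - intros s hs _. pose proof (flow_mono_l a b s hab hs) as hm.
      pose proof (hlam (beta a s) (beta b s)) as H. rewrite (Rabs_minus_sym (beta a s)) in H.
      rewrite (Rabs_pos_eq (beta b s - beta a s)) in H; [|lra]. apply Rabs_le_between in H. lra.
    - rewrite !(flow_0 _ _ hbeta) Rmult_0_r exp_0. lra. }
  destruct (Rle_dec s1 s2) as [e|e].
  - rewrite Rabs_minus_sym (Rabs_minus_sym s1) (Rabs_pos_eq (s2 - s1)); [|lra].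
    rewrite Rabs_pos_eq; [|pose proof (flow_mono_l s1 s2 t e ht); lra]. auto.
  - assert (e' : s2 <= s1) by lra. rewrite (Rabs_pos_eq (s1 - s2)); [|lra].
    rewrite Rabs_pos_eq; [|pose proof (flow_mono_l s2 s1 t e' ht); lra]. auto.
Qed.

Lemma flow_lipschitz_r s t1 t2 : 0 <= s -> 0 <= t1 -> 0 <= t2 ->
  Rabs (beta s t1 - beta s t2) <= L * s * Rabs (t1 - t2).
Proof.
  intros hs.
  assert (key : forall a b, 0 <= a -> a <= b -> Rabs (beta s b - beta s a) <= L * s * b - L * s * a).
  { intros a b ha hab.
    apply (derive_abs_le (beta s) (fun t => - lam (beta s t)) (fun t => L * s * t) (fun _ => L * s)); auto.
    - intros; apply hbeta; lra.
    - intros; auto_derive; auto; ring.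
    - intros x hx. rewrite Rabs_Ropp.
      pose proof (hlam (beta s x) 0) as H. rewrite hlam0 !Rminus_0_r in H.
      apply Rle_trans with (1 := H). apply Rmult_le_compat_l; [lra|].
      rewrite Rabs_pos_eq. apply flow_le; auto; lra. apply flow_nonneg; auto; lra. }
  intros h1 h2. destruct (Rle_dec t1 t2) as [e|e].
  - rewrite Rabs_minus_sym (Rabs_minus_sym t1) (Rabs_pos_eq (t2 - t1)); [|lra]. specialize (key t1 t2 h1 e). lra.
  - rewrite (Rabs_pos_eq (t1 - t2)); [|lra]. specialize (key t2 t1 h2 ltac:(lra)). lra.
Qed.

(** As long as the flow stays in [e, s], it decreases at least at the rate lam z > 0, the minimum of
    [lam] there. It would have used up the height s by the time s / lam z. *)
Lemma flow_vanishes s e : 0 <= s -> 0 < e -> exists T, 0 <= T /\ forall t, T <= t -> beta s t < e.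
Proof.
  intros hs he.
  destruct (Rlt_le_dec s e) as [hse|hse].
  { exists 0. split; [lra|]. intros t ht. apply Rle_lt_trans with (2 := hse). apply flow_le; auto. }
  destruct (continuity_ab_min lam e s hse) as [z [hz hz2]].
  { intros x _. apply continuity_pt_filterlim. apply (contract_continuous lam L); auto. }
  assert (hlz : 0 < lam z) by (apply hpos; lra).
  assert (hex : exists T, 0 <= T /\ beta s T < e).
  { apply NNPP. intros hn.
    assert (hge : forall t, 0 <= t -> e <= beta s t).
    { intros t ht. apply Rnot_lt_le. intros h. apply hn. exists t; auto. }
    assert (hT : 0 <= s / lam z) by (apply Rdiv_le_0_compat; auto).
    assert (beta s (s / lam z) + lam z * (s / lam z) <= beta s 0 + lam z * 0).
    { apply (derive_nonpos_le (fun t => beta s t + lam z * t) (fun t => - lam (beta s t) + lam z)); auto.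
      - intros x hx. apply: is_derive_plus. apply hbeta; lra. auto_derive; auto; ring.
      - intros x hx. assert (lam z <= lam (beta s x)); [|lra]. apply hz. split. apply hge; lra.
        apply flow_le; auto; lra. }
    rewrite (flow_0 _ _ hbeta) in H. replace (lam z * (s / lam z)) with s in H by (field; lra).
    pose proof (hge _ hT). lra. }
  destruct hex as [T [hT h]]. exists T. split; auto. intros t ht.
  apply Rle_lt_trans with (2 := h). apply flow_anti_r; auto.
Qed.

Lemma flow_continuous {U : UniformSpace} (g k : U -> R) p : continuous g p -> continuous k p ->
  continuous (fun q => beta (pos_part (g q)) (pos_part (k q))) p.
Proof.
  intros hg hk.
  assert (hg' : continuous (fun q => pos_part (g q)) p) by (apply (continuous_comp g pos_part); auto; apply pos_part_continuous).
  assert (hk' : continuous (fun q => pos_part (k q)) p) by (apply (continuous_comp k pos_part); auto; apply pos_part_continuous).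
  set (a := pos_part (g p)) in *. set (b := pos_part (k p)) in *.
  assert (ha : 0 <= a) by apply pos_part_nonneg. assert (hb : 0 <= b) by apply pos_part_nonneg.
  apply filterlim_locally. intros e.
  assert (hE := exp_pos (L * b)).
  assert (d1 : 0 < e / 2 / exp (L * b)) by (apply Rdiv_lt_0_compat; [pose proof (cond_pos e); lra|auto]).
  (* The Lipschitz constant in time is L times the starting value, which is only known to stay below
     a plus the first tolerance; the second tolerance is therefore chosen after the first. *)
  assert (d2 : 0 < e / 2 / (L * (a + e / 2 / exp (L * b)))).
  { apply Rdiv_lt_0_compat; [pose proof (cond_pos e); lra|]. apply Rmult_lt_0_compat; lra. }
  assert (l1 := proj1 (filterlim_locally _ _) hg' (mkposreal _ d1)).
  assert (l2 := proj1 (filterlim_locally _ _) hk' (mkposreal _ d2)).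
  apply: filter_imp (filter_and _ _ l1 l2). intros q [b1 b2].
  change (Rabs (pos_part (g q) - a) < e / 2 / exp (L * b)) in b1.
  change (Rabs (pos_part (k q) - b) < e / 2 / (L * (a + e / 2 / exp (L * b)))) in b2.
  change (Rabs (beta (pos_part (g q)) (pos_part (k q)) - beta a b) < e).
  set (a' := pos_part (g q)) in *. set (b' := pos_part (k q)) in *.
  assert (ha' : 0 <= a') by apply pos_part_nonneg. assert (hb' : 0 <= b') by apply pos_part_nonneg.
  replace (beta a' b' - beta a b) with ((beta a' b' - beta a' b) + (beta a' b - beta a b)) by ring.
  apply Rle_lt_trans with (1 := Rabs_triang _ _).
  pose proof (flow_lipschitz_l a' a b hb) as f1. pose proof (flow_lipschitz_r a' b' b ha' hb' hb) as f2.
  assert (exp (L * b) * Rabs (a' - a) < e / 2).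
  { apply Rlt_le_trans with (exp (L * b) * (e / 2 / exp (L * b))). apply Rmult_lt_compat_l; auto.
    right; field; lra. }
  assert (L * a' * Rabs (b' - b) <= e / 2).
  { set (K := L * (a + e / 2 / exp (L * b))) in *.
    assert (hK : 0 < K) by (apply Rmult_lt_0_compat; lra).
    apply Rle_trans with (K * (e / 2 / K)).
    - apply Rmult_le_compat; auto using Rabs_pos; try lra. nra.
      unfold K. apply Rmult_le_compat_l; [lra|]. apply Rabs_lt_between in b1. lra.
    - right; field; lra. }
  lra.
Qed.
End Decay.

(** * Decay estimates *)

Lemma Rabs_Rmin_le a b a' b' : Rabs (Rmin a b - Rmin a' b') <= Rmax (Rabs (a - a')) (Rabs (b - b')).
Proof.
  unfold Rmin, Rmax, Rabs; repeat destruct Rle_dec; repeat destruct Rcase_abs; lra.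
Qed.

Lemma exp_le_compat x y : x <= y -> exp x <= exp y.
Proof. intros [h|h]. left; apply exp_increasing; auto. rewrite h; lra. Qed.

Lemma Rabs_ln_div_le a b d : 0 < a -> 0 < b -> (Rabs (ln (a / b)) <= d <-> b * exp (- d) <= a <= b * exp d).
Proof.
  intros ha hb. assert (hab : 0 < a / b) by (apply Rdiv_lt_0_compat; auto).
  assert (e : a = b * exp (ln (a / b))) by (rewrite exp_ln; auto; field; lra).
  set (l := ln (a / b)) in *. clearbody l. rewrite e.
  split.
  - intros h. apply Rabs_le_between in h.
    split; apply Rmult_le_compat_l; try lra; apply exp_le_compat; lra.
  - intros [h1 h2]. apply Rabs_le_between.
    assert (inc : forall x y, exp x <= exp y -> x <= y).
    { intros x y h. destruct (Rle_dec x y) as [n|n]; auto. assert (h3 : y < x) by lra.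
      apply exp_increasing in h3. lra. }
    split; apply inc; apply Rmult_le_reg_l with b; auto.
Qed.

(** From ln x <= x - 1, applied to a/b and to b/a. *)
Lemma Rabs_ln_div_lipschitz a b m : 0 < m -> m <= a -> m <= b -> Rabs (ln (a / b)) <= Rabs (a - b) / m.
Proof.
  intros hm ha hb.
  assert (lnle : forall x, 0 < x -> ln x <= x - 1).
  { intros x hx. pose proof (exp_ineq1_le (ln x)) as h. rewrite exp_ln in h; auto. lra. }
  assert (key : forall a b, m <= a -> m <= b -> ln (a / b) <= Rabs (a - b) / m).
  { intros p q hp hq. assert (hpq : 0 < p / q) by (apply Rdiv_lt_0_compat; lra).
    apply Rle_trans with (1 := lnle _ hpq).
    replace (p / q - 1) with ((p - q) * / q) by (field; lra).
    assert (0 < / q <= / m) by (split; [apply Rinv_0_lt_compat; lra|apply Rinv_le_contravar; lra]).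
    apply Rle_trans with (Rabs (p - q) * / q).
    apply Rmult_le_compat_r; [lra|apply Rle_abs]. apply Rmult_le_compat_l; [apply Rabs_pos|lra]. }
  apply Rabs_le. split; auto.
  assert (E : ln (a / b) = - ln (b / a)).
  { rewrite !ln_div; try lra. }
  rewrite E (Rabs_minus_sym a). specialize (key b a hb ha). lra.
Qed.

(** Lets e^d - 1 bound deviations on both sides of the equilibrium. *)
Lemma one_minus_exp_opp_le d : 0 <= d -> 1 - exp (- d) <= exp d - 1.
Proof.
  intros hd. pose proof (exp_ineq1_le d). pose proof (exp_ineq1_le (- d)). lra.
Qed.

Section Estimates.
Variables (c mu rho_eq : R) (f : R -> R).
Let v_eq := f rho_eq.
Let A := rho_eq * (c + v_eq).
Hypotheses (hc : 0 < c) (hmu : 0 < mu) (hrho : 0 < rho_eq) (hf : speed_function f)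
  (hsign : forall V, 0 <= V -> V <> v_eq -> (V - f (A / (c + V))) * (V - v_eq) > 0).

Let v_eq_pos : 0 < v_eq.
Proof. apply hf. unfold Rnneg; lra. Qed.

Let A_pos : 0 < A.
Proof. apply Rmult_lt_0_compat; lra. Qed.

Let f_lip : locally_lipschitz (fun s => f (pos_part s)).
Proof. apply (C1_on_locally_lipschitz Rnneg); [apply pos_part_retract|apply hf]. Qed.

Definition settled_accel (y : R) : R := outlet_accel c mu f (fun _ => A) y 0.

(* A lower bound for the speed at which [|y - v_eq| = s] decreases, whichever the
   side of [v_eq]. *)
Definition decay_rate (s : R) : R :=
  Rmin (- settled_accel (v_eq + pos_part s)) (settled_accel (pos_part (v_eq - pos_part s))).

Lemma settled_accel_eq y : 0 <= y -> settled_accel y = - mu * (y - f (A / (c + y))).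
Proof. intros hy. unfold settled_accel, outlet_accel. rewrite pos_part_id; auto. Qed.

Lemma settled_accel_0 : settled_accel v_eq = 0.
Proof.
  rewrite settled_accel_eq; [|lra].
  replace (A / (c + v_eq)) with rho_eq by (unfold A; field; lra). unfold v_eq; ring.
Qed.

Lemma decay_rate_0 : decay_rate 0 = 0.
Proof.
  unfold decay_rate. rewrite (pos_part_id 0); [|lra]. rewrite Rplus_0_r Rminus_0_r pos_part_id; [|lra].
  rewrite settled_accel_0 Ropp_0. apply Rmin_left; lra.
Qed.

(** The sign condition is used once on each side of v_eq. When s >= v_eq the lower point is clamped
    to V = 0, where the condition still applies. *)
Lemma decay_rate_pos s : 0 < s -> 0 < decay_rate s.
Proof.
  intros hs. unfold decay_rate. rewrite (pos_part_id s); [|lra]. apply Rmin_pos.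
  - rewrite settled_accel_eq; [|lra]. pose proof (hsign (v_eq + s) ltac:(lra) ltac:(lra)).
    assert (0 < v_eq + s - f (A / (c + (v_eq + s)))) by nra. nra.
  - set (V := pos_part (v_eq - s)). assert (hV : 0 <= V) by apply pos_part_nonneg.
    assert (hV2 : V < v_eq) by (unfold V, pos_part; apply Rmax_lub_lt; lra).
    rewrite settled_accel_eq; auto. pose proof (hsign V hV ltac:(lra)).
    assert (V - f (A / (c + V)) < 0) by nra. nra.
Qed.

Lemma decay_rate_lipschitz : exists L, 0 < L /\
  forall a b, Rabs (decay_rate a - decay_rate b) <= L * Rabs (a - b).
Proof.
  destruct (outlet_accel_lipschitz c mu f (fun _ => A) A 0) as [L [hL hl]]; auto.
  { intros; lra. } { intros. rewrite Rminus_diag Rabs_R0. lra. }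
  exists L; split; auto.
  assert (hl' : forall a b, Rabs (settled_accel a - settled_accel b) <= L * Rabs (a - b)).
  { intros a b. specialize (hl a 0 b 0). rewrite Rminus_diag Rabs_R0 Rplus_0_r in hl. exact hl. }
  intros a b. unfold decay_rate. apply Rle_trans with (1 := Rabs_Rmin_le _ _ _ _).
  pose proof (retract_contract _ _ pos_part_retract) as hp.
  apply Rmax_lub.
  - replace (- settled_accel (v_eq + pos_part a) - - settled_accel (v_eq + pos_part b))
      with (- (settled_accel (v_eq + pos_part a) - settled_accel (v_eq + pos_part b))) by ring.
    rewrite Rabs_Ropp. apply Rle_trans with (1 := hl' _ _). apply Rmult_le_compat_l; [lra|].
    replace (v_eq + pos_part a - (v_eq + pos_part b)) with (pos_part a - pos_part b) by ring. auto.
  - apply Rle_trans with (1 := hl' _ _). apply Rmult_le_compat_l; [lra|].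
    apply Rle_trans with (1 := hp _ _).
    replace (v_eq - pos_part a - (v_eq - pos_part b)) with (- (pos_part a - pos_part b)) by ring.
    rewrite Rabs_Ropp; auto.
Qed.

Lemma settled_decay L beta (y : R -> R) s :
  (forall a b, Rabs (decay_rate a - decay_rate b) <= L * Rabs (a - b)) -> 0 < L ->
  decay_flow decay_rate beta ->
  (forall t, 0 <= t -> 0 < y t) -> (forall t, 0 <= t -> is_derive y t (settled_accel (y t))) ->
  Rabs (y 0 - v_eq) <= s -> forall t, 0 <= t -> Rabs (y t - v_eq) <= beta s t.
Proof.
  intros hlam hL hb hy dy h0 t ht.
  assert (hs : 0 <= s) by (pose proof (Rabs_pos (y 0 - v_eq)); lra).
  apply Rabs_le_between in h0.
  apply Rabs_le. split.
  - assert (v_eq - y t <= beta s t); [|lra].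
    apply (flow_comparison decay_rate L beta hlam hb (fun t => v_eq - y t) (fun t => 0 - settled_accel (y t))); auto; try lra.
    + intros r hr. apply: is_derive_minus; auto. apply: is_derive_const.
    + intros r hr h. pose proof (flow_nonneg decay_rate L beta hlam decay_rate_0 hb s r hs hr).
      unfold decay_rate. rewrite (pos_part_id (v_eq - y r)); [|lra].
      replace (v_eq - (v_eq - y r)) with (y r) by ring. rewrite (pos_part_id (y r)); [|left; auto].
      match goal with |- _ <= - Rmin ?a ?b => pose proof (Rmin_r a b) end. lra.
  - assert (y t - v_eq <= beta s t); [|lra].
    apply (flow_comparison decay_rate L beta hlam hb (fun t => y t - v_eq) (fun t => settled_accel (y t) - 0)); auto; try lra.
    + intros r hr. apply: is_derive_minus; auto. apply: is_derive_const.
    + intros r hr h. pose proof (flow_nonneg decay_rate L beta hlam decay_rate_0 hb s r hs hr).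
      unfold decay_rate. rewrite (pos_part_id (y r - v_eq)); [|lra].
      replace (v_eq + (y r - v_eq)) with (y r) by ring.
      match goal with |- _ <= - Rmin ?a ?b => pose proof (Rmin_l a b) end. lra.
Qed.

(** The first entry bounds the initial speed from below. The second bounds the target speed f(Z / (c
    + y)) at the outlet, because Z <= A e^d and [f] is non-increasing. *)
Definition speed_floor (d : R) : R := Rmin (v_eq * exp (- d)) (f (pos_part (A * exp d / c))).

(* After this time every characteristic on the road has entered through the inlet. *)
Definition flush_time (d : R) : R := 1 / c + 1 / speed_floor d.

(* For [d <= 1] the deviation of the speed is at most [C (e^d - 1)] by Gronwall;
   for [d >= 1] the remaining terms bound the speed itself, as [1 <= e^d - 1]. *)
Definition transient_bound (C M d : R) : R := (exp d - 1) * (C + v_eq + v_eq * exp d + M).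

Lemma speed_floor_pos d : 0 < speed_floor d.
Proof.
  apply Rmin_pos. apply Rmult_lt_0_compat; auto. apply exp_pos. apply hf, pos_part_nonneg.
Qed.

Lemma speed_floor_anti d d' : d <= d' -> speed_floor d' <= speed_floor d.
Proof.
  intros h. apply Rmin_glb.
  - apply Rle_trans with (1 := Rmin_l _ _). apply Rmult_le_compat_l; [lra|]. apply exp_le_compat; lra.
  - apply Rle_trans with (1 := Rmin_r _ _). apply hf. apply pos_part_nonneg.
    apply Rle_max_compat_l. apply Rmult_le_compat_r; [left; apply Rinv_0_lt_compat; auto|].
    apply Rmult_le_compat_l; [lra|]. apply exp_le_compat; lra.
Qed.

Lemma flush_time_mono d d' : d <= d' -> flush_time d <= flush_time d'.
Proof.
  intros h. unfold flush_time. apply Rplus_le_compat_l. apply Rmult_le_compat_l; [lra|].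
  apply Rinv_le_contravar. apply speed_floor_pos. apply speed_floor_anti; auto.
Qed.

Lemma flush_time_pos d : 0 < flush_time d.
Proof.
  pose proof (speed_floor_pos d). apply Rplus_lt_0_compat; apply Rdiv_lt_0_compat; lra.
Qed.

(** All that the estimates see of the initial data. Stating it through d alone keeps the resulting
    bounds uniform over data of the same deviation. *)
Record profile_data (d : R) (v0 Z : R -> R) : Prop := {
  pd_nonneg : 0 <= d;
  pd_speed : forall x, I01 x -> v_eq * exp (- d) <= v0 x <= v_eq * exp d;
  pd_label : forall r, A * exp (- d) <= Z r <= A * exp d;
  pd_inflow : forall r, r <= 0 -> Z r = A }.

Section Trajectory.
Variables (d : R) (v0 Z : R -> R) (rho v : R -> R -> R) (y w G : R -> R).
Hypotheses (hd : profile_data d v0 Z) (hcf : characteristic_form c mu f v0 Z rho v y w G).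

Let Z_bound r : 0 <= Z r <= A * exp d.
Proof.
  destruct (pd_label _ _ _ hd r). split; auto. pose proof (exp_pos (- d)).
  apply Rle_trans with (2 := H). apply Rmult_le_pos; lra.
Qed.

Let w_initial s : 0 <= s <= 1 / c -> v_eq * exp (- d) <= w s <= v_eq * exp d.
Proof.
  intros hs. replace s with (c * s / c) by (field; lra).
  assert (hI : I01 (c * s)).
  { split. nra. destruct hs as [_ hs]. apply Rmult_le_compat_l with (r := c) in hs; [|lra].
    replace (c * (1 / c)) with 1 in hs by (field; lra). lra. }
  rewrite (cf_w_initial hcf); auto. apply hd; auto.
Qed.

Let inv_c : 0 < 1 / c.
Proof. apply Rdiv_lt_0_compat; lra. Qed.

Let y_0 : y 0 = w (1 / c).
Proof. rewrite -(cf_w_outlet hcf); [|lra]. rewrite Rplus_0_l; auto. Qed.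

Let w_late s : 1 / c <= s -> w s = y (s - 1 / c).
Proof. intros hs. rewrite -(cf_w_outlet hcf); [|lra]. f_equal; ring. Qed.

Lemma speed_lower s : 0 <= s -> speed_floor d <= w s.
Proof.
  intros hs. destruct (Rle_dec s (1 / c)) as [e|e].
  - apply Rle_trans with (1 := Rmin_l _ _). apply w_initial; lra.
  - rewrite w_late; [|lra].
    apply (outlet_lower_bound c mu f Z (A * exp d) _ y (fun t => G (t + 1 / c) - t)); auto; try lra.
    + apply hcf.
    + rewrite y_0. apply Rle_trans with (1 := Rmin_l _ _). apply w_initial; lra.
    + apply Rle_trans with (1 := Rmin_r _ _). rewrite pos_part_id; [lra|].
      apply Rdiv_le_0_compat; auto. pose proof (exp_pos d). nra.
Qed.

Lemma speed_upper M t : (forall s, Rnneg s -> f s <= M) -> 0 <= t -> y t <= v_eq * exp d + M.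
Proof.
  intros hM ht. assert (hM0 : 0 <= M). { pose proof (hM rho_eq ltac:(unfold Rnneg; lra)). fold v_eq in H. lra. }
  assert (y t - (v_eq * exp d + M) <= 0); [|lra].
  apply (gronwall_nonpos (fun t => y t - (v_eq * exp d + M))
    (fun t => outlet_accel c mu f Z (y t) (G (t + 1 / c) - t) - 0) 0); auto.
  - intros s hs. apply: is_derive_minus. apply hcf; auto. apply: is_derive_const.
  - intros s hs hu. unfold outlet_accel. pose proof (exp_pos d).
    assert (f (Z (G (s + 1 / c) - s) / (c + pos_part (y s))) <= M).
    { apply hM. pose proof (Z_bound (G (s + 1 / c) - s)). pose proof (pos_part_nonneg (y s)).
      apply Rdiv_le_0_compat; lra. }
    assert (0 < v_eq * exp d) by (apply Rmult_lt_0_compat; auto). nra.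
  - rewrite y_0. pose proof (w_initial (1 / c) ltac:(lra)). lra.
Qed.

Let Gd s : 0 <= s -> c / (c + w s) <= 1.
Proof.
  intros hs. pose proof (cf_w_pos hcf s hs).
  apply (Rmult_le_reg_r (c + w s)); [lra|]. unfold Rdiv. rewrite Rmult_assoc Rinv_l; lra.
Qed.

Lemma flushed t x : I01 x -> flush_time d <= t -> G (t + x / c) - t <= 0.
Proof.
  intros hx ht. pose proof (flush_time_pos d) as hfl.
  assert (hxc : 0 <= x / c <= 1 / c).
  { destruct hx. split. apply Rdiv_le_0_compat; auto.
    apply Rmult_le_compat_r; auto. left; apply Rinv_0_lt_compat; auto. }
  assert (h1 : G (t + x / c) <= G (t + 1 / c)).
  { apply (derive_nonneg_le G (fun s => c / (c + w s))). lra.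
    - intros s hs. apply hcf. lra.
    - intros s hs. assert (0 < w s) by (apply hcf; lra). apply Rdiv_le_0_compat; lra. }
  assert (h2 : G (1 / c) - 1 / c <= G 0 - 0).
  { apply (derive_nonpos_le (fun s => G s - s) (fun s => c / (c + w s) - 1)). lra.
    - intros s hs. apply: is_derive_minus. apply hcf; lra. apply: is_derive_id.
    - intros s hs. pose proof (Gd s ltac:(lra)). lra. }
  rewrite (cf_G_0 hcf) in h2.
  set (m := speed_floor d) in *. assert (hm : 0 < m) by apply speed_floor_pos.
  (* With speed at least m, the outlet label falls at least at the rate m / (c + m). It starts at
     most at 1/c, so it is non-positive after (1/c) (c + m) / m = 1/c + 1/m, the flush time. *)
  assert (h3 : G (t + 1 / c) - t + t * (m / (c + m)) <= G (0 + 1 / c) - 0 + 0 * (m / (c + m))).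
  { apply (derive_nonpos_le (fun t => G (t + 1 / c) - t + t * (m / (c + m)))
     (fun s => 1 * (c / (c + w (s + 1 / c))) - 1 + m / (c + m))). lra.
    - intros s hs. apply: is_derive_plus. apply: is_derive_minus.
      apply: (is_derive_comp G (fun t => t + 1 / c)). apply hcf; lra. auto_derive; auto; ring.
      apply: is_derive_id. auto_derive; auto; ring.
    - intros s hs. assert (hw : m <= w (s + 1 / c)) by (apply speed_lower; lra).
      replace (m / (c + m)) with (1 - c * / (c + m)) by (field; lra).
      assert (/ (c + w (s + 1 / c)) <= / (c + m)) by (apply Rinv_le_contravar; lra).
      unfold Rdiv. nra. }
  rewrite Rplus_0_l in h3.
  assert (1 / c <= t * (m / (c + m))).
  { apply Rle_trans with (flush_time d * (m / (c + m))).
    unfold flush_time. fold m. right; field; lra.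
    apply Rmult_le_compat_r; auto. apply Rdiv_le_0_compat; lra. }
  lra.
Qed.

(** At speed v_eq and label value A the acceleration vanishes. Its Lipschitz bound in speed and
    label value gives |y'| <= L (|y - v_eq| + q), where q = A (e^d - 1) bounds |Z - A|. For d <= 1
    the cutoff at A e is inactive. *)
Lemma transient_small L t : 0 < L -> d <= 1 ->
  lipschitz2 (outlet_accel c mu f (fun z => Rmin (A * exp 1) (pos_part z))) L ->
  0 <= t <= flush_time 1 ->
  Rabs (y t - v_eq) <= exp (3 * L * flush_time 1) * (v_eq + A) * (exp d - 1).
Proof.
  intros hL hd1 hl ht.
  pose proof (pd_nonneg _ _ _ hd) as hd0.
  assert (hE : 0 <= exp d - 1) by (pose proof (exp_ineq1_le d); lra).
  set (q := A * (exp d - 1)). assert (hq : 0 <= q) by (apply Rmult_le_pos; lra).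
  set (acc := fun t => outlet_accel c mu f Z (y t) (G (t + 1 / c) - t)).
  assert (hacc : forall s, 0 <= s -> Rabs (acc s) <= L * (Rabs (y s - v_eq) + q)).
  { intros s hs. set (z := Z (G (s + 1 / c) - s)).
    assert (he1 : exp d <= exp 1) by (apply exp_le_compat; auto).
    destruct (Z_bound (G (s + 1 / c) - s)) as [hz1 hz2]. fold z in hz1, hz2.
    assert (hz3 : z <= A * exp 1) by nra.
    assert (hA1 : A <= A * exp 1) by (pose proof (exp_ineq1_le 1); nra).
    specialize (hl (y s) z v_eq A).
    assert (e1 : outlet_accel c mu f (fun z => Rmin (A * exp 1) (pos_part z)) (y s) z = acc s).
    { unfold outlet_accel. rewrite pos_part_id; auto. rewrite Rmin_right; auto. }
    assert (e2 : outlet_accel c mu f (fun z => Rmin (A * exp 1) (pos_part z)) v_eq A = 0).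
    { rewrite -settled_accel_0. unfold settled_accel, outlet_accel. rewrite (pos_part_id A); [|lra].
      rewrite Rmin_right; auto. }
    rewrite e1 e2 Rminus_0_r in hl. apply Rle_trans with (1 := hl). apply Rmult_le_compat_l; [lra|].
    apply Rplus_le_compat_l. apply Rabs_le.
    destruct (pd_label _ _ _ hd (G (s + 1 / c) - s)) as [hz4 hz5]. fold z in hz4, hz5.
    pose proof (one_minus_exp_opp_le d hd0). unfold q. split; nra. }
  (* Adding the constant q^2 makes the inequality homogeneous: with a = |y - v_eq|, 2 L (a + q) a <=
     6 L (a^2 + q^2), with room to spare. The square root turns 6 L into the 3 L of the
     statement. *)
  assert (H : (y t - v_eq) ^ 2 + q ^ 2 <= exp (6 * L * t) * ((y 0 - v_eq) ^ 2 + q ^ 2)).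
  { assert ((y t - v_eq) ^ 2 + q ^ 2 - exp (6 * L * t) * ((y 0 - v_eq) ^ 2 + q ^ 2) <= 0); [|lra].
    apply (gronwall_nonpos (fun t => (y t - v_eq) ^ 2 + q ^ 2 - exp (6 * L * t) * ((y 0 - v_eq) ^ 2 + q ^ 2))
      (fun t => 2 * acc t * (y t - v_eq) - 6 * L * exp (6 * L * t) * ((y 0 - v_eq) ^ 2 + q ^ 2)) (6 * L)); try lra.
    - intros s hs. apply: is_derive_minus; [|auto_derive; auto; ring].
      apply (is_derive_eq _ _ (INR 2 * (acc s - 0) * (y s - v_eq) ^ Nat.pred 2 + 0)); [|simpl; ring].
      apply: is_derive_plus; [|apply: is_derive_const].
      apply: is_derive_pow. apply: is_derive_minus. apply hcf; auto. apply: is_derive_const.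
    - intros s hs _. specialize (hacc s hs).
      assert (acc s * (y s - v_eq) <= L * (Rabs (y s - v_eq) + q) * Rabs (y s - v_eq)).
      { apply Rle_trans with (1 := Rle_abs _). rewrite Rabs_mult. apply Rmult_le_compat_r; auto using Rabs_pos. }
      rewrite -(pow2_abs (y s - v_eq)). set (a := Rabs (y s - v_eq)) in *.
      assert (0 <= L * (a - q) ^ 2) by (apply Rmult_le_pos; [lra|apply pow2_ge_0]).
      assert (0 <= L * a ^ 2) by (apply Rmult_le_pos; [lra|apply pow2_ge_0]).
      assert (0 <= L * q ^ 2) by (apply Rmult_le_pos; [lra|apply pow2_ge_0]). nra.
    - rewrite Rmult_0_r exp_0. lra. }
  assert (h0 : Rabs (y 0 - v_eq) <= v_eq * (exp d - 1)).
  { rewrite y_0. pose proof (w_initial (1 / c) ltac:(lra)). pose proof (one_minus_exp_opp_le d hd0).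
    apply Rabs_le; split; nra. }
  set (K := exp (3 * L * flush_time 1)).
  assert (hK : exp (6 * L * t) <= K ^ 2).
  { unfold K. simpl. rewrite Rmult_1_r -exp_plus. apply exp_le_compat. nra. }
  assert (hK0 : 0 < K) by apply exp_pos.
  apply Rsqr_incr_0_var.
  2: { apply Rmult_le_pos; auto. apply Rmult_le_pos; lra. }
  rewrite -Rsqr_abs !Rsqr_pow2.
  assert ((y 0 - v_eq) ^ 2 <= (v_eq * (exp d - 1)) ^ 2).
  { rewrite -pow2_abs. apply pow_incr. split; auto using Rabs_pos. }
  set (E := exp d - 1) in *.
  apply Rle_trans with (exp (6 * L * t) * ((y 0 - v_eq) ^ 2 + q ^ 2)).
  { pose proof (pow2_ge_0 q). lra. }
  apply Rle_trans with (K ^ 2 * ((v_eq * E) ^ 2 + q ^ 2)).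
  { pose proof (pow2_ge_0 q). pose proof (pow2_ge_0 (y 0 - v_eq)).
    apply Rmult_le_compat; try lra. left; apply exp_pos. }
  replace ((K * (v_eq + A) * E) ^ 2) with (K ^ 2 * ((v_eq + A) ^ 2 * E ^ 2)) by ring.
  apply Rmult_le_compat_l. apply pow2_ge_0. unfold q. fold E.
  assert (0 <= 2 * v_eq * A * E ^ 2) by (apply Rmult_le_pos; [nra|apply pow2_ge_0]). nra.
Qed.
End Trajectory.
End Estimates.

(** * The KL bound for the deviation *)

Section Deviation.
Variables (c mu rho_eq : R) (f : R -> R) (L Ld M : R) (beta : R -> R -> R).
Let v_eq := f rho_eq.
Let A := rho_eq * (c + v_eq).
Let floor := speed_floor c rho_eq f.
Let flush := flush_time c rho_eq f.
Let kappa := transient_bound rho_eq f (exp (3 * L * flush 1) * (v_eq + A)) M.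
Hypotheses (hc : 0 < c) (hmu : 0 < mu) (hrho : 0 < rho_eq) (hf : speed_function f)
  (hsign : forall V, 0 <= V -> V <> v_eq -> (V - f (A / (c + V))) * (V - v_eq) > 0)
  (hM : forall s, Rnneg s -> f s <= M)
  (hL : 0 < L) (hacc : lipschitz2 (outlet_accel c mu f (fun z => Rmin (A * exp 1) (pos_part z))) L)
  (hLd : 0 < Ld)
  (hrate : forall a b, Rabs (decay_rate c mu rho_eq f a - decay_rate c mu rho_eq f b) <= Ld * Rabs (a - b))
  (hflow : decay_flow (decay_rate c mu rho_eq f) beta).

Let v_eq_pos : 0 < v_eq.
Proof. apply hf. unfold Rnneg; lra. Qed.

Let A_pos : 0 < A.
Proof. apply Rmult_lt_0_compat; lra. Qed.

Let M_pos : 0 < M.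
Proof. apply Rlt_le_trans with v_eq; auto. apply hM. unfold Rnneg; lra. Qed.

Let C_pos : 0 < exp (3 * L * flush 1) * (v_eq + A).
Proof. apply Rmult_lt_0_compat; [apply exp_pos|lra]. Qed.

Lemma transient_bound_mono d d' : 0 <= d -> d <= d' -> kappa d <= kappa d'.
Proof.
  intros h0 h. unfold kappa, transient_bound. fold v_eq. pose proof (exp_le_compat d d' h).
  pose proof (exp_ineq1_le d).
  assert (v_eq * exp d <= v_eq * exp d') by (apply Rmult_le_compat_l; lra).
  assert (0 <= v_eq * exp d) by (apply Rmult_le_pos; lra).
  apply Rmult_le_compat; lra.
Qed.

Lemma transient_bound_nonneg d : 0 <= d -> 0 <= kappa d.
Proof.
  intros h. unfold kappa, transient_bound. fold v_eq. pose proof (exp_ineq1_le d).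
  assert (0 <= v_eq * exp d) by (apply Rmult_le_pos; lra).
  apply Rmult_le_pos; lra.
Qed.

Let rate_0 : decay_rate c mu rho_eq f 0 = 0.
Proof. apply decay_rate_0; auto. Qed.

Let rate_pos s : 0 < s -> 0 < decay_rate c mu rho_eq f s.
Proof. apply decay_rate_pos; auto. Qed.

Section Trajectory.
Variables (d : R) (v0 Z : R -> R) (rho v : R -> R -> R) (y w G : R -> R).
Hypotheses (hd : profile_data c rho_eq f d v0 Z) (hcf : characteristic_form c mu f v0 Z rho v y w G).

(** Until 1/c + flush d the flow is evaluated at time 0, so the claim is the transient bound
    [kappa d]. From then on [y], shifted by [flush d], follows the autonomous equation and starts
    within [kappa d] of v_eq. *)
Lemma speed_deviation s : 0 <= s ->
  Rabs (w s - v_eq) <= beta (kappa d) (pos_part (s - 1 / c - flush d)).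
Proof.
  intros hs. pose proof (pd_nonneg _ _ _ _ _ _ hd) as hd0.
  assert (hfl : 0 < flush d) by (apply flush_time_pos; auto).
  assert (hic : 0 < 1 / c) by (apply Rdiv_lt_0_compat; lra).
  assert (hE : 0 <= exp d - 1) by (pose proof (exp_ineq1_le d); lra).
  assert (hvE : 0 <= v_eq * exp d) by (apply Rmult_le_pos; lra).
  assert (outlet : forall t, 0 <= t -> t <= flush d -> Rabs (y t - v_eq) <= kappa d).
  { intros t ht htf. destruct (Rle_dec d 1) as [e|e].
    - assert (flush d <= flush 1) by (apply flush_time_mono; auto).
      apply Rle_trans with (exp (3 * L * flush 1) * (v_eq + A) * (exp d - 1)).
      + apply (transient_small c mu rho_eq f hc hrho hf d v0 Z rho v y w G); auto; fold flush; lra.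
      + unfold kappa, transient_bound. fold v_eq. rewrite Rmult_comm. apply Rmult_le_compat_l; lra.
    - pose proof (speed_upper c mu rho_eq f hc hmu hrho hf d v0 Z rho v y w G hd hcf M t hM ht) as hu.
      assert (0 < y t). { rewrite -(cf_w_outlet hcf); auto. apply hcf; lra. }
      apply Rle_trans with (v_eq + v_eq * exp d + M).
      + fold v_eq in hu. apply Rabs_le. lra.
      + assert (1 <= exp d - 1).
        { pose proof (exp_ineq1_le d). lra. }
        unfold kappa, transient_bound. fold v_eq.
        rewrite -{1}(Rmult_1_l (v_eq + v_eq * exp d + M)). apply Rmult_le_compat; lra. }
  assert (late : forall t, 1 / c <= t -> w t = y (t - 1 / c)).
  { intros t ht. rewrite -(cf_w_outlet hcf); [|lra]. f_equal; ring. }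
  destruct (Rle_dec s (1 / c + flush d)) as [h|h].
  - unfold pos_part. rewrite Rmax_left; [|lra]. rewrite (flow_0 _ _ hflow).
    destruct (Rle_dec s (1 / c)) as [h'|h'].
    + replace s with (c * s / c) by (field; lra).
      assert (hI : I01 (c * s)).
      { split. nra. apply Rmult_le_compat_l with (r := c) in h'; [|lra].
        replace (c * (1 / c)) with 1 in h' by (field; lra). lra. }
      rewrite (cf_w_initial hcf); auto.
      destruct (pd_speed _ _ _ _ _ _ hd _ hI) as [p1 p2]. fold v_eq in p1, p2.
      pose proof (one_minus_exp_opp_le d hd0).
      apply Rle_trans with (v_eq * (exp d - 1)). apply Rabs_le; split; nra.
      unfold kappa, transient_bound. fold v_eq. rewrite Rmult_comm. apply Rmult_le_compat_l; lra.
    + rewrite late; [|lra]. apply outlet; lra.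
  - rewrite pos_part_id; [|lra]. rewrite late; [|lra].
    set (tau := s - 1 / c - flush d). assert (etau : s - 1 / c = tau + flush d) by (unfold tau; ring).
    assert (htau : 0 <= tau) by (unfold tau; lra). rewrite etau.
    apply (settled_decay c mu rho_eq f hc hrho hf Ld beta (fun t => y (t + flush d))); auto; try lra.
    + intros t ht. rewrite -(cf_w_outlet hcf); [|lra]. apply hcf. lra.
    + intros t ht.
      pose proof (cf_y_deriv hcf (t + flush d) ltac:(lra)) as dy.
      apply (is_derive_eq _ _ (1 * outlet_accel c mu f Z (y (t + flush d)) (G (t + flush d + 1 / c) - (t + flush d)))).
      * apply: (is_derive_comp y (fun t => t + flush d)); auto. auto_derive; auto; ring.
      * rewrite Rmult_1_l. unfold settled_accel, outlet_accel. rewrite (pd_inflow _ _ _ _ _ _ hd); auto.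
        apply (flushed c mu rho_eq f hc hmu hrho hf d v0 Z rho v y w G); auto. apply I01_1. fold flush; lra.
    + rewrite Rplus_0_l. apply outlet; lra.
Qed.

Let settled_time t := pos_part (t - 1 / c - flush d).

(** As rho = Z / (c + w), the logarithm of rho / rho_eq splits into a label part and a speed part.
    The label part is at most d before the flush time and 0 after it; d e^(flush d - t) is a
    continuous majorant of this step function that tends to 0. *)
Lemma log_deviation t x : Omega (t, x) ->
  Rabs (ln (v t x / v_eq)) <= beta (kappa d) (settled_time t) / floor d /\
  Rabs (ln (rho t x / rho_eq)) <= d * exp (flush d - t) + beta (kappa d) (settled_time t) / floor d.
Proof.
  intros hO. destruct (Omega_pair _ _ hO) as [ht hx].
  pose proof (pd_nonneg _ _ _ _ _ _ hd) as hd0.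
  assert (hxc : 0 <= x / c) by (apply Rdiv_le_0_compat; lra).
  assert (hfloor : 0 < floor d) by (apply speed_floor_pos; auto).
  assert (hw : floor d <= w (t + x / c)).
  { apply (speed_lower c mu rho_eq f hc hmu hrho hf d v0 Z rho v y w G); auto; lra. }
  assert (hv : floor d <= v_eq).
  { apply Rle_trans with (1 := Rmin_l _ _). fold v_eq.
    assert (exp (- d) <= 1). { rewrite -exp_0. apply exp_le_compat; lra. } nra. }
  assert (hdev : Rabs (w (t + x / c) - v_eq) <= beta (kappa d) (settled_time t)).
  { apply Rle_trans with (1 := speed_deviation (t + x / c) ltac:(lra)).
    apply (flow_anti_r _ Ld beta hrate rate_0 rate_pos hflow).
    apply transient_bound_nonneg; auto. apply pos_part_nonneg.
    apply Rle_max_compat_l. lra. }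
  assert (hdiv : Rabs (w (t + x / c) - v_eq) / floor d <= beta (kappa d) (settled_time t) / floor d).
  { apply Rmult_le_compat_r; auto. left; apply Rinv_0_lt_compat; auto. }
  rewrite (cf_v hcf); auto.
  split.
  - apply Rle_trans with (2 := hdiv). apply Rabs_ln_div_lipschitz; auto.
  - pose proof (cf_rho hcf t x hO) as hr.
    rewrite (cf_v hcf) in hr; auto.
    set (W := w (t + x / c)) in *. set (r := G (t + x / c) - t) in *.
    destruct (pd_label _ _ _ _ _ _ hd r) as [hz1 hz2]. fold v_eq in hz1, hz2. fold A in hz1, hz2.
    assert (hz : 0 < Z r). { pose proof (exp_pos (- d)). nra. }
    assert (e : rho t x / rho_eq = (Z r / A) * ((c + v_eq) / (c + W))).
    { rewrite -hr. unfold A. field. repeat split; lra. }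
    rewrite e ln_mult; [|apply Rdiv_lt_0_compat; auto|apply Rdiv_lt_0_compat; lra].
    apply Rle_trans with (1 := Rabs_triang _ _). apply Rplus_le_compat.
    + destruct (Rle_dec (flush d) t) as [h|h].
      * assert (hr0 : r <= 0).
        { apply (flushed c mu rho_eq f hc hmu hrho hf d v0 Z rho v y w G); auto. }
        rewrite (pd_inflow _ _ _ _ _ _ hd r hr0). fold v_eq. fold A.
        replace (A / A) with 1 by (field; lra). rewrite ln_1 Rabs_R0.
        apply Rmult_le_pos; auto. left; apply exp_pos.
      * apply Rle_trans with d. apply Rabs_ln_div_le; auto.
        assert (1 <= exp (flush d - t)). { rewrite -exp_0. apply exp_le_compat; lra. } nra.
    + apply Rle_trans with (2 := hdiv). rewrite Rabs_minus_sym.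
      replace (v_eq - W) with ((c + v_eq) - (c + W)) by ring.
      apply Rabs_ln_div_lipschitz; lra.
Qed.
End Trajectory.

(** The factor 2 collects the speed term of v and that of rho. The first summand also makes the
    bound strictly increasing in s, for which the flow is only shown to be non-decreasing. The
    positive parts make it continuous on the whole plane. *)
Definition deviation_bound (s t : R) : R :=
  s * exp (flush s - t) + 2 * / floor s * beta (pos_part (kappa s)) (pos_part (t - 1 / c - flush s)).

Lemma floor_continuous s : continuous floor s.
Proof.
  apply locally_lipschitz_continuous.
  assert (hexp : locally_lipschitz exp).
  { apply (is_derive_locally_lipschitz exp exp). intros; apply is_derive_exp.
    intros; apply: ex_derive_continuous; eexists; apply is_derive_exp. }
  assert (h1 : locally_lipschitz (fun s => v_eq * exp (- s))).
  { apply (locally_lipschitz_scal v_eq). apply (locally_lipschitz_comp (fun s => - s) exp); auto.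
    apply (locally_lipschitz_ext (fun s => -1 * s + 0)). intros; ring. apply locally_lipschitz_affine. }
  assert (h2 : locally_lipschitz (fun s => f (pos_part (A * exp s / c)))).
  { apply (locally_lipschitz_comp (fun s => A * exp s / c) (fun s => f (pos_part s))).
    - apply (locally_lipschitz_ext (fun s => / c * (A * exp s))). intros; unfold Rdiv; ring.
      apply locally_lipschitz_scal, locally_lipschitz_scal; auto.
    - apply (C1_on_locally_lipschitz Rnneg); [apply pos_part_retract|apply hf]. }
  intros K. destruct (h1 K) as [L1 [p1 q1]]. destruct (h2 K) as [L2 [p2 q2]].
  exists (L1 + L2). split. lra. intros a b ha hb.
  apply Rle_trans with (1 := Rabs_Rmin_le _ _ _ _). specialize (q1 a b ha hb). specialize (q2 a b ha hb).
  pose proof (Rabs_pos (a - b)). fold v_eq. fold A. apply Rmax_lub; nra.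
Qed.

Let floor_pos s : 0 < floor s.
Proof. apply speed_floor_pos; auto. Qed.

Lemma inv_floor_continuous s : continuous (fun s => / floor s) s.
Proof. apply continuous_Rinv_comp. apply floor_continuous. apply Rgt_not_eq, floor_pos. Qed.

Lemma flush_continuous s : continuous flush s.
Proof.
  apply: continuous_plus. apply continuous_const. apply: continuous_mult. apply continuous_const.
  apply inv_floor_continuous.
Qed.

Lemma deviation_bound_continuous {U : UniformSpace} (g k : U -> R) p : continuous g p -> continuous k p ->
  continuous (fun q => deviation_bound (g q) (k q)) p.
Proof.
  intros hg hk.
  assert (hfl : continuous (fun q => flush (g q)) p) by (apply (continuous_comp g flush); auto; apply flush_continuous).
  assert (hka : continuous (fun q => kappa (g q)) p).
  { apply (continuous_comp g kappa); auto. apply: ex_derive_continuous. unfold kappa, transient_bound.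
    auto_derive; auto. }
  apply: continuous_plus; apply: continuous_mult; auto.
  - apply (continuous_comp (fun q => flush (g q) - k q) exp). apply: continuous_minus; auto.
    apply: ex_derive_continuous; eexists; apply is_derive_exp.
  - apply: continuous_mult. apply continuous_const. apply (continuous_comp g (fun s => / floor s)); auto.
    apply inv_floor_continuous.
  - apply (flow_continuous _ Ld beta hLd hrate rate_0 rate_pos hflow (fun q => kappa (g q)) (fun q => k q - 1 / c - flush (g q))); auto.
    apply: continuous_minus; auto. apply: continuous_minus; auto. apply continuous_const.
Qed.

Let gain_nonneg s : 0 <= 2 * / floor s.
Proof. pose proof (Rinv_0_lt_compat _ (floor_pos s)). lra. Qed.

Let beta_nonneg s t : 0 <= s -> 0 <= t -> 0 <= beta s t.
Proof. apply (flow_nonneg _ Ld beta hrate rate_0 hflow). Qed.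

Lemma deviation_bound_lt s1 s2 t : 0 <= s1 -> s1 < s2 -> deviation_bound s1 t < deviation_bound s2 t.
Proof.
  intros h0 h. unfold deviation_bound.
  assert (hfl : flush s1 <= flush s2) by (apply flush_time_mono; auto; lra).
  assert (hka : kappa s1 <= kappa s2) by (apply transient_bound_mono; lra).
  apply Rplus_lt_le_compat.
  - assert (exp (flush s1 - t) <= exp (flush s2 - t)) by (apply exp_le_compat; lra).
    pose proof (exp_pos (flush s2 - t)). nra.
  - apply Rmult_le_compat; auto. apply beta_nonneg; apply pos_part_nonneg.
    + apply Rmult_le_compat_l; [lra|]. apply Rinv_le_contravar; auto. apply speed_floor_anti; auto; lra.
    + apply Rle_trans with (beta (pos_part (kappa s2)) (pos_part (t - 1 / c - flush s1))).
      * apply (flow_mono_l _ Ld beta hrate hflow). apply Rle_max_compat_l; auto. apply pos_part_nonneg.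
      * apply (flow_anti_r _ Ld beta hrate rate_0 rate_pos hflow); try apply pos_part_nonneg.
        apply Rle_max_compat_l. lra.
Qed.

Lemma deviation_bound_0 t : deviation_bound 0 t = 0.
Proof.
  unfold deviation_bound. rewrite Rmult_0_l Rplus_0_l.
  assert (e : kappa 0 = 0) by (unfold kappa, transient_bound; rewrite exp_0; ring).
  rewrite e pos_part_id; [|lra].
  assert (hp := pos_part_nonneg (t - 1 / c - flush 0)).
  pose proof (flow_le _ Ld beta hrate rate_0 rate_pos hflow 0 _ ltac:(lra) hp).
  pose proof (beta_nonneg 0 _ ltac:(lra) hp).
  replace (beta 0 (pos_part (t - 1 / c - flush 0))) with 0 by lra. ring.
Qed.

Lemma deviation_bound_nonneg s t : 0 <= s -> 0 <= deviation_bound s t.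
Proof.
  intros [h|h].
  - rewrite -(deviation_bound_0 t). left. apply deviation_bound_lt; auto; lra.
  - rewrite -h deviation_bound_0. lra.
Qed.

Lemma deviation_bound_KL : class_KL deviation_bound.
Proof.
  split; [|split; [|split]].
  - intros s t hs _. apply deviation_bound_nonneg; auto.
  - apply continuous_on_of_continuous. intros [s t] _.
    apply (deviation_bound_continuous fst snd). apply continuous_fst. apply continuous_snd.
  - intros t _. split; [|split; [|split]].
    + intros s hs. apply deviation_bound_nonneg; auto.
    + apply continuous_on_of_continuous. intros s _.
      apply (deviation_bound_continuous (fun s => s) (fun _ => t)). apply continuous_id. apply continuous_const.
    + intros s1 s2 h1 h2. apply deviation_bound_lt; auto.
    + apply deviation_bound_0.
  - intros s hs. split.
    + intros t1 t2 h1 h2. unfold deviation_bound. apply Rplus_le_compat.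
      * apply Rmult_le_compat_l; auto. apply exp_le_compat; lra.
      * apply Rmult_le_compat_l; auto.
        apply (flow_anti_r _ Ld beta hrate rate_0 rate_pos hflow); try apply pos_part_nonneg.
        apply Rle_max_compat_l. lra.
    + apply is_lim_spec. intros e.
      assert (he : 0 < e / 2) by (pose proof (cond_pos e); lra).
      pose proof (floor_pos s) as hfl.
      destruct (flow_vanishes _ Ld beta hrate rate_0 rate_pos hflow (pos_part (kappa s)) (e / 2 * (floor s / 2)))
        as [T [hT hv]]. apply pos_part_nonneg. apply Rmult_lt_0_compat; lra.
      (* Past the first entry the flow has run for at least T. Past the second, e^x >= 1 + x makes
         the exponential term at most e/2. *)
      exists (Rmax (T + 1 / c + flush s) (flush s + s / (e / 2))). intros t ht.
      pose proof (Rmax_l (T + 1 / c + flush s) (flush s + s / (e / 2))).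
      pose proof (Rmax_r (T + 1 / c + flush s) (flush s + s / (e / 2))).
      rewrite Rminus_0_r Rabs_pos_eq; [|apply deviation_bound_nonneg; auto].
      unfold deviation_bound.
      assert (h1 : s * exp (flush s - t) <= e / 2).
      { assert (hq : s / (e / 2) <= exp (t - flush s)).
        { pose proof (exp_ineq1_le (t - flush s)). lra. }
        apply Rmult_le_compat_r with (r := e / 2) in hq; [|lra].
        replace (s / (e / 2) * (e / 2)) with s in hq by (field; lra).
        replace (flush s - t) with (- (t - flush s)) by ring. rewrite exp_Ropp.
        pose proof (exp_pos (t - flush s)).
        apply Rmult_le_reg_r with (exp (t - flush s)); auto.
        rewrite Rmult_assoc Rinv_l; [|lra]. lra. }
      assert (h2 : 2 * / floor s * beta (pos_part (kappa s)) (pos_part (t - 1 / c - flush s)) < e / 2).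
      { assert (hb : beta (pos_part (kappa s)) (pos_part (t - 1 / c - flush s)) < e / 2 * (floor s / 2)).
        { apply hv. apply Rle_trans with (t - 1 / c - flush s). lra. apply Rmax_r. }
        pose proof (Rinv_0_lt_compat _ hfl).
        apply Rmult_lt_compat_l with (r := 2 * / floor s) in hb; [|lra].
        apply Rlt_le_trans with (1 := hb). right; field; lra. }
      lra.
Qed.
End Deviation.

(** * The closed loop *)

(** The outlet pairs (y, G(t + 1/c) - t) of both solutions satisfy the same Lipschitz system from
    the same values [v0 1] and [G0 1]. Equality then passes from y to w, G, v and finally rho, after
    division by c + v > 0. *)
Lemma characteristic_form_unique c mu f v0 Z L rho1 v1 y1 w1 G1 rho2 v2 y2 w2 G2 :
  0 < c -> (forall x, I01 x -> 0 < v0 x) -> C1_on I01 v0 ->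
  0 < L -> lipschitz2 (outlet_accel c mu f Z) L -> lipschitz2 (outlet_drift c) L ->
  characteristic_form c mu f v0 Z rho1 v1 y1 w1 G1 ->
  characteristic_form c mu f v0 Z rho2 v2 y2 w2 G2 ->
  forall t x, Omega (t, x) -> rho1 t x = rho2 t x /\ v1 t x = v2 t x.
Proof.
  intros hc hv0 hv0C hL hacc hdrift h1 h2 t x hO.
  destruct (travel_time_inverse c v0 hc hv0C hv0) as [G0 [H [G00 [_ [dG0 _]]]]].
  assert (hic : 0 < 1 / c) by (apply Rdiv_lt_0_compat; lra).
  assert (outlet : forall rho v y w G, characteristic_form c mu f v0 Z rho v y w G ->
    y 0 = v0 1 /\ G (1 / c) = G0 1 /\
    (forall t, 0 <= t -> is_derive (fun t => G (t + 1 / c) - t) t (outlet_drift c (y t) (G (t + 1 / c) - t)))).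
  { intros rho v y w G hcf. split; [|split].
    - rewrite -(cf_w_outlet hcf); [|lra]. rewrite Rplus_0_l.
      apply hcf. apply I01_1.
    - apply (label_initial c v0 G0); auto using I01_1. apply hcf.
      intros z hz. rewrite -(cf_w_initial hcf); auto. apply hcf.
      destruct hz. apply Rdiv_le_0_compat; auto.
    - intros s hs. pose proof (cf_w_pos hcf (s + 1 / c) ltac:(lra)) as hw.
      apply (is_derive_eq _ _ (1 * (c / (c + w (s + 1 / c))) - 1)).
      + apply: is_derive_minus; [|apply: is_derive_id].
        apply: (is_derive_comp G (fun t => t + 1 / c)). apply hcf; lra. auto_derive; auto; ring.
      + rewrite (cf_w_outlet hcf) in hw |- *; auto.
        unfold outlet_drift. rewrite pos_part_id; [|lra]. field. lra. }
  destruct (outlet _ _ _ _ _ h1) as [a1 [b1 d1]]. destruct (outlet _ _ _ _ _ h2) as [a2 [b2 d2]].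
  assert (ey : forall s, 0 <= s -> y1 s = y2 s).
  { intros s hs.
    apply (lipschitz2_ode_unique (outlet_accel c mu f Z) (outlet_drift c) L
      y1 (fun t => G1 (t + 1 / c) - t) y2 (fun t => G2 (t + 1 / c) - t)); auto.
    - apply h1.
    - apply h2.
    - rewrite a1 a2; auto.
    - rewrite !Rplus_0_l b1 b2; auto. }
  assert (ew : forall s, 0 <= s -> w1 s = w2 s).
  { intros s hs. destruct (Rle_dec s (1 / c)) as [e|e].
    - replace s with (c * s / c) by (field; lra).
      assert (hI : I01 (c * s)).
      { split. nra. apply Rmult_le_compat_l with (r := c) in e; [|lra].
        replace (c * (1 / c)) with 1 in e by (field; lra). lra. }
      rewrite (cf_w_initial h1); auto. rewrite (cf_w_initial h2); auto.
    - replace s with ((s - 1 / c) + 1 / c) by ring.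
      rewrite (cf_w_outlet h1); [|lra]. rewrite (cf_w_outlet h2); [|lra].
      apply ey; lra. }
  assert (eG : forall s, 0 <= s -> G1 s = G2 s).
  { intros s hs. apply (derive_eq_eq G1 G2 (fun s => c / (c + w1 s)) 0 s); auto.
    - intros; apply h1; lra.
    - intros r hr. rewrite ew; [|lra]. apply h2; lra.
    - rewrite (cf_G_0 h1) (cf_G_0 h2); auto. }
  destruct (Omega_pair _ _ hO) as [ht hx].
  assert (hs : 0 <= t + x / c) by (assert (0 <= x / c) by (apply Rdiv_le_0_compat; lra); lra).
  assert (ev : v1 t x = v2 t x).
  { rewrite (cf_v h1); auto. rewrite (cf_v h2); auto. }
  split; auto.
  pose proof (cf_rho h1 t x hO) as r1. pose proof (cf_rho h2 t x hO) as r2.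
  rewrite ev eG in r1; auto. rewrite -r2 in r1.
  apply Rmult_eq_reg_r with (1 := r1).
  pose proof (cf_w_pos h2 _ hs). rewrite (cf_v h2); auto. lra.
Qed.

(** Positivity makes the logarithm continuous, so the maximum is attained and [max01] is not a
    default value. *)
Lemma max01_ln_correct u k : C1_on I01 u -> (forall x, I01 x -> 0 < u x) -> 0 < k ->
  is_max01 (fun x => Rabs (ln (u x / k))) (max01 (fun x => Rabs (ln (u x / k)))).
Proof.
  intros hu hp hk. apply max01_correct. intros x.
  apply (continuous_comp (fun y => ln (u (clamp01 y) / k)) Rabs); [|apply: continuous_Rabs].
  apply (continuous_comp (fun y => u (clamp01 y) / k) ln).
  - apply: continuous_mult. apply C1_on_clamp_continuous; auto. apply continuous_const.
  - apply: ex_derive_continuous. exists (/ (u (clamp01 x) / k)). apply is_derive_ln.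
    apply Rdiv_lt_0_compat; auto. apply hp, clamp01_in.
Qed.

Lemma state_space_pos c mu h f rho v : state_space c mu h f rho v ->
  forall x, I01 x -> 0 < rho x /\ 0 < v x.
Proof.
  intros [_ [_ [hp _]]] x hx. specialize (hp x hx).
  pose proof (Rmin_l (rho x) (v x)). pose proof (Rmin_r (rho x) (v x)). lra.
Qed.

(** V > 0 puts the argument strictly below B/c, inside an open interval on which [h] is the
    identity; this gives the slope as well as the value. *)
Lemma inlet_unsaturated c rho_max eps h B : 0 < c -> inlet_function rho_max eps h -> 0 < B ->
  B / c <= rho_max - eps ->
  forall V, 0 < V -> h (B / (c + V)) = B / (c + V) /\ Derive_in Rnneg h (B / (c + V)) = 1.
Proof.
  intros hc [_ [_ [hid _]]] hB hle V hV.
  assert (h1 : 0 < B / (c + V)) by (apply Rdiv_lt_0_compat; lra).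
  assert (h2 : B / (c + V) < B / c).
  { apply Rmult_lt_compat_l; auto. apply Rinv_lt_contravar; nra. }
  split. apply hid; lra.
  apply (Derive_in_eq _ _ _ _ _ pos_part_retract). left; auto.
  apply is_derive_D_in. apply is_derive_ext_loc with (fun s : R => s); [|apply: is_derive_id].
  apply (filter_imp (fun s => 0 < s /\ s < B / c)).
  - intros s hs. symmetry. apply hid. lra.
  - apply filter_and; [apply open_gt|apply open_lt]; auto.
Qed.

(** Adding c to numerator and denominator moves v0 / v_eq closer to 1, so c + v0 deviates from c +
    v_eq by a factor of at most e^(d2) either way. Multiplication by rho0 adds the exponents to d =
    d1 + d2. *)
Lemma deviation_profile_data c rho_eq f rho0 v0 H :
  0 < c -> 0 < rho_eq -> 0 < f rho_eq -> C1_on I01 rho0 -> C1_on I01 v0 ->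
  (forall x, I01 x -> 0 < rho0 x) -> (forall x, I01 x -> 0 < v0 x) ->
  rho0 0 * (c + v0 0) = rho_eq * (c + f rho_eq) ->
  H 0 = 0 -> (forall r, is_derive H r (c + v0 (clamp01 (H r)))) ->
  profile_data c rho_eq f (deviation rho_eq (f rho_eq) rho0 v0) v0
    (fun r => rho0 (clamp01 (H r)) * (c + v0 (clamp01 (H r)))).
Proof.
  intros hc hre hfe hr0C hv0C hr0 hv0 hz0 H0 dH.
  destruct (max01_ln_correct rho0 rho_eq hr0C hr0 hre) as [[x1 [hx1 e1]] hm1].
  destruct (max01_ln_correct v0 (f rho_eq) hv0C hv0 hfe) as [[x2 [hx2 e2]] hm2].
  unfold deviation.
  set (d1 := max01 _) in *. set (d2 := max01 (fun x => Rabs (ln (v0 x / f rho_eq)))) in *.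
  assert (hd1 : 0 <= d1) by (rewrite -e1; apply Rabs_pos).
  assert (hd2 : 0 <= d2) by (rewrite -e2; apply Rabs_pos).
  clear x1 hx1 e1 x2 hx2 e2.
  assert (b1 : forall x, I01 x -> rho_eq * exp (- d1) <= rho0 x <= rho_eq * exp d1).
  { intros x hx. apply Rabs_ln_div_le; auto. }
  assert (b2 : forall x, I01 x -> f rho_eq * exp (- d2) <= v0 x <= f rho_eq * exp d2).
  { intros x hx. apply Rabs_ln_div_le; auto. }
  assert (i1 := exp_ineq1_le d1). assert (i2 := exp_ineq1_le d2).
  assert (j1 : exp (- d1) <= 1) by (rewrite -exp_0; apply exp_le_compat; lra).
  assert (j2 : exp (- d2) <= 1) by (rewrite -exp_0; apply exp_le_compat; lra).
  assert (k1 := exp_pos (- d1)). assert (k2 := exp_pos (- d2)).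
  split.
  - lra.
  - intros x hx. specialize (b2 x hx).
    assert (exp d2 <= exp (d1 + d2)) by (apply exp_le_compat; lra).
    assert (exp (- (d1 + d2)) <= exp (- d2)) by (apply exp_le_compat; lra). nra.
  - intros r. set (x := clamp01 (H r)). specialize (b1 x (clamp01_in _)). specialize (b2 x (clamp01_in _)).
    rewrite Ropp_plus_distr !exp_plus.
    assert (l1 : (c + f rho_eq) * exp (- d2) <= c + v0 x) by nra.
    assert (l2 : c + v0 x <= (c + f rho_eq) * exp d2) by nra.
    split.
    + replace (rho_eq * (c + f rho_eq) * (exp (- d1) * exp (- d2)))
        with (rho_eq * exp (- d1) * ((c + f rho_eq) * exp (- d2))) by ring.
      apply Rmult_le_compat; try lra; apply Rmult_le_pos; lra.
    + replace (rho_eq * (c + f rho_eq) * (exp d1 * exp d2))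
        with (rho_eq * exp d1 * ((c + f rho_eq) * exp d2)) by ring.
      assert (v0x := hv0 x (clamp01_in _)). assert (r0x := hr0 x (clamp01_in _)).
      apply Rmult_le_compat; lra.
  - intros r hr. apply (label_neg c rho_eq f rho0 v0 H); auto.
Qed.

Theorem theorem3p1 (c mu rho_max eps : R) (h f : R -> R) (rho_eq : R)
  (hc : 0 < c) (hmu : 0 < mu) (hrho_max : 0 < rho_max)
  (heps : 0 < eps < rho_max)
  (hh : inlet_function rho_max eps h)
  (hf : speed_function f)
  (hrho_eq : 0 < rho_eq)
  (hsmall : rho_eq <= c / (c + f rho_eq) * (rho_max - eps))
  (hsign : forall v : R, 0 <= v -> v <> f rho_eq ->
     (v - f (rho_eq * ((c + f rho_eq) / (c + v)))) * (v - f rho_eq) > 0) :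
  exists Q : R -> R -> R, class_KL Q /\
    forall rho0 v0 : R -> R,
      state_space c mu h f rho0 v0 ->
      rho0 0 = rho_eq * ((c + f rho_eq) / (c + v0 0)) ->
      Derive_in I01 rho0 0 = - (rho0 0 / (c + v0 0)) * Derive_in I01 v0 0 ->
      exists rho v : R -> R -> R,
        closed_loop_solution c mu rho_eq h f rho0 v0 rho v /\
        (forall rho' v' : R -> R -> R,
           closed_loop_solution c mu rho_eq h f rho0 v0 rho' v' ->
           forall t x, Omega (t, x) -> rho' t x = rho t x /\ v' t x = v t x) /\
        (forall t, Rnneg t ->
           deviation rho_eq (f rho_eq) (rho t) (v t) <=
           Q (deviation rho_eq (f rho_eq) rho0 v0) t).
Proof.
  assert (hfe : 0 < f rho_eq) by (apply hf; unfold Rnneg; lra).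
  set (A := rho_eq * (c + f rho_eq)).
  assert (hA : 0 < A) by (apply Rmult_lt_0_compat; lra).
  assert (hic : 0 < / c) by (apply Rinv_0_lt_compat; auto).
  assert (hsign' : forall V, 0 <= V -> V <> f rho_eq -> (V - f (A / (c + V))) * (V - f rho_eq) > 0).
  { intros V h1 h2. specialize (hsign V h1 h2).
    replace (A / (c + V)) with (rho_eq * ((c + f rho_eq) / (c + V))) by (unfold A, Rdiv; ring). auto. }
  assert (hinlet1 : forall V, 0 < V -> h (A / (c + V)) = A / (c + V) /\ Derive_in Rnneg h (A / (c + V)) = 1).
  { apply (inlet_unsaturated c rho_max eps); auto.
    apply Rmult_le_reg_r with c; auto. unfold Rdiv. rewrite Rmult_assoc Rinv_l; [|lra].
    apply Rmult_le_compat_r with (r := c + f rho_eq) in hsmall; [|lra].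
    replace (c / (c + f rho_eq) * (rho_max - eps) * (c + f rho_eq)) with ((rho_max - eps) * c) in hsmall by (field; lra).
    unfold A. lra. }
  assert (hinlet : forall V, 0 < V -> h (rho_eq * V * ((c + f rho_eq) / (c + V)) / V) = A / (c + V)).
  { intros V hV. rewrite -(proj1 (hinlet1 V hV)). f_equal. unfold A. field. lra. }
  destruct (decay_rate_lipschitz c mu rho_eq f hc hmu hrho_eq hf) as [Ld [hLd hrate]].
  destruct (decay_flow_exists _ Ld hLd hrate) as [beta hflow].
  assert (hfl : locally_lipschitz (fun s => f (pos_part s))).
  { apply (C1_on_locally_lipschitz Rnneg); [apply pos_part_retract|apply hf]. }
  (* This constant enters Q and must precede the initial data. Hence the label value z itself is the
     variable, cut off at A e, the largest value possible when d <= 1. *)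
  destruct (outlet_accel_lipschitz c mu f (fun z => Rmin (A * exp 1) (pos_part z)) (A * exp 1) 1 hc hmu hfl)
    as [L [hL hacc]].
  { intros z. split; [|apply Rmin_l]. apply Rmin_glb; [|apply pos_part_nonneg].
    apply Rmult_le_pos; [lra|]. left; apply exp_pos. }
  { intros p q. apply Rle_trans with (1 := Rabs_Rmin_le _ _ _ _). rewrite Rminus_diag Rabs_R0 Rmult_1_l.
    apply Rmax_lub. apply Rabs_pos. apply (retract_contract _ _ pos_part_retract). }
  destruct (proj1 (proj2 (proj2 hf))) as [M hM].
  exists (deviation_bound c rho_eq f L M beta). split.
  { apply (deviation_bound_KL c mu rho_eq f L Ld M beta); auto. }
  intros rho0 v0 hst hb0 hb1.
  assert (hr0 : forall x, I01 x -> 0 < rho0 x) by (intros x hx; apply (state_space_pos _ _ _ _ _ _ hst x hx)).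
  assert (hv0 : forall x, I01 x -> 0 < v0 x) by (intros x hx; apply (state_space_pos _ _ _ _ _ _ hst x hx)).
  destruct hst as [hr0W [hv0W [_ [hv1 _]]]].
  pose proof (hv0 0 I01_0) as hv00.
  assert (hz0 : rho0 0 * (c + v0 0) = A) by (rewrite hb0; unfold A; field; lra).
  assert (hz0' : Derive_in I01 rho0 0 * (c + v0 0) + rho0 0 * Derive_in I01 v0 0 = 0).
  { rewrite hb1. field. lra. }
  destruct (travel_time_inverse c v0 hc (proj1 hv0W) hv0) as [G0 [H [G00 [H0 [dG0 [dH [HG0 G0H]]]]]]].
  pose proof (deviation_profile_data c rho_eq f rho0 v0 H hc hrho_eq hfe (proj1 hr0W) (proj1 hv0W) hr0 hv0 hz0 H0 dH)
    as hdata.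
  set (Z := fun r => rho0 (clamp01 (H r)) * (c + v0 (clamp01 (H r)))) in *.
  assert (repr : forall rho v, closed_loop_solution c mu rho_eq h f rho0 v0 rho v ->
    exists y w G, characteristic_form c mu f v0 Z rho v y w G).
  { intros rho v hs. apply (representation c mu rho_eq h f rho0 v0 G0 H rho v); auto. }
  destruct (outlet_profile c mu f rho0 v0 G0 H) as [w [dw [G [hdw [hwl [hdwl [hwp [hwi [hG0 [dG hout]]]]]]]]]]; auto.
  destruct (label_smooth c rho_eq f rho0 v0 G0 H) as [ZZ [dZZ [hdZ [hZl [hdZl hZZ]]]]]; auto.
  assert (hGi : forall x, I01 x -> G (x / c) = G0 x).
  { intros x hx. apply (label_initial c v0 G0); auto. intros z hz. apply (is_derive_eq _ _ _ _ (dG _)).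
    rewrite pos_part_id ?hwi; auto. destruct hz. apply Rdiv_le_0_compat; auto. }
  (* Labels on the road never exceed the initial one at the outlet, so [ZZ] may replace [Z] at every
     point of Omega. *)
  assert (hlabel : forall t x, Omega (t, x) -> G (t + x / c) - t <= G0 1).
  { intros t x hO. destruct (Omega_pair _ _ hO) as [ht hx].
    rewrite -hGi; [|apply I01_1].
    assert (hxc : x / c <= 1 / c) by (apply Rmult_le_compat_r; lra).
    assert (G (t + x / c) - t <= G (0 + x / c) - 0).
    { apply (derive_nonpos_le (fun t => G (t + x / c) - t) (fun t => 1 * (c / (c + w (pos_part (t + x / c)))) - 1)); auto.
      - intros s _. apply: is_derive_minus; [|apply: is_derive_id].
        apply: (is_derive_comp G (fun t => t + x / c)); auto. auto_derive; auto; ring.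
      - intros s _. pose proof (hwp _ (pos_part_nonneg (s + x / c))).
        assert (c / (c + w (pos_part (s + x / c))) <= 1); [|lra].
        apply (Rmult_le_reg_r (c + w (pos_part (s + x / c)))); [lra|].
        unfold Rdiv. rewrite Rmult_assoc Rinv_l; lra. }
    assert (G (x / c) <= G (1 / c)).
    { apply (derive_nonneg_le G (fun s => c / (c + w (pos_part s)))); auto.
      intros s _. pose proof (hwp _ (pos_part_nonneg s)). apply Rdiv_le_0_compat; lra. }
    rewrite Rplus_0_l in H1. lra. }
  assert (hG01 : 0 < G0 1).
  { rewrite -G00. apply (derive_pos_lt G0 (fun x => / (c + v0 (clamp01 x)))); auto. lra.
    intros x _. apply Rinv_0_lt_compat. pose proof (hv0 _ (clamp01_in x)). lra. }
  exists (fun t x => ZZ (G (t + x / c) - t) / (c + w (t + x / c))), (fun t x => w (t + x / c)).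
  assert (hsol : closed_loop_solution c mu rho_eq h f rho0 v0
    (fun t x => ZZ (G (t + x / c) - t) / (c + w (t + x / c))) (fun t x => w (t + x / c))).
  { apply (closed_loop_solution_of_profile c mu rho_eq h f rho0 v0 w dw G ZZ dZZ); auto.
    - intros t ht. rewrite hout; auto. rewrite hZZ; auto. apply hlabel. split; auto. apply I01_1.
    - intros r hr. rewrite hZZ; [|lra]. apply (pd_inflow _ _ _ _ _ _ hdata); auto.
    - intros x hx. rewrite hGi; auto. rewrite hZZ.
      + apply (label_G0 c rho0 v0 G0 H); auto.
      + rewrite -hGi; auto. pose proof (hlabel 0 x) as hl. rewrite Rplus_0_l Rminus_0_r in hl.
        apply hl. split; auto. simpl; unfold Rnneg; lra.
    - intros t x hO. rewrite hZZ; auto. apply Rmult_lt_0_compat. apply hr0, clamp01_in.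
      pose proof (hv0 _ (clamp01_in (H (G (t + x / c) - t)))). lra. }
  (* The constructed solution is passed through the representation, so that uniqueness and the
     estimate treat it like any other solution. *)
  destruct (repr _ _ hsol) as [y2 [w2 [G2 hcf]]].
  split; [|split]; auto.
  - intros rho' v' hsol'. destruct (repr _ _ hsol') as [y1 [w1 [G1 hcf1]]].
    (* For uniqueness the Lipschitz constant may depend on the initial data. *)
    destruct (label_bounds c rho0 v0 H) as [B [LZ [hB hLZ]]]; auto.
    destruct (outlet_accel_lipschitz c mu f Z B LZ hc hmu hfl hB hLZ) as [L' [hL' hacc']].
    apply (characteristic_form_unique c mu f v0 Z (L' + / c) rho' v' y1 w1 G1 _ _ y2 w2 G2); auto.
    + apply hv0W.
    + lra.
    + apply lipschitz2_le with L'; auto; lra.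
    + apply lipschitz2_le with (/ c); [lra|]. apply outlet_drift_lipschitz; auto.
  - intros t ht. destruct hsol as [_ [_ [hst' _]]]. specialize (hst' t ht). cbv beta in hst'.
    pose proof (state_space_pos _ _ _ _ _ _ hst') as hp. destruct hst' as [s1 [s2 _]].
    unfold deviation at 1.
    match goal with |- max01 ?a + max01 ?b <= _ => set (fr := a); set (fv := b) end.
    assert (mr : is_max01 fr (max01 fr)).
    { apply (max01_ln_correct (fun x => ZZ (G (t + x / c) - t) / (c + w (t + x / c)))); auto. apply s1. intros; apply hp; auto. }
    assert (mv : is_max01 fv (max01 fv)).
    { apply (max01_ln_correct (fun x => w (t + x / c))); auto. apply s2. intros; apply hp; auto. }
    destruct mr as [[xr [hxr er]] _]. destruct mv as [[xv [hxv ev]] _].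
    rewrite -er -ev. unfold fr, fv.
    assert (est := fun x hx => log_deviation c mu rho_eq f L Ld M beta hc hmu hrho_eq hf hsign' hM hL hacc hLd hrate hflow
      _ _ _ _ _ _ _ _ hdata hcf t x hx). cbv beta in est.
    destruct (est xr (conj ht hxr)) as [_ q1]. destruct (est xv (conj ht hxv)) as [q2 _].
    unfold deviation_bound. rewrite (pos_part_id (transient_bound _ _ _ _ _)).
    2: { apply (transient_bound_nonneg c rho_eq f L M); auto. apply (pd_nonneg _ _ _ _ _ _ hdata). }
    unfold Rdiv in q1, q2 |- *. lra.
Qed.
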